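(* Assume that $b\in\mathbb{C}$, $\Re(c)>\Re(a)>0$, $x\in\mathbb{C}$ with $x\ne1$, $|\arg(1-x)|<\pi$, and $\lambda\in\mathbb{R}$. Then for every positive integer $N$, as $|\lambda|\to\infty$, $$\Phi_1[a,b;c;x,i\lambda]=\frac{\Gamma(c)}{\Gamma(c-a)}\sum_{n=0}^{N-1}{}_2F_1\left[\begin{matrix}-n,b\\ c-a-n\end{matrix};x\right]\frac{(a)_n(a-c+1)_n}{n!}(-i\lambda)^{-a-n}+\frac{\Gamma(c)}{\Gamma(a)}e^{i\lambda}\sum_{n=0}^{N-1}{}_2F_1\left[\begin{matrix}a,b\\ a-n\end{matrix};x\right]\frac{(1-a)_n(c-a)_n}{n!}(i\lambda)^{a-c-n}+\mathcal{O}\bigl(|\lambda|^{-N}\bigr).$$ In particular, $$\Phi_1[a,b;c;x,i\lambda]\sim\frac{\Gamma(c)}{\Gamma(c-a)}(-i\lambda)^{-a}+\frac{\Gamma(c)}{\Gamma(a)}(1-x)^{-b}(i\lambda)^{a-c}e^{i\lambda}.$$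
   Context: $(\alpha)_n=\Gamma(\alpha+n)/\Gamma(\alpha)$ is the Pochhammer symbol, ${}_2F_1$ the (principal branch of the) Gauss hypergeometric function, and powers take principal values; $x$ and the parameters are fixed. The Humbert function $\Phi_1$ is defined for $|x|<1$, $y\in\mathbb{C}$ by $$\Phi_1[a,b;c;x,y]=\sum_{m,n=0}^{\infty}\frac{(a)_{m+n}(b)_m}{(c)_{m+n}}\frac{x^m}{m!}\frac{y^n}{n!},$$ and is continued analytically to all $x\in\mathbb{C}\setminus[1,\infty)$, $y\in\mathbb{C}$ by $$\Phi_1[a,b;c;x,y]=\sum_{n=0}^{\infty}\frac{(a)_n}{(c)_n}\,{}_2F_1\left[\begin{matrix}a+n,b\\ c+n\end{matrix};x\right]\frac{y^n}{n!}.$$ Exceptional parameters are understood by continuity: $(a-c+1)_n\,{}_2F_1[-n,b;c-a-n;x]$ means $\sum_{k=0}^{n}(-1)^k\frac{(-n)_k(b)_k}{k!}(a-c+1)_{n-k}x^k$ when $c-a$ is a positive integer, and $(1-a)_n\,{}_2F_1[a,b;a-n;x]$ means $(1-x)^{-b}\sum_{k=0}^{n}(-1)^k\frac{(-n)_k(b)_k}{k!}(1-a)_{n-k}\left(\frac{x}{x-1}\right)^k$ when $a$ is a positive integer. The notation $\Phi_1\sim A+B$ in the last display means that $A$ and $B$ are the leading terms of the two constituent expansions, i.e. $\Phi_1=A\,(1+\mathcal{O}(|\lambda|^{-1}))+B\,(1+\mathcal{O}(|\lambda|^{-1}))$. *)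

(* Defs.v *)
From Stdlib Require Import Reals Factorial ClassicalEpsilon.
From Coquelicot Require Import Coquelicot.

Open Scope R_scope.
Open Scope C_scope.

(* Argument in (-PI, PI] of a nonzero complex number. *)
Definition Carg (z : C) : R :=
  if Rle_dec 0 (Im z) then acos (Re z / Cmod z) else (- acos (Re z / Cmod z))%R.

Definition Cexp (z : C) : C :=
  (exp (Re z) * cos (Im z), exp (Re z) * sin (Im z))%R.

Definition Clog (z : C) : C := (ln (Cmod z), Carg z).

(* Principal value of z^w, for z <> 0. *)
Definition Cpower (z w : C) : C := Cexp (w * Clog z).

(* Euler's integral; it converges for 0 < Re z, the only values of z at which
   the Gamma function is used below. *)
Definition Gamma (z : C) : C :=
  @RInt_gen C_R_CompleteNormedModule
    (fun t : R => Cpower (RtoC t) (z - 1) * Cexp (- RtoC t))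
    (at_right 0%R) (Rbar_locally p_infty).

Definition natC (n : nat) : C := RtoC (INR n).

Definition factC (n : nat) : C := natC (fact n).

(* The product z (z + 1) ... (z + n - 1): it equals Gamma (z + n) / Gamma z
   and also makes sense at the poles z = 0, -1, -2, ... of Gamma. *)
Fixpoint poch (z : C) (n : nat) : C :=
  match n with
  | O => 1
  | S k => poch z k * (z + natC k)
  end.

Definition CSeries (u : nat -> C) : C :=
  (Series (fun n => Re (u n)), Series (fun n => Im (u n))).

(* C minus the half-line [1, +oo). *)
Definition slit_plane (z : C) : Prop := ~ (Im z = 0%R /\ (1 <= Re z)%R).

Definition analytic_at (F : C -> C) (z : C) : Prop :=
  exists (r : R) (u : nat -> C), (0 < r)%R /\
    forall w : C, (Cmod (w - z) < r)%R ->
      @is_pseries C_AbsRing C_NormedModule u (w - z) (F w).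

Definition hyp2F1_coeff (a b c : C) (n : nat) : C :=
  poch a n * poch b n / (poch c n * factC n).

Definition is_principal_hyp2F1 (a b c : C) (F : C -> C) : Prop :=
  (forall z : C, slit_plane z -> analytic_at F z) /\
  (forall z : C, (Cmod z < 1)%R ->
     @is_pseries C_AbsRing C_NormedModule (hyp2F1_coeff a b c) z (F z)).

(* For c <> 0, -1, -2, ... there is such a function and, the slit plane being
   connected, its values on the slit plane are determined. *)
Definition hyp2F1 (a b c : C) : C -> C :=
  epsilon (inhabits (fun _ : C => RtoC 0)) (is_principal_hyp2F1 a b c).

(* Single-series form of the Humbert function, valid for every x in the slit
   plane and every y. *)
Definition Phi1 (a b c x y : C) : C :=
  CSeries (fun n =>
    poch a n / poch c n * hyp2F1 (a + natC n) b (c + natC n) x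
    * (y ^ n / factC n)).

Definition is_pos_integer (z : C) : Prop :=
  exists m : nat, (0 < m)%nat /\ z = natC m.

(* (a - c + 1)_n 2F1[-n, b; c - a - n; x], understood by continuity when c - a
   is a positive integer, since then c - a - n may be a pole of 2F1. *)
Definition coeff0 (a b c x : C) (n : nat) : C :=
  if excluded_middle_informative (is_pos_integer (c - a)) then
    sum_n (fun k =>
      (-1) ^ k * (poch (- natC n) k * poch b k / factC k)
      * poch (a - c + 1) (n - k) * x ^ k) n
  else poch (a - c + 1) n * hyp2F1 (- natC n) b (c - a - natC n) x.

(* (1 - a)_n 2F1[a, b; a - n; x], understood by continuity when a is a positive
   integer, since then a - n may be a pole of 2F1. *)
Definition coeff1 (a b x : C) (n : nat) : C :=
  if excluded_middle_informative (is_pos_integer a) then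
    Cpower (1 - x) (- b) *
    sum_n (fun k =>
      (-1) ^ k * (poch (- natC n) k * poch b k / factC k)
      * poch (1 - a) (n - k) * (x / (x - 1)) ^ k) n
  else poch (1 - a) n * hyp2F1 a b (a - natC n) x.

(* f lam = O(|lam|^(-N)) as |lam| -> +oo, for real lam of either sign. *)
Definition bigO_inv_pow (N : nat) (f : R -> C) : Prop :=
  exists K L : R, (0 < L)%R /\
    forall lam : R, (L <= Rabs lam)%R -> (Cmod (f lam) <= K / Rabs lam ^ N)%R.

(* f = A (1 + O(1/|lam|)) + B (1 + O(1/|lam|)) as |lam| -> +oo. *)
Definition sim_sum (f A B : R -> C) : Prop :=
  exists e1 e2 : R -> C, bigO_inv_pow 1 e1 /\ bigO_inv_pow 1 e2 /\
    exists L : R, forall lam : R, (L <= Rabs lam)%R ->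
      f lam = A lam * (1 + e1 lam) + B lam * (1 + e2 lam).

(* Main.v *)
Require Import Defs.
From Stdlib Require Import Reals Lra Lia Factorial ClassicalEpsilon.
From Coquelicot Require Import Coquelicot.

(** By Euler's integral for the hypergeometric function, summed over the
    series that defines it, the Humbert function is
      Phi1[a,b;c;x,y] =
        1 / B(a, c - a) int_0^1 t^(a-1) (1-t)^(c-a-1) (1-xt)^(-b) e^(yt) dt
    ([Phi1_integral]). For y = i lam this is a Fourier integral of a function
    that is smooth inside (0, 1), so only the two ends contribute. Near 0 the
    integrand is t^(a-1) times a smooth function with Taylor coefficients g_k,
    and formally
      int_0^oo t^(a+k-1) e^(i lam t) dt = Gamma(a+k) (- i lam)^(-a-k),
    which gives the first sum. The reflection t -> 1 - t exchanges a and c - a,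
    replaces x by x / (x - 1) and lam by - lam, and brings out the factor
    e^(i lam) (1-x)^(-b); it turns the contribution of the end 1 into that of
    an end 0 and gives the second sum ([Phi1_expansion]).

    The error terms come from integration by parts. The class [tame] records
    power bounds, at both ends, for a function and its derivatives; it is
    stable under products, and its Fourier integrals decay like lam^(-N) once
    the exponents exceed N ([tame_fourier_decay]). A polynomial cutoff that is
    flat at both ends separates the ends ([cutoff_exists]), and the Taylor
    remainder of the regular factor belongs to the class ([tame_regular_rem]).
    The formal integral above is made exact by writing, in place of the
    cutoff, e^(-t) sum_(j<=M) t^j / j!, which is 1 up to order M + 1 at 0: its
    transform is a finite sum of Gamma(z+j) (1 - i lam)^(-z-j) / j!
    ([expsum_laplace]), and this is a Taylor polynomial of (- i lam)^(-z)
    centred at 1 - i lam ([laplace_sum_limit]).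

    The hypergeometric function is given only as some function analytic on the
    slit plane with the right series at 0, so the identity theorem
    ([principal_unique]) reduces each of its values to the exhibition of such a
    function: Euler's integral for the terms of Phi1, a polynomial for the
    first family of coefficients, and a terminating sum of
    z^k (1-z)^(-b-k), which is Pfaff's transformation, for the second
    ([euler_principal], [poly_principal], [pfaff_principal]). In the generic
    and in the exceptional case alike, the coefficients are then n! times the
    Taylor coefficients g_n ([coeff0_eq], [coeff1_eq]).

    The constants require Gamma(a) Gamma(b) = B(a,b) Gamma(a+b) and
    Gamma <> 0 on the right half-plane. Both follow from
    n^a B(a, n+b) -> Gamma(a) ([Beta_Gamma_limit]): the first by comparing
    Euler's products, the second because those products are bounded away
    from 0 ([Gamma_mult_Beta], [Gamma_neq_0]).

    For the leading behaviour one takes N > Re a + 1, so that the error is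
    smaller than the first term by a factor O(1 / lam). *)

Open Scope R_scope.
Open Scope C_scope.

(** * Complex numbers *)

Lemma C_eq (z w : C) : Re z = Re w -> Im z = Im w -> z = w.
Proof. destruct z, w; simpl; intros -> ->; reflexivity. Qed.

Lemma Cmod_sqr (z : C) : (Cmod z * Cmod z = Re z * Re z + Im z * Im z)%R.
Proof.
  unfold Cmod. rewrite sqrt_sqrt. { unfold Re, Im; ring. }
  nra.
Qed.

Lemma im_le_Cmod (z : C) : (Rabs (Im z) <= Cmod z)%R.
Proof.
  apply Rsqr_incr_0_var; [|apply Cmod_ge_0].
  unfold Rsqr. rewrite Cmod_sqr, <- Rabs_mult.
  rewrite Rabs_right; nra.
Qed.

Lemma Cmod_le_re_im (z : C) : (Cmod z <= Rabs (Re z) + Rabs (Im z))%R.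
Proof.
  apply Rsqr_incr_0_var; [|generalize (Rabs_pos (Re z)), (Rabs_pos (Im z)); lra].
  unfold Rsqr. rewrite Cmod_sqr.
  generalize (Rabs_pos (Re z)), (Rabs_pos (Im z)); intros.
  assert (E1 : (Re z * Re z = Rabs (Re z) * Rabs (Re z))%R)
    by (rewrite <- Rabs_mult, Rabs_right; nra).
  assert (E2 : (Im z * Im z = Rabs (Im z) * Rabs (Im z))%R)
    by (rewrite <- Rabs_mult, Rabs_right; nra).
  nra.
Qed.

Lemma Cmod_RtoC_pos (r : R) : (0 <= r)%R -> Cmod (RtoC r) = r.
Proof. intros; rewrite Cmod_R; apply Rabs_right; lra. Qed.

Lemma Cmod_minus_sym (z w : C) : Cmod (z - w) = Cmod (w - z).
Proof. rewrite <- Cmod_opp. f_equal. ring. Qed.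

Lemma Cmod_triangle_minus (z w : C) : (Cmod (z - w) <= Cmod z + Cmod w)%R.
Proof.
  replace (z - w) with (z + - w) by ring.
  eapply Rle_trans; [apply Cmod_triangle|]. rewrite Cmod_opp; lra.
Qed.

Lemma Cmod_triangle_rev (z w : C) : (Cmod z - Cmod w <= Cmod (z - w))%R.
Proof.
  assert (H := Cmod_triangle (z - w) w).
  replace (z - w + w) with z in H by ring. lra.
Qed.

Lemma Cexp_plus (z w : C) : Cexp (z + w) = Cexp z * Cexp w.
Proof.
  unfold Cexp. apply C_eq; unfold Re, Im; simpl.
  - rewrite exp_plus, cos_plus. ring.
  - rewrite exp_plus, sin_plus. ring.
Qed.

Lemma Cexp_0 : Cexp 0 = 1.
Proof.
  unfold Cexp. rewrite re_RtoC, im_RtoC, exp_0, cos_0, sin_0.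
  apply C_eq; unfold Re, Im; simpl; ring.
Qed.

Lemma Cmod_Cexp (z : C) : Cmod (Cexp z) = exp (Re z).
Proof.
  assert (H : (0 < exp (Re z))%R) by apply exp_pos.
  assert (S := Cmod_sqr (Cexp z)). simpl in S.
  assert (T := sin2_cos2 (Im z)). unfold Rsqr in T.
  assert (0 <= Cmod (Cexp z))%R by apply Cmod_ge_0.
  apply Rsqr_inj; [lra|lra|]. unfold Rsqr. rewrite S.
  transitivity (exp (Re z) * exp (Re z) * (sin (Im z) * sin (Im z) + cos (Im z) * cos (Im z)))%R;
    [ring|rewrite T; ring].
Qed.

Lemma Cexp_neq_0 (z : C) : Cexp z <> 0.
Proof. apply Cmod_gt_0. rewrite Cmod_Cexp. apply exp_pos. Qed.

Lemma Cexp_opp (z : C) : Cexp (- z) = / Cexp z.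
Proof.
  assert (H : Cexp (- z) * Cexp z = 1).
  { rewrite <- Cexp_plus. replace (- z + z) with (RtoC 0) by ring. apply Cexp_0. }
  rewrite <- (Cmult_1_l (/ Cexp z)), <- H. field. apply Cexp_neq_0.
Qed.

(** * Argument, logarithm and powers off the cut *)

(** Being off the half-line of nonpositive reals, in the form in which the
    half-angle formula for the argument has a positive denominator. *)
Definition offcut (z : C) : Prop := (0 < Cmod z + Re z)%R.

Lemma offcut_neq_0 (z : C) : offcut z -> z <> 0.
Proof. intros H ->. unfold offcut in H. rewrite Cmod_0 in H. simpl in H. lra. Qed.

Lemma offcut_Cmod_pos (z : C) : offcut z -> (0 < Cmod z)%R.
Proof. intros H; apply Cmod_gt_0, offcut_neq_0, H. Qed.

Lemma offcut_im (z : C) : Im z <> 0%R -> offcut z.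
Proof.
  intros H. unfold offcut.
  assert (S := Cmod_sqr z). assert (P := Cmod_ge_0 z).
  assert (0 < Im z * Im z)%R by nra. nra.
Qed.

Lemma offcut_re (z : C) : (0 < Re z)%R -> offcut z.
Proof. intros H; unfold offcut. generalize (Cmod_ge_0 z); lra. Qed.

Lemma offcut_not (z : C) : ~ offcut z -> Im z = 0%R /\ (Re z <= 0)%R.
Proof.
  intros H. split.
  - destruct (Req_dec (Im z) 0); auto. destruct H. apply offcut_im; auto.
  - destruct (Rle_lt_dec (Re z) 0); auto. destruct H. apply offcut_re; auto.
Qed.

Lemma offcut_iff (z : C) : offcut z <-> ~ (Im z = 0%R /\ (Re z <= 0)%R).
Proof.
  split.
  - intros H [H1 H2]. unfold offcut in H.
    assert (S := Cmod_sqr z). rewrite H1 in S. assert (P := Cmod_ge_0 z). nra.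
  - intros H. destruct (classic (offcut z)) as [|N]; auto.
    destruct H; apply offcut_not; auto.
Qed.

(** Used along segments issuing from 1, such as 1 - x t for t in [0, 1]. *)
Lemma offcut_star (r s : R) (z : C) : (0 <= r)%R -> (0 <= s)%R -> (0 < r + s)%R ->
  offcut z -> offcut (RtoC r + RtoC s * z).
Proof.
  intros Hr Hs Hrs Hz. rewrite offcut_iff in *. intros [H1 H2]. apply Hz.
  destruct z as [u v]; unfold Re, Im in *; simpl in *.
  destruct Hs as [Hs| <-]; [|exfalso; nra].
  split.
  - apply Rmult_eq_reg_l with s; lra.
  - nra.
Qed.

Lemma offcut_inv (z : C) : offcut z -> offcut (/ z).
Proof.
  intros Hz. assert (N := offcut_Cmod_pos z Hz). assert (S := Cmod_sqr z).
  rewrite offcut_iff in *. intros [H1 H2]. apply Hz.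
  destruct z as [u v]; unfold Re, Im in *; simpl in *.
  assert (Q : (0 < u * (u * 1) + v * (v * 1))%R) by nra.
  assert (I := Rinv_0_lt_compat _ Q).
  unfold Rdiv in *. split; nra.
Qed.

Lemma Cmod_half_angle (z : C) : offcut z ->
  (1 + (Im z / (Cmod z + Re z)) * (Im z / (Cmod z + Re z))
   = 2 * Cmod z / (Cmod z + Re z))%R.
Proof.
  intros H. assert (S := Cmod_sqr z). unfold offcut in H.
  apply Rmult_eq_reg_r with ((Cmod z + Re z) * (Cmod z + Re z))%R; [|nra].
  field_simplify; [|lra|lra]. nra.
Qed.

Lemma cos_2atan (x : R) : (cos (2 * atan x) = (1 - x * x) / (1 + x * x))%R.
Proof.
  rewrite cos_2a_cos, cos_atan.
  assert (P : (0 < 1 + x²)%R) by (unfold Rsqr; nra).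
  assert (Q := sqrt_lt_R0 _ P). assert (E := sqrt_sqrt _ (Rlt_le _ _ P)).
  unfold Rsqr in *.
  set (q := sqrt _) in *.
  replace (1 - x * x)%R with (2 - q * q)%R by lra. rewrite <- E. field. lra.
Qed.

Lemma sin_2atan (x : R) : (sin (2 * atan x) = 2 * x / (1 + x * x))%R.
Proof.
  rewrite sin_2a, sin_atan, cos_atan.
  assert (P : (0 < 1 + x²)%R) by (unfold Rsqr; nra).
  assert (Q := sqrt_lt_R0 _ P). assert (E := sqrt_sqrt _ (Rlt_le _ _ P)).
  unfold Rsqr in *.
  set (q := sqrt _) in *. rewrite <- E. field. lra.
Qed.

(** The half-angle formula is smooth across the positive half-line, where the
    definition by arccosines changes branch; it is the form that gets
    differentiated. *)
Lemma Carg_atan (z : C) : offcut z -> Carg z = (2 * atan (Im z / (Cmod z + Re z)))%R.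
Proof.
  intros H. assert (P := offcut_Cmod_pos z H).
  assert (E := Cmod_half_angle z H). unfold offcut in H.
  set (x := (Im z / (Cmod z + Re z))%R) in *.
  assert (Ec : (Re z / Cmod z = cos (2 * atan x))%R).
  { rewrite cos_2atan, E.
    replace (1 - x * x)%R with (2 - 2 * Cmod z / (Cmod z + Re z))%R by lra.
    field. lra. }
  assert (B := atan_bound x).
  unfold Carg. rewrite Ec. destruct (Rle_dec 0 (Im z)) as [I|I].
  - assert (X : (0 <= x)%R) by (apply Rdiv_le_0_compat; lra).
    assert (0 <= atan x)%R.
    { rewrite <- atan_0. destruct X as [X| <-]; [left; apply atan_increasing; auto|right; auto]. }
    apply acos_cos; lra.
  - assert (X : (x < 0)%R).
    { unfold x, Rdiv. assert (J := Rinv_0_lt_compat _ H). nra. }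
    assert (atan x < 0)%R by (rewrite <- atan_0; apply atan_increasing; auto).
    rewrite <- cos_neg, acos_cos; lra.
Qed.

Lemma Carg_bound (z : C) : (Rabs (Carg z) <= PI)%R.
Proof.
  unfold Carg. assert (B := acos_bound (Re z / Cmod z)).
  destruct (Rle_dec 0 (Im z)); [|rewrite Rabs_Ropp]; rewrite Rabs_right; lra.
Qed.

Lemma Cexp_Clog (z : C) : offcut z -> Cexp (Clog z) = z.
Proof.
  intros H. assert (P := offcut_Cmod_pos z H).
  assert (E := Cmod_half_angle z H). assert (S := Cmod_sqr z).
  unfold Cexp, Clog. simpl. rewrite exp_ln; auto. rewrite Carg_atan; auto.
  rewrite cos_2atan, sin_2atan, E. unfold offcut in H.
  apply injective_projections; simpl; change (fst z) with (Re z); change (snd z) with (Im z).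
  - replace (1 - Im z / (Cmod z + Re z) * (Im z / (Cmod z + Re z)))%R
      with (2 - 2 * Cmod z / (Cmod z + Re z))%R by lra.
    field. lra.
  - field. lra.
Qed.

Lemma Cpower_plus (z v w : C) : Cpower z (v + w) = Cpower z v * Cpower z w.
Proof. unfold Cpower. rewrite <- Cexp_plus. f_equal. ring. Qed.

Lemma Cpower_0 (z : C) : Cpower z 0 = 1.
Proof. unfold Cpower. rewrite Cmult_0_l. apply Cexp_0. Qed.

Lemma Cpower_1 (z : C) : offcut z -> Cpower z 1 = z.
Proof. intros; unfold Cpower. rewrite Cmult_1_l. apply Cexp_Clog; auto. Qed.

Lemma Cpower_opp (z w : C) : Cpower z (- w) = / Cpower z w.
Proof.
  unfold Cpower. rewrite <- Cexp_opp. f_equal. ring.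
Qed.

Lemma Cpower_neq_0 (z w : C) : Cpower z w <> 0.
Proof. apply Cexp_neq_0. Qed.

Lemma natC_S (n : nat) : natC (S n) = natC n + 1.
Proof. unfold natC. rewrite S_INR, RtoC_plus. reflexivity. Qed.

Lemma natC_0 : natC 0 = 0.
Proof. reflexivity. Qed.

Lemma Cpower_nat (z : C) (n : nat) : offcut z -> Cpower z (natC n) = z ^ n.
Proof.
  intros H; induction n as [|n IH].
  - apply Cpower_0.
  - rewrite natC_S, Cpower_plus, IH, Cpower_1; auto. rewrite Cpow_S. ring.
Qed.

Lemma Cpower_sub_nat (z w : C) (n : nat) : offcut z ->
  Cpower z (w - natC n) = Cpower z w / z ^ n.
Proof.
  intros H. unfold Cminus. rewrite Cpower_plus, Cpower_opp, Cpower_nat; auto.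
Qed.

Lemma Cpower_pred (z w : C) : offcut z -> Cpower z w = Cpower z (w - 1) * z.
Proof.
  intros H. rewrite <- (Cpower_1 z) at 3; auto. rewrite <- Cpower_plus. f_equal. ring.
Qed.

Lemma Cmod_Cpower (z w : C) :
  Cmod (Cpower z w) = exp (Re w * ln (Cmod z) - Im w * Carg z).
Proof. unfold Cpower. rewrite Cmod_Cexp. reflexivity. Qed.

Lemma Carg_pos (t : R) : (0 < t)%R -> Carg (RtoC t) = 0%R.
Proof.
  intros H. unfold Carg. simpl. destruct (Rle_dec 0 0); [|lra].
  rewrite Cmod_RtoC_pos by lra. replace (t / t)%R with 1%R by (field; lra). apply acos_1.
Qed.

Lemma Cpower_pos (t : R) (w : C) : (0 < t)%R -> Cpower (RtoC t) w = Cexp (w * RtoC (ln t)).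
Proof.
  intros H. unfold Cpower, Clog. rewrite Carg_pos, Cmod_RtoC_pos; auto; lra.
Qed.

Lemma Cmod_Cpower_pos (t : R) (w : C) : (0 < t)%R -> Cmod (Cpower (RtoC t) w) = Rpower t (Re w).
Proof.
  intros H. rewrite Cpower_pos, Cmod_Cexp; auto. unfold Rpower. f_equal.
  rewrite re_scal_r. reflexivity.
Qed.

Lemma Cpower_pos_mult (s t : R) (w : C) : (0 < s)%R -> (0 < t)%R ->
  Cpower (RtoC (s * t)) w = Cpower (RtoC s) w * Cpower (RtoC t) w.
Proof.
  intros Hs Ht. rewrite !Cpower_pos; auto; [|nra].
  rewrite <- Cexp_plus, ln_mult; auto. f_equal. rewrite RtoC_plus. ring.
Qed.

Lemma Cpower_pos_inv (t : R) (w : C) : (0 < t)%R ->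
  Cpower (RtoC (/ t)) w = Cpower (RtoC t) (- w).
Proof.
  intros Ht. rewrite !Cpower_pos; auto; [|apply Rinv_0_lt_compat; auto].
  rewrite ln_Rinv; auto. f_equal. rewrite RtoC_opp. ring.
Qed.

Lemma Cpower_one_base (w : C) : Cpower 1 w = 1.
Proof. rewrite Cpower_pos by lra. rewrite ln_1, Cmult_0_r. apply Cexp_0. Qed.

Lemma offcut_pos (t : R) : (0 < t)%R -> offcut (RtoC t).
Proof. intros; apply offcut_re; simpl; auto. Qed.

(** The argument is at most PI, so only the modulus has to be kept away from 0
    and infinity. *)
Lemma Cpower_bound (m M : R) (w : C) : (0 < m)%R ->
  exists K, (0 < K)%R /\ forall z, (m <= Cmod z <= M)%R -> (Cmod (Cpower z w) <= K)%R.
Proof.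
  intros Hm.
  exists (exp (Rabs (Re w) * (Rabs (ln m) + Rabs (ln M)) + Rabs (Im w) * PI)).
  split; [apply exp_pos|]. intros z [H1 H2].
  rewrite Cmod_Cpower.
  assert (X : (Re w * ln (Cmod z) - Im w * Carg z <=
    Rabs (Re w) * (Rabs (ln m) + Rabs (ln M)) + Rabs (Im w) * PI)%R).
  { apply Rplus_le_compat.
    - apply Rle_trans with (Rabs (Re w) * Rabs (ln (Cmod z)))%R.
      { rewrite <- Rabs_mult. apply Rle_abs. }
      apply Rmult_le_compat_l; [apply Rabs_pos|].
      assert (ln m <= ln (Cmod z))%R by (apply ln_le; lra).
      assert (ln (Cmod z) <= ln M)%R by (apply ln_le; lra).
      unfold Rabs; destruct (Rcase_abs _), (Rcase_abs _), (Rcase_abs _); lra.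
    - apply Rle_trans with (Rabs (Im w) * Rabs (Carg z))%R.
      { rewrite <- Rabs_mult, <- Rabs_Ropp. apply Rle_abs. }
      apply Rmult_le_compat_l; [apply Rabs_pos|apply Carg_bound]. }
  destruct X as [X|X]; [left; apply exp_increasing; auto|rewrite X; right; auto].
Qed.

(** * Complex-valued functions of a real variable *)

(** Both components are differentiated separately, which leaves every limit in
    the real line. *)
Definition der (f : R -> C) (t : R) (l : C) : Prop :=
  is_derive (fun s => Re (f s)) t (Re l) /\ is_derive (fun s => Im (f s)) t (Im l).

Lemma is_derive_eq (f : R -> R) (t l l' : R) : is_derive f t l -> l = l' -> is_derive f t l'.
Proof. intros H <-; exact H. Qed.

Lemma is_deriveR_mult (f g : R -> R) (t a b : R) : is_derive f t a -> is_derive g t b ->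
  is_derive (fun s => (f s * g s)%R) t (a * g t + f t * b)%R.
Proof. rewrite !is_derive_Reals. apply derivable_pt_lim_mult. Qed.

Lemma is_deriveR_plus (f g : R -> R) (t a b : R) : is_derive f t a -> is_derive g t b ->
  is_derive (fun s => (f s + g s)%R) t (a + b)%R.
Proof. rewrite !is_derive_Reals. apply derivable_pt_lim_plus. Qed.

Lemma is_deriveR_minus (f g : R -> R) (t a b : R) : is_derive f t a -> is_derive g t b ->
  is_derive (fun s => (f s - g s)%R) t (a - b)%R.
Proof. rewrite !is_derive_Reals. apply derivable_pt_lim_minus. Qed.

Lemma is_deriveR_comp (f g : R -> R) (t a b : R) : is_derive f (g t) a -> is_derive g t b ->
  is_derive (fun s => f (g s)) t (a * b)%R.
Proof.
  rewrite !is_derive_Reals. intros H1 H2. apply (derivable_pt_lim_comp g f); auto.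
Qed.

Lemma is_deriveR_const (c t : R) : is_derive (fun _ => c) t 0%R.
Proof. exact (is_derive_const (V := R_NormedModule) c t). Qed.

Lemma der_eq (f : R -> C) (t : R) (l l' : C) : der f t l -> l = l' -> der f t l'.
Proof. intros H <-; exact H. Qed.

Lemma der_ext_loc (f g : R -> C) (t : R) (l : C) :
  locally t (fun s => f s = g s) -> der f t l -> der g t l.
Proof.
  intros E [H1 H2]; split;
    [apply (is_derive_ext_loc (fun s => Re (f s)))|apply (is_derive_ext_loc (fun s => Im (f s)))];
    auto; revert E; apply filter_imp; intros s ->; reflexivity.
Qed.

Lemma der_ext (f g : R -> C) (t : R) (l : C) :
  (forall s, f s = g s) -> der f t l -> der g t l.
Proof. intros E; apply der_ext_loc, filter_forall, E. Qed.

Lemma der_unique (f : R -> C) (t : R) (l l' : C) : der f t l -> der f t l' -> l = l'.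
Proof.
  intros [H1 H2] [H3 H4]. apply is_derive_unique in H1, H2, H3, H4.
  apply C_eq; congruence.
Qed.

Lemma der_const (c : C) (t : R) : der (fun _ => c) t 0.
Proof.
  split; [exact (is_deriveR_const (Re c) t)|exact (is_deriveR_const (Im c) t)].
Qed.

Lemma der_RtoC (f : R -> R) (t l : R) : is_derive f t l -> der (fun s => RtoC (f s)) t (RtoC l).
Proof. intros H; split; [exact H|exact (is_deriveR_const 0%R t)]. Qed.

Lemma der_id (t : R) : der (fun s => RtoC s) t 1.
Proof. apply (der_RtoC (fun s => s)). exact (is_derive_id (K := R_AbsRing) t). Qed.

Lemma der_plus (f g : R -> C) (t : R) (k l : C) :
  der f t k -> der g t l -> der (fun s => f s + g s) t (k + l).
Proof.
  intros [H1 H2] [H3 H4]; split.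
  - apply (is_deriveR_plus (fun s => Re (f s)) (fun s => Re (g s))); auto.
  - apply (is_deriveR_plus (fun s => Im (f s)) (fun s => Im (g s))); auto.
Qed.

Lemma der_opp (f : R -> C) (t : R) (l : C) : der f t l -> der (fun s => - f s) t (- l).
Proof.
  intros [H1 H2]; split.
  - apply (is_derive_opp (fun s => Re (f s))); auto.
  - apply (is_derive_opp (fun s => Im (f s))); auto.
Qed.

Lemma der_minus (f g : R -> C) (t : R) (k l : C) :
  der f t k -> der g t l -> der (fun s => f s - g s) t (k - l).
Proof. intros; apply der_plus; auto; apply der_opp; auto. Qed.

Lemma der_mult (f g : R -> C) (t : R) (k l : C) :
  der f t k -> der g t l -> der (fun s => f s * g s) t (k * g t + f t * l).
Proof.
  intros [H1 H2] [H3 H4]; split.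
  - eapply is_derive_eq.
    + apply (is_deriveR_minus (fun s => (Re (f s) * Re (g s))%R) (fun s => (Im (f s) * Im (g s))%R));
        apply is_deriveR_mult; eassumption.
    + unfold Re, Im. simpl. ring.
  - eapply is_derive_eq.
    + apply (is_deriveR_plus (fun s => (Re (f s) * Im (g s))%R) (fun s => (Im (f s) * Re (g s))%R));
        apply is_deriveR_mult; eassumption.
    + unfold Re, Im. simpl. ring.
Qed.

Lemma der_scal (c : C) (f : R -> C) (t : R) (l : C) :
  der f t l -> der (fun s => c * f s) t (c * l).
Proof.
  intros H. eapply der_eq; [apply der_mult; [apply der_const|exact H]|]. cbv beta; ring.
Qed.

Lemma der_comp (f : R -> C) (u : R -> R) (t u' : R) (l : C) :
  der f (u t) l -> is_derive u t u' -> der (fun s => f (u s)) t (RtoC u' * l).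
Proof.
  intros [H1 H2] H; split.
  - eapply is_derive_eq;
      [apply (is_deriveR_comp (fun s => Re (f s)) u t _ _ H1 H)|].
    rewrite re_scal_l. ring.
  - eapply is_derive_eq;
      [apply (is_deriveR_comp (fun s => Im (f s)) u t _ _ H2 H)|].
    rewrite im_scal_l. ring.
Qed.

Lemma der_sum (f : nat -> R -> C) (l : nat -> C) (t : R) (n : nat) :
  (forall k, (k <= n)%nat -> der (f k) t (l k)) ->
  der (fun s => sum_n (fun k => f k s) n) t (sum_n l n).
Proof.
  induction n as [|n IH]; intros H.
  - rewrite sum_O. apply der_ext with (f 0%nat); [intros; now rewrite sum_O|auto].
  - rewrite sum_Sn. apply der_ext with (fun s => sum_n (fun k => f k s) n + f (S n) s);
      [intros; now rewrite sum_Sn|].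
    apply der_plus; auto.
Qed.

Lemma is_derive_continuity (f : R -> R) (t l : R) : is_derive f t l -> continuous f t.
Proof. intros H; apply (@ex_derive_continuous R_AbsRing R_NormedModule); exists l; exact H. Qed.

Definition continuousC (f : R -> C) (t : R) : Prop :=
  continuous (fun s => Re (f s)) t /\ continuous (fun s => Im (f s)) t.

Lemma der_cont (f : R -> C) (t : R) (l : C) : der f t l -> continuousC f t.
Proof. intros [H1 H2]; split; eapply is_derive_continuity; eassumption. Qed.

Lemma continuousC_plus (f g : R -> C) (t : R) : continuousC f t -> continuousC g t -> continuousC (fun s => f s + g s) t.
Proof.
  intros [H1 H2] [H3 H4]; split.
  - apply (continuous_plus (fun s => Re (f s)) (fun s => Re (g s))); auto.
  - apply (continuous_plus (fun s => Im (f s)) (fun s => Im (g s))); auto.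
Qed.

Lemma continuousC_mult (f g : R -> C) (t : R) : continuousC f t -> continuousC g t -> continuousC (fun s => f s * g s) t.
Proof.
  intros [H1 H2] [H3 H4]; split.
  - apply (continuous_minus (fun s => Re (f s) * Re (g s))%R (fun s => Im (f s) * Im (g s))%R);
      apply (continuous_mult (K := R_AbsRing)); auto.
  - apply (continuous_plus (fun s => Re (f s) * Im (g s))%R (fun s => Im (f s) * Re (g s))%R);
      apply (continuous_mult (K := R_AbsRing)); auto.
Qed.

Lemma continuousC_const (c : C) (t : R) : continuousC (fun _ => c) t.
Proof. eapply der_cont, der_const. Qed.

Lemma continuousC_ext_loc (f g : R -> C) (t : R) :
  locally t (fun s => f s = g s) -> continuousC f t -> continuousC g t.
Proof.
  intros E [H1 H2]; split;
    [apply (continuous_ext_loc _ (fun s => Re (f s)))|apply (continuous_ext_loc _ (fun s => Im (f s)))];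
    auto; revert E; apply filter_imp; intros s ->; reflexivity.
Qed.

Lemma continuousC_comp (f : R -> C) (u : R -> R) (t : R) :
  continuousC f (u t) -> continuous u t -> continuousC (fun s => f (u s)) t.
Proof.
  intros [H1 H2] H; split;
    [apply (continuous_comp u (fun s => Re (f s)))|apply (continuous_comp u (fun s => Im (f s)))]; auto.
Qed.

(** Project F on the direction of its total increment and apply the real mean
    value theorem to the difference with G. *)
Lemma mean_value_le (F f : R -> C) (G g : R -> R) (a b : R) : (a <= b)%R ->
  (forall t, (a <= t <= b)%R -> der F t (f t)) ->
  (forall t, (a <= t <= b)%R -> is_derive G t (g t)) ->
  (forall t, (a <= t <= b)%R -> (Cmod (f t) <= g t)%R) ->
  (Cmod (F b - F a) <= G b - G a)%R.
Proof.
  intros Hab HF HG Hfg.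
  set (D := F b - F a).
  assert (Hmon : forall (h : R -> R) (h' : R -> R),
    (forall t, (a <= t <= b)%R -> is_derive h t (h' t)) ->
    (forall t, (a <= t <= b)%R -> (0 <= h' t)%R) -> (h a <= h b)%R).
  { intros h h' Hd Hp.
    destruct (MVT_gen h a b h') as [c [Hc Ec]].
    - rewrite Rmin_left, Rmax_right by lra. intros; apply Hd; lra.
    - rewrite Rmin_left, Rmax_right by lra. intros x Hx.
      apply continuity_pt_filterlim. eapply is_derive_continuity, Hd; lra.
    - rewrite Rmin_left, Rmax_right in Hc by lra.
      specialize (Hp c Hc). nra. }
  assert (P := Cmod_ge_0 D).
  assert (M : (G a <= G b)%R).
  { apply (Hmon G g); auto. intros t Ht. eapply Rle_trans; [apply Cmod_ge_0|apply Hfg; auto]. }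
  destruct P as [P|P]; [|lra].
  apply Rmult_le_reg_l with (Cmod D); auto.
  assert (X := Hmon
    (fun t => (Cmod D * G t - (Re D * Re (F t) + Im D * Im (F t)))%R)
    (fun t => (Cmod D * g t - (Re D * Re (f t) + Im D * Im (f t)))%R)).
  cbv beta in X.
  assert (Y : (Cmod D * Cmod D = Re D * (Re (F b) - Re (F a)) + Im D * (Im (F b) - Im (F a)))%R).
  { rewrite Cmod_sqr. unfold D, Re, Im. simpl. ring. }
  rewrite Y.
  enough ((Cmod D * G a - (Re D * Re (F a) + Im D * Im (F a)) <=
     Cmod D * G b - (Re D * Re (F b) + Im D * Im (F b)))%R) by lra.
  apply X.
  - intros t Ht. destruct (HF t Ht) as [F1 F2]. specialize (HG t Ht).
    apply (is_deriveR_minus (fun t => Cmod D * G t)%R (fun t => (Re D * Re (F t) + Im D * Im (F t))%R)).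
    { apply is_derive_scal; auto. }
    apply (is_deriveR_plus (fun t => Re D * Re (F t))%R (fun t => (Im D * Im (F t))%R));
      apply is_derive_scal; auto.
  - intros t Ht. specialize (Hfg t Ht).
    assert (Z : (Re D * Re (f t) + Im D * Im (f t) <= Cmod D * Cmod (f t))%R).
    { replace (Re D * Re (f t) + Im D * Im (f t))%R with (Re (Cconj D * f t))
        by (unfold Re, Im; simpl; ring).
      eapply Rle_trans; [apply Rle_abs|]. eapply Rle_trans; [apply re_le_Cmod|].
      rewrite Cmod_mult, Cmod_conj. lra. }
    nra.
Qed.

Lemma der_zero_const (F : R -> C) (a b : R) : (a <= b)%R ->
  (forall t, (a <= t <= b)%R -> der F t 0) -> F a = F b.
Proof.
  intros Hab H. symmetry. apply Ceq_minus, Cmod_eq_0.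
  apply Rle_antisym; [|apply Cmod_ge_0].
  eapply Rle_trans; [apply (mean_value_le F (fun _ => 0) (fun _ => 0%R) (fun _ => 0%R)); auto|].
  - intros t _; exact (is_deriveR_const 0%R t).
  - intros; rewrite Cmod_0; lra.
  - lra.
Qed.

Lemma der_Cexp (f : R -> C) (t : R) (l : C) :
  der f t l -> der (fun s => Cexp (f s)) t (l * Cexp (f t)).
Proof.
  intros [H1 H2]; split; simpl.
  - eapply is_derive_eq.
    + apply is_deriveR_mult.
      * apply (is_deriveR_comp exp (fun s => Re (f s))); [apply is_derive_exp|exact H1].
      * apply (is_deriveR_comp cos (fun s => Im (f s))); [apply is_derive_cos|exact H2].
    + unfold Re, Im. simpl. ring.
  - eapply is_derive_eq.
    + apply is_deriveR_mult.
      * apply (is_deriveR_comp exp (fun s => Re (f s))); [apply is_derive_exp|exact H1].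
      * apply (is_deriveR_comp sin (fun s => Im (f s))); [apply is_derive_sin|exact H2].
    + unfold Re, Im. simpl. ring.
Qed.

Lemma is_derive_Cmod (f : R -> C) (t : R) (l : C) : f t <> 0 -> der f t l ->
  is_derive (fun s => Cmod (f s)) t ((Re (f t) * Re l + Im (f t) * Im l) / Cmod (f t))%R.
Proof.
  intros N [H1 H2]. assert (P := proj1 (Cmod_gt_0 _) N). assert (S := Cmod_sqr (f t)).
  set (u := fun s => Re (f s)) in *. set (v := fun s => Im (f s)) in *.
  change (Re (f t)) with (u t) in *. change (Im (f t)) with (v t) in *.
  apply (is_derive_ext (fun s => sqrt (u s ^ 2 + v s ^ 2))); [reflexivity|].
  assert (E : Cmod (f t) = sqrt (u t ^ 2 + v t ^ 2)) by reflexivity.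
  eapply is_derive_eq.
  - auto_derive; [|reflexivity].
    repeat split.
    + exists (Re l); exact H1.
    + exists (Im l); exact H2.
    + assert (0 < Cmod (f t) * Cmod (f t))%R by nra. lra.
  - replace (Derive (fun x => u x) t) with (Re l) by (symmetry; apply is_derive_unique; exact H1).
    replace (Derive (fun x => v x) t) with (Im l) by (symmetry; apply is_derive_unique; exact H2).
    replace (u t * (u t * 1) + v t * (v t * 1))%R with (u t ^ 2 + v t ^ 2)%R by ring.
    rewrite <- E. field. lra.
Qed.

Lemma der_Clog (f : R -> C) (t : R) (l : C) : offcut (f t) -> der f t l ->
  der (fun s => Clog (f s)) t (l / f t).
Proof.
  intros Ho Hd. assert (N := offcut_neq_0 _ Ho). assert (P := offcut_Cmod_pos _ Ho).
  assert (HM := is_derive_Cmod f t l N Hd). assert (S := Cmod_sqr (f t)).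
  assert (O := Ho). unfold offcut in O.
  assert (L : locally t (fun s => offcut (f s))).
  { assert (CC : continuous (fun s => (Cmod (f s) + Re (f s))%R) t).
    { eapply is_derive_continuity.
      apply (is_deriveR_plus (fun s => Cmod (f s)) (fun s => Re (f s))); [exact HM|apply Hd]. }
    apply CC. exists (mkposreal _ O). intros y Hy.
    unfold ball in Hy; simpl in Hy. unfold AbsRing_ball, abs, minus, plus, opp in Hy; simpl in Hy.
    apply Rabs_def2 in Hy. lra. }
  assert (Ere : (Re (l / f t) = (Re (f t) * Re l + Im (f t) * Im l) / (Cmod (f t) * Cmod (f t)))%R).
  { rewrite S. unfold Re, Im. destruct (f t) as [u v], l as [p q]. simpl in *. field.
    unfold Re, Im in S; simpl in S. nra. }
  assert (Eim : (Im (l / f t) = (Re (f t) * Im l - Im (f t) * Re l) / (Cmod (f t) * Cmod (f t)))%R).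
  { rewrite S. unfold Re, Im. destruct (f t) as [u v], l as [p q]. simpl in *. field.
    unfold Re, Im in S; simpl in S. nra. }
  assert (HM' := HM). destruct Hd as [H1 H2]. split.
  - change (is_derive (fun s => ln (Cmod (f s))) t (Re (l / f t))). eapply is_derive_eq.
    + apply (is_deriveR_comp ln (fun s => Cmod (f s))); [apply is_derive_ln; auto|exact HM].
    + rewrite Ere. field. lra.
  - apply (is_derive_ext_loc (fun s => (2 * atan (Im (f s) / (Cmod (f s) + Re (f s))))%R)).
    { revert L. apply filter_imp. intros s Hs. simpl. symmetry. apply Carg_atan; auto. }
    set (u := fun s => Re (f s)) in *. set (v := fun s => Im (f s)) in *.
    set (r := fun s => Cmod (f s)) in *.
    rewrite Eim.
    change (Re (f t)) with (u t) in *. change (Im (f t)) with (v t) in *.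
    change (Cmod (f t)) with (r t) in *.
    apply (is_derive_ext (fun s => (2 * atan (v s / (r s + u s)))%R)); [reflexivity|].
    eapply is_derive_eq.
    + auto_derive; [|reflexivity]. repeat split.
      * exists (Im l); exact H2.
      * exists ((u t * Re l + v t * Im l) / r t)%R; exact HM.
      * exists (Re l); exact H1.
      * lra.
    + replace (Derive (fun x => u x) t) with (Re l) by (symmetry; apply is_derive_unique; exact H1).
      replace (Derive (fun x => v x) t) with (Im l) by (symmetry; apply is_derive_unique; exact H2).
      replace (Derive (fun x => r x) t) with ((u t * Re l + v t * Im l) / r t)%R
        by (symmetry; apply is_derive_unique; exact HM).
      set (U := u t) in *; set (W := v t) in *; set (Q := r t) in *.
      assert (E1 : (1 + W / (Q + U) * (W / (Q + U)) = 2 * Q / (Q + U))%R).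
      { apply (Cmod_half_angle (f t) Ho). }
      replace (W * / (Q + U))%R with (W / (Q + U))%R by reflexivity.
      replace (1 + (W / (Q + U)) * ((W / (Q + U)) * 1))%R with (2 * Q / (Q + U))%R
        by (rewrite <- E1; ring).
      assert (EW : (W * W = Q * Q - U * U)%R) by lra.
      apply Rmult_eq_reg_r with (Q * Q * (Q + U))%R; [|assert (0 < Q * Q * (Q + U))%R by (apply Rmult_lt_0_compat; nra); lra].
      transitivity (Im l * Q * (Q + U) - W * U * Re l - (W * W) * Im l - W * Re l * Q)%R;
        [field; lra|rewrite EW; field; lra].
Qed.

Lemma der_Cpower (f : R -> C) (t : R) (l w : C) : offcut (f t) -> der f t l ->
  der (fun s => Cpower (f s) w) t (w * l * Cpower (f t) (w - 1)).
Proof.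
  intros Ho Hd. assert (N := offcut_neq_0 _ Ho).
  eapply der_eq.
  - apply (der_Cexp (fun s => w * Clog (f s))), der_scal, der_Clog; eauto.
  - cbv beta. fold (Cpower (f t) w). rewrite (Cpower_pred (f t) w Ho). field. exact N.
Qed.

Lemma der_Cpower_pos (t : R) (w : C) : (0 < t)%R ->
  der (fun s => Cpower (RtoC s) w) t (w * Cpower (RtoC t) (w - 1)).
Proof.
  intros H. eapply der_eq.
  - apply der_Cpower; [apply offcut_pos; exact H|apply der_id].
  - ring.
Qed.

Lemma der_pow (f : R -> C) (t : R) (l : C) (n : nat) : der f t l ->
  der (fun s => f s ^ n) t (natC n * l * f t ^ (n - 1)).
Proof.
  intros H. induction n as [|n IH].
  - apply der_ext with (fun _ => RtoC 1); [reflexivity|].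
    replace (natC 0 * l * f t ^ (0 - 1)) with (RtoC 0) by (rewrite natC_0; ring). apply der_const.
  - apply der_ext with (fun s => f s * f s ^ n); [intros; now rewrite Cpow_S|].
    eapply der_eq; [apply der_mult; [exact H|exact IH]|]. cbv beta.
    rewrite natC_S. destruct n as [|n].
    + rewrite natC_0. simpl. ring.
    + replace (S (S n) - 1)%nat with (S n) by lia. replace (S n - 1)%nat with n by lia.
      rewrite Cpow_S. ring.
Qed.

(** * Improper integrals by antiderivatives *)

Lemma ball_Rabs (x eps y : R) : ball x eps y -> (Rabs (y - x) < eps)%R.
Proof. intros H; exact H. Qed.

(** [Unit] stands for (0, 1) and [Half] for (0, +oo), the only two ranges of
    integration that occur. *)
Inductive itv : Set := Unit | Half.

Definition dom (i : itv) (t : R) : Prop :=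
  match i with Unit => (0 < t < 1)%R | Half => (0 < t)%R end.

Definition hi_end (i : itv) : (R -> Prop) -> Prop :=
  match i with Unit => at_left 1 | Half => Rbar_locally p_infty end.

Global Instance hi_end_proper (i : itv) : ProperFilter (hi_end i).
Proof. destruct i; simpl; typeclasses eauto. Qed.

Definition lim_at {T : Type} (Fl : (T -> Prop) -> Prop) (F : T -> C) (A : C) : Prop :=
  filterlim (fun t => Re (F t)) Fl (locally (Re A)) /\
  filterlim (fun t => Im (F t)) Fl (locally (Im A)).

(** The integrals below have continuous integrands with singular ends.
    Defining them by an antiderivative makes the fundamental theorem,
    integration by parts and changes of variable immediate; only the existence
    of an antiderivative with limits has to be proved, by domination. *)
Definition nint (i : itv) (f : R -> C) (v : C) : Prop :=
  exists (F : R -> C) (A B : C),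
    (forall t, dom i t -> der F t (f t)) /\
    lim_at (at_right 0%R) F A /\ lim_at (hi_end i) F B /\ v = B - A.

Definition integrable (i : itv) (f : R -> C) : Prop := exists v, nint i f v.

Definition Nint (i : itv) (f : R -> C) : C := epsilon (inhabits (RtoC 0)) (nint i f).

Lemma Nint_spec (i : itv) (f : R -> C) : integrable i f -> nint i f (Nint i f).
Proof. intros H. exact (epsilon_spec _ (nint i f) H). Qed.

Lemma lo_dom (i : itv) : at_right 0%R (dom i).
Proof.
  exists (mkposreal 1 Rlt_0_1). intros y Hy Hp.
  apply ball_Rabs in Hy. simpl in Hy.
  apply Rabs_def2 in Hy. destruct i; simpl; lra.
Qed.

Lemma hi_dom (i : itv) : hi_end i (dom i).
Proof.
  destruct i; simpl.
  - exists (mkposreal 1 Rlt_0_1). intros y Hy Hp.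
    apply ball_Rabs in Hy. simpl in Hy.
    apply Rabs_def2 in Hy. repeat split; lra.
  - exists 0%R. auto.
Qed.

Lemma dom_open (i : itv) (t : R) : dom i t -> locally t (dom i).
Proof.
  assert (L : forall a, (a < t)%R -> locally t (fun s => (a < s)%R)) by (intros; apply (open_gt a t); auto).
  assert (U : forall a, (t < a)%R -> locally t (fun s => (s < a)%R)) by (intros; apply (open_lt a t); auto).
  destruct i; simpl; intros H.
  - apply filter_and; [apply L|apply U]; lra.
  - apply L; auto.
Qed.

Lemma dom_convex (i : itv) (a b t : R) : dom i a -> dom i b -> (a <= t <= b)%R -> dom i t.
Proof. destruct i; simpl; lra. Qed.

Lemma dom_half (i : itv) : dom i (1 / 2).
Proof. destruct i; simpl; lra. Qed.

Lemma lim_const {T : Type} (Fl : (T -> Prop) -> Prop) {FF : Filter Fl} (c : C) : lim_at Fl (fun _ => c) c.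
Proof. split; apply filterlim_const. Qed.

Lemma lim_ext {T : Type} (Fl : (T -> Prop) -> Prop) {FF : Filter Fl} (F G : T -> C) (A : C) :
  Fl (fun t => F t = G t) -> lim_at Fl F A -> lim_at Fl G A.
Proof.
  intros E [H1 H2]; split; [eapply filterlim_ext_loc, H1|eapply filterlim_ext_loc, H2];
    revert E; apply filter_imp; intros t ->; reflexivity.
Qed.

Lemma limR_plus {T : Type} (Fl : (T -> Prop) -> Prop) {FF : Filter Fl} (F G : T -> R) (A B : R) :
  filterlim F Fl (locally A) -> filterlim G Fl (locally B) ->
  filterlim (fun t => (F t + G t)%R) Fl (locally (A + B)%R).
Proof.
  intros H1 H2. eapply filterlim_comp_2; [exact H1|exact H2|].
  apply (filterlim_plus (V := R_NormedModule)).
Qed.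

Lemma limR_mult {T : Type} (Fl : (T -> Prop) -> Prop) {FF : Filter Fl} (F G : T -> R) (A B : R) :
  filterlim F Fl (locally A) -> filterlim G Fl (locally B) ->
  filterlim (fun t => (F t * G t)%R) Fl (locally (A * B)%R).
Proof.
  intros H1 H2. eapply filterlim_comp_2; [exact H1|exact H2|].
  apply (filterlim_mult (K := R_AbsRing)).
Qed.

Lemma limR_opp {T : Type} (Fl : (T -> Prop) -> Prop) {FF : Filter Fl} (F : T -> R) (A : R) :
  filterlim F Fl (locally A) -> filterlim (fun t => (- F t)%R) Fl (locally (- A)%R).
Proof.
  intros H1. eapply filterlim_comp; [exact H1|].
  apply (filterlim_opp (V := R_NormedModule)).
Qed.

Lemma limR_minus {T : Type} (Fl : (T -> Prop) -> Prop) {FF : Filter Fl} (F G : T -> R) (A B : R) :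
  filterlim F Fl (locally A) -> filterlim G Fl (locally B) ->
  filterlim (fun t => (F t - G t)%R) Fl (locally (A - B)%R).
Proof. intros H1 H2. apply limR_plus; auto. apply limR_opp; auto. Qed.

Lemma lim_plus {T : Type} (Fl : (T -> Prop) -> Prop) {FF : Filter Fl} (F G : T -> C) (A B : C) :
  lim_at Fl F A -> lim_at Fl G B -> lim_at Fl (fun t => F t + G t) (A + B).
Proof. intros [H1 H2] [H3 H4]; split; apply limR_plus; auto. Qed.

Lemma lim_mult {T : Type} (Fl : (T -> Prop) -> Prop) {FF : Filter Fl} (F G : T -> C) (A B : C) :
  lim_at Fl F A -> lim_at Fl G B -> lim_at Fl (fun t => F t * G t) (A * B).
Proof.
  intros [H1 H2] [H3 H4]; split.
  - apply (limR_minus Fl); apply (limR_mult Fl); auto.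
  - apply (limR_plus Fl); apply (limR_mult Fl); auto.
Qed.

Lemma lim_scal {T : Type} (Fl : (T -> Prop) -> Prop) {FF : Filter Fl} (c : C) (F : T -> C) (A : C) :
  lim_at Fl F A -> lim_at Fl (fun t => c * F t) (c * A).
Proof. intros H; apply (lim_mult Fl (fun _ => c)); auto. apply lim_const; auto. Qed.

Lemma lim_minus {T : Type} (Fl : (T -> Prop) -> Prop) {FF : Filter Fl} (F G : T -> C) (A B : C) :
  lim_at Fl F A -> lim_at Fl G B -> lim_at Fl (fun t => F t - G t) (A - B).
Proof. intros [H1 H2] [H3 H4]; split; apply limR_minus; auto. Qed.

Lemma limR_eps {T : Type} (Fl : (T -> Prop) -> Prop) {FF : Filter Fl} (F : T -> R) (A : R) :
  filterlim F Fl (locally A) <-> forall eps, (0 < eps)%R -> Fl (fun t => (Rabs (F t - A) < eps)%R).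
Proof.
  split.
  - intros H eps He. apply (H (fun y => (Rabs (y - A) < eps)%R)).
    exists (mkposreal _ He). intros y Hy. exact Hy.
  - intros H P [eps HP]. unfold filtermap. generalize (H eps (cond_pos eps)). apply filter_imp.
    intros t Ht. apply HP. exact Ht.
Qed.

Lemma lim_eps {T : Type} (Fl : (T -> Prop) -> Prop) {FF : Filter Fl} (F : T -> C) (A : C) :
  lim_at Fl F A <-> forall eps, (0 < eps)%R -> Fl (fun t => (Cmod (F t - A) < eps)%R).
Proof.
  split.
  - intros [H1 H2] eps He. rewrite (limR_eps Fl) in H1, H2.
    assert (He2 : (0 < eps / 2)%R) by lra.
    generalize (filter_and _ _ (H1 _ He2) (H2 _ He2)). apply filter_imp.
    intros t [X Y]. eapply Rle_lt_trans; [apply Cmod_le_re_im|].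
    change (Re (F t - A)) with (Re (F t) - Re A)%R.
    change (Im (F t - A)) with (Im (F t) - Im A)%R. lra.
  - intros H; split; rewrite (limR_eps Fl); intros eps He; generalize (H eps He);
      apply filter_imp; intros t Ht; eapply Rle_lt_trans; [|exact Ht| |exact Ht].
    + apply (re_le_Cmod (F t - A)).
    + apply (im_le_Cmod (F t - A)).
Qed.

Lemma lim_Cmod {T : Type} (Fl : (T -> Prop) -> Prop) {FF : Filter Fl} (F : T -> C) (A : C) :
  lim_at Fl F A -> filterlim (fun t => Cmod (F t)) Fl (locally (Cmod A)).
Proof.
  rewrite (lim_eps Fl), (limR_eps Fl). intros H eps He. generalize (H eps He). apply filter_imp.
  intros t Ht. eapply Rle_lt_trans; [|exact Ht].
  assert (X := Cmod_triangle_rev (F t) A). assert (Y := Cmod_triangle_rev A (F t)).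
  rewrite Cmod_minus_sym in Y. apply Rabs_le; lra.
Qed.

Lemma lim_squeeze {T : Type} (Fl : (T -> Prop) -> Prop) {FF : Filter Fl} (F : T -> C) (g : T -> R) :
  Fl (fun t => (Cmod (F t) <= g t)%R) -> filterlim g Fl (locally 0%R) -> lim_at Fl F 0.
Proof.
  rewrite (lim_eps Fl), (limR_eps Fl). intros H1 H2 eps He.
  generalize (filter_and _ _ H1 (H2 eps He)). apply filter_imp. intros t [X Y].
  replace (F t - 0) with (F t) by ring. apply Rabs_def2 in Y. lra.
Qed.

Lemma limR_le {T : Type} (Fl : (T -> Prop) -> Prop) {FF : ProperFilter Fl} (F G : T -> R) (A B : R) :
  Fl (fun t => (F t <= G t)%R) -> filterlim F Fl (locally A) -> filterlim G Fl (locally B) ->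
  (A <= B)%R.
Proof.
  intros H H1 H2. apply Rnot_lt_le. intros N.
  rewrite (limR_eps Fl) in H1, H2. assert (E : (0 < (A - B) / 2)%R) by lra.
  destruct (filter_ex _ (filter_and _ _ H (filter_and _ _ (H1 _ E) (H2 _ E)))) as [t [X [Y Z]]].
  apply Rabs_def2 in Y, Z. lra.
Qed.

Lemma limR_unique {T : Type} (Fl : (T -> Prop) -> Prop) {FF : ProperFilter Fl} (F : T -> R) (A B : R) :
  filterlim F Fl (locally A) -> filterlim F Fl (locally B) -> A = B.
Proof. intros H1 H2; apply Rle_antisym; eapply limR_le; eauto; apply filter_forall; intros; lra. Qed.

Lemma lim_unique {T : Type} (Fl : (T -> Prop) -> Prop) {FF : ProperFilter Fl} (F : T -> C) (A B : C) :
  lim_at Fl F A -> lim_at Fl F B -> A = B.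
Proof. intros [H1 H2] [H3 H4]; apply C_eq; eapply limR_unique; eassumption. Qed.

Lemma der_zero_dom (i : itv) (F : R -> C) : (forall t, dom i t -> der F t 0) ->
  forall t, dom i t -> F t = F (1 / 2)%R.
Proof.
  intros H t Ht. destruct (Rle_dec t (1 / 2)).
  - apply der_zero_const; auto. intros s Hs. apply H. eapply dom_convex; [| |exact Hs]; auto.
    apply dom_half.
  - symmetry. apply der_zero_const; [lra|]. intros s Hs. apply H.
    eapply dom_convex; [| |exact Hs]; auto. apply dom_half.
Qed.

Lemma nint_unique (i : itv) (f : R -> C) (u v : C) : nint i f u -> nint i f v -> u = v.
Proof.
  intros (F & A & B & HF & HA & HB & ->) (G & A' & B' & HG & HA' & HB' & ->).
  assert (D : forall t, dom i t -> F t - G t = F (1/2)%R - G (1/2)%R).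
  { intros t Ht. apply (der_zero_dom i (fun t => F t - G t)); auto.
    intros s Hs. eapply der_eq; [apply der_minus; eauto|]. ring. }
  assert (EA : A - A' = F (1/2)%R - G (1/2)%R).
  { apply (lim_unique (at_right 0%R) (fun t => F t - G t)).
    - apply lim_minus; auto; typeclasses eauto.
    - apply lim_ext with (fun _ => F (1/2)%R - G (1/2)%R); [typeclasses eauto| |apply lim_const; typeclasses eauto].
      generalize (lo_dom i). apply filter_imp. intros t Ht; symmetry; apply D; exact Ht. }
  assert (EB : B - B' = F (1/2)%R - G (1/2)%R).
  { apply (lim_unique (hi_end i) (fun t => F t - G t)).
    - apply lim_minus; auto; typeclasses eauto.
    - apply lim_ext with (fun _ => F (1/2)%R - G (1/2)%R); [typeclasses eauto| |apply lim_const; typeclasses eauto].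
      generalize (hi_dom i). apply filter_imp. intros t Ht; symmetry; apply D; exact Ht. }
  replace B with (B' + (A - A')) by (rewrite EA, <- EB; ring). ring.
Qed.

Lemma Nint_eq (i : itv) (f : R -> C) (v : C) : nint i f v -> Nint i f = v.
Proof. intros H. apply (nint_unique i f); auto. apply Nint_spec. exists v; auto. Qed.

Lemma nint_ext (i : itv) (f g : R -> C) (v : C) :
  (forall t, dom i t -> f t = g t) -> nint i f v -> nint i g v.
Proof.
  intros E (F & A & B & HF & H). exists F, A, B. split; auto.
  intros t Ht. rewrite <- E; auto.
Qed.

Lemma nint_plus (i : itv) (f g : R -> C) (u v : C) :
  nint i f u -> nint i g v -> nint i (fun t => f t + g t) (u + v).
Proof.
  intros (F & A & B & HF & HA & HB & ->) (G & A' & B' & HG & HA' & HB' & ->).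
  exists (fun t => F t + G t), (A + A'), (B + B'). split; [|split; [|split]].
  - intros; apply der_plus; auto.
  - apply lim_plus; auto; typeclasses eauto.
  - apply lim_plus; auto; typeclasses eauto.
  - ring.
Qed.

Lemma nint_scal (i : itv) (c : C) (f : R -> C) (v : C) :
  nint i f v -> nint i (fun t => c * f t) (c * v).
Proof.
  intros (F & A & B & HF & HA & HB & ->).
  exists (fun t => c * F t), (c * A), (c * B). split; [|split; [|split]].
  - intros; apply der_scal; auto.
  - apply lim_scal; auto; typeclasses eauto.
  - apply lim_scal; auto; typeclasses eauto.
  - ring.
Qed.

Lemma nint_minus (i : itv) (f g : R -> C) (u v : C) :
  nint i f u -> nint i g v -> nint i (fun t => f t - g t) (u - v).
Proof.
  intros H1 H2. replace (u - v) with (u + (-1) * v) by ring.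
  apply nint_ext with (fun t => f t + (-1) * g t); [intros; ring|].
  apply nint_plus; auto. apply nint_scal; auto.
Qed.

Lemma nint_sum (i : itv) (f : nat -> R -> C) (v : nat -> C) (n : nat) :
  (forall k, (k <= n)%nat -> nint i (f k) (v k)) ->
  nint i (fun t => sum_n (fun k => f k t) n) (sum_n v n).
Proof.
  induction n as [|n IH]; intros H.
  - rewrite sum_O. apply nint_ext with (f 0%nat); [intros; now rewrite sum_O|auto].
  - rewrite sum_Sn. apply nint_ext with (fun t => sum_n (fun k => f k t) n + f (S n) t);
      [intros; now rewrite sum_Sn|].
    apply nint_plus; auto.
Qed.

Lemma nint_der_zero (i : itv) (F f : R -> C) :
  (forall t, dom i t -> der F t (f t)) ->
  lim_at (at_right 0%R) F 0 -> lim_at (hi_end i) F 0 -> nint i f 0.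
Proof. intros H1 H2 H3. exists F, 0, 0. split; [|split; [|split]]; auto. ring. Qed.

Lemma antiderivative_le (i : itv) (F f : R -> C) (G g : R -> R) :
  (forall t, dom i t -> der F t (f t)) ->
  (forall t, dom i t -> is_derive G t (g t)) ->
  (forall t, dom i t -> (Cmod (f t) <= g t)%R) ->
  forall s t, dom i s -> dom i t -> (Cmod (F t - F s) <= Rabs (G t - G s))%R.
Proof.
  intros HF HG Hfg s t Hs Ht. destruct (Rle_dec s t) as [L|L].
  - eapply Rle_trans; [|apply Rle_abs].
    apply (mean_value_le F f G g); auto; intros u Hu; assert (dom i u) by (apply (dom_convex i s t); auto); auto.
  - rewrite Cmod_minus_sym, Rabs_minus_sym. eapply Rle_trans; [|apply Rle_abs].
    apply (mean_value_le F f G g); [lra| | |]; intros u Hu;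
      assert (dom i u) by (apply (dom_convex i t s); auto; lra); auto.
Qed.

(** The increments of an antiderivative of f are bounded by those of G. *)
Lemma nint_le (i : itv) (f : R -> C) (v : C) (G g : R -> R) (a b : R) :
  nint i f v ->
  (forall t, dom i t -> is_derive G t (g t)) ->
  (forall t, dom i t -> (Cmod (f t) <= g t)%R) ->
  filterlim G (at_right 0%R) (locally a) -> filterlim G (hi_end i) (locally b) ->
  (Cmod v <= b - a)%R.
Proof.
  intros (F & A & B & HF & HA & HB & ->) HG Hfg Ha Hb.
  (* the bound on increments is passed to the limit one end at a time *)
  assert (X : forall s, dom i s -> (Cmod (B - F s) <= b - G s)%R).
  { intros s Hs.
    apply (limR_le (hi_end i) (fun t => Cmod (F t - F s)) (fun t => (G t - G s)%R)).
    - assert (Hgt : hi_end i (fun t => (s <= t)%R)).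
      { destruct i; simpl in *.
        - assert (P : (0 < 1 - s)%R) by lra. exists (mkposreal _ P). intros y Hy _.
          apply ball_Rabs in Hy. simpl in Hy.
          apply Rabs_def2 in Hy. lra.
        - exists s. intros; lra. }
      generalize (filter_and _ _ Hgt (hi_dom i)). apply filter_imp. intros t [Hst Ht].
      apply (mean_value_le F f G g); auto; intros u Hu;
        assert (dom i u) by (apply (dom_convex i s t); auto; lra); auto.
    - apply lim_Cmod; [typeclasses eauto|]. apply lim_minus; auto; try typeclasses eauto.
      apply lim_const; typeclasses eauto.
    - apply limR_minus; auto; try typeclasses eauto. apply filterlim_const. }
  apply (limR_le (at_right 0%R) (fun s => Cmod (B - F s)) (fun s => (b - G s)%R)).
  - generalize (lo_dom i). apply filter_imp. exact X.
  - apply lim_Cmod; [typeclasses eauto|]. apply lim_minus; auto; try typeclasses eauto.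
    apply lim_const; typeclasses eauto.
  - apply limR_minus; auto; try typeclasses eauto. apply filterlim_const.
Qed.

Lemma limR_exists {T : Type} (Fl : (T -> Prop) -> Prop) {FF : ProperFilter Fl} (D : T -> Prop) (F G : T -> R) (a : R) :
  Fl D -> (forall s t, D s -> D t -> (Rabs (F t - F s) <= Rabs (G t - G s))%R) ->
  filterlim G Fl (locally a) -> exists A, filterlim F Fl (locally A).
Proof.
  intros HD H HG.
  apply (filterlim_locally_cauchy (U := R_CompleteSpace)).
  intros eps.
  destruct (proj2 (filterlim_locally_cauchy (U := R_CompleteSpace) (F := Fl) G) (ex_intro _ a HG) eps)
    as [P [HP Hc]].
  exists (fun t => P t /\ D t). split; [apply filter_and; auto|].
  intros u v [Pu Du] [Pv Dv]. specialize (Hc u v Pu Pv).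
  eapply Rle_lt_trans; [apply (H u v); auto|exact Hc].
Qed.

Lemma antiderivative_exists (i : itv) (f : R -> R) :
  (forall t, dom i t -> continuous f t) ->
  forall t, dom i t -> is_derive (fun s => RInt f (1 / 2) s) t (f t).
Proof.
  intros H t Ht. apply (is_derive_RInt f (fun s => RInt f (1 / 2) s) (1 / 2) t); [|apply H; auto].
  generalize (dom_open i t Ht). apply filter_imp. intros s Hs.
  apply (RInt_correct (V := R_CompleteNormedModule)), (ex_RInt_continuous (V := R_CompleteNormedModule)).
  intros z Hz. apply H.
  assert (P := dom_half i).
  destruct (Rle_dec (1 / 2) s).
  - rewrite Rmin_left, Rmax_right in Hz by lra. eapply dom_convex; [| |exact Hz]; auto.
  - rewrite Rmin_right, Rmax_left in Hz by lra. eapply dom_convex; [| |exact Hz]; auto.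
Qed.

(** The antiderivative based at 1/2 satisfies Cauchy's criterion at both ends
    because G does. *)
Lemma nint_exists (i : itv) (f : R -> C) (G g : R -> R) (a b : R) :
  (forall t, dom i t -> continuousC f t) ->
  (forall t, dom i t -> is_derive G t (g t)) ->
  (forall t, dom i t -> (Cmod (f t) <= g t)%R) ->
  filterlim G (at_right 0%R) (locally a) -> filterlim G (hi_end i) (locally b) ->
  integrable i f.
Proof.
  intros Hc HG Hfg Ha Hb.
  set (F := fun s => (RInt (fun t => Re (f t)) (1 / 2) s, RInt (fun t => Im (f t)) (1 / 2) s) : C).
  assert (HF : forall t, dom i t -> der F t (f t)).
  { intros t Ht. split; apply (antiderivative_exists i); auto; intros; apply Hc; auto. }
  assert (Hle := antiderivative_le i F f G g HF HG Hfg).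
  assert (Hre : forall s t, dom i s -> dom i t -> (Rabs (Re (F t) - Re (F s)) <= Rabs (G t - G s))%R).
  { intros s t Hs Ht. eapply Rle_trans; [apply (re_le_Cmod (F t - F s))|auto]. }
  assert (Him : forall s t, dom i s -> dom i t -> (Rabs (Im (F t) - Im (F s)) <= Rabs (G t - G s))%R).
  { intros s t Hs Ht. eapply Rle_trans; [apply (im_le_Cmod (F t - F s))|auto]. }
  destruct (limR_exists (at_right 0%R) (dom i) _ G a (lo_dom i) Hre Ha) as [A1 HA1].
  destruct (limR_exists (at_right 0%R) (dom i) _ G a (lo_dom i) Him Ha) as [A2 HA2].
  destruct (limR_exists (hi_end i) (dom i) _ G b (hi_dom i) Hre Hb) as [B1 HB1].
  destruct (limR_exists (hi_end i) (dom i) _ G b (hi_dom i) Him Hb) as [B2 HB2].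
  exists ((B1, B2) - (A1, A2) : C). exists F, (A1, A2), (B1, B2).
  split; [exact HF|]. split; [split; auto|]. split; [split; auto|]. reflexivity.
Qed.

(** * Weights at the two ends and dominated integrals *)

(** The map [tau] sends either interval increasingly onto (0, 1), so the
    behaviour at both ends is measured by powers of [tau] and of [wt] = 1 -
    [tau]. *)
Definition tau (i : itv) (t : R) : R := match i with Unit => t | Half => (t / (1 + t))%R end.
Definition wt (i : itv) (t : R) : R := match i with Unit => (1 - t)%R | Half => (/ (1 + t))%R end.
Definition dtau (i : itv) (t : R) : R :=
  match i with Unit => 1%R | Half => (/ (1 + t) * / (1 + t))%R end.

Lemma tau_pos (i : itv) (t : R) : dom i t -> (0 < tau i t)%R.
Proof. destruct i; simpl; intros; [lra|]. apply Rdiv_lt_0_compat; lra. Qed.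

Lemma wt_pos (i : itv) (t : R) : dom i t -> (0 < wt i t)%R.
Proof. destruct i; simpl; intros; [lra|]. apply Rinv_0_lt_compat; lra. Qed.

Lemma dtau_pos (i : itv) (t : R) : dom i t -> (0 < dtau i t)%R.
Proof.
  destruct i; simpl; intros; [lra|].
  assert (0 < / (1 + t))%R by (apply Rinv_0_lt_compat; lra). nra.
Qed.

Lemma tau_wt (i : itv) (t : R) : dom i t -> (tau i t + wt i t = 1)%R.
Proof. destruct i; simpl; intros; [lra|]. field. lra. Qed.

Lemma tau_le1 (i : itv) (t : R) : dom i t -> (tau i t <= 1)%R.
Proof. intros H. assert (A := wt_pos i t H). assert (B := tau_wt i t H). lra. Qed.

Lemma wt_le1 (i : itv) (t : R) : dom i t -> (wt i t <= 1)%R.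
Proof. intros H. assert (A := tau_pos i t H). assert (B := tau_wt i t H). lra. Qed.

Lemma is_derive_tau (i : itv) (t : R) : dom i t -> is_derive (tau i) t (dtau i t).
Proof.
  destruct i; simpl; intros H.
  - exact (is_derive_id (K := R_AbsRing) t).
  - unfold tau. auto_derive; [lra|]. field. lra.
Qed.

Lemma is_derive_wt (i : itv) (t : R) : dom i t -> is_derive (wt i) t (- dtau i t)%R.
Proof.
  destruct i; simpl; intros H.
  - unfold wt. auto_derive; [auto|ring].
  - unfold wt. auto_derive; [lra|]. field. lra.
Qed.

Lemma tau_lo (i : itv) : filterlim (tau i) (at_right 0%R) (at_right 0%R).
Proof.
  intros P [eps HP]. unfold filtermap.
  exists eps. intros y Hy Hp. apply ball_Rabs in Hy. apply HP.
  - change (Rabs (tau i y - 0) < eps)%R.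
    rewrite Rminus_0_r in *.
    rewrite Rabs_right in Hy by lra.
    assert (dom Half y) by exact Hp.
    destruct i; simpl.
    + rewrite Rabs_right; lra.
    + assert (0 < y / (1 + y))%R by (apply Rdiv_lt_0_compat; lra).
      assert (y / (1 + y) = y - y * (y / (1 + y)))%R by (field; lra).
      rewrite Rabs_right; nra.
  - destruct i; simpl; auto. apply Rdiv_lt_0_compat; lra.
Qed.

Lemma wt_hi (i : itv) : filterlim (wt i) (hi_end i) (at_right 0%R).
Proof.
  intros P [eps HP]. unfold filtermap. destruct i; simpl.
  - exists eps. intros y Hy Hp. apply ball_Rabs in Hy. apply HP; [|lra].
    change (Rabs (1 - y - 0) < eps)%R. rewrite Rabs_minus_sym in Hy.
    replace (1 - y - 0)%R with (1 - y)%R by ring. exact Hy.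
  - assert (Q := Rinv_0_lt_compat _ (cond_pos eps)).
    exists (/ eps)%R. intros y Hy. apply HP; [|apply Rinv_0_lt_compat; lra].
    change (Rabs (/ (1 + y) - 0) < eps)%R. rewrite Rminus_0_r, Rabs_right.
    + rewrite <- (Rinv_inv eps). apply Rinv_lt_contravar; [apply Rmult_lt_0_compat|]; lra.
    + left; apply Rinv_0_lt_compat; lra.
Qed.

Lemma at_right_locally (a : R) (f : R -> R) (Fl : (R -> Prop) -> Prop) :
  filterlim f Fl (at_right a) -> filterlim f Fl (locally a).
Proof. intros H P HP. apply H. revert HP. apply filter_le_within. Qed.

Lemma limR_ext (Fl : (R -> Prop) -> Prop) {FF : Filter Fl} (F G : R -> R) (A : R) :
  Fl (fun t => F t = G t) -> filterlim F Fl (locally A) -> filterlim G Fl (locally A).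
Proof. intros E H. eapply filterlim_ext_loc; eauto. Qed.

Lemma wt_lo (i : itv) : filterlim (wt i) (at_right 0%R) (locally 1%R).
Proof.
  apply limR_ext with (fun t => (1 - tau i t)%R); [typeclasses eauto| |].
  - generalize (lo_dom i). apply filter_imp. intros t Ht. assert (E := tau_wt i t Ht). lra.
  - replace 1%R with (1 - 0)%R at 1 by ring. apply limR_minus; [typeclasses eauto|apply filterlim_const|].
    apply at_right_locally, tau_lo.
Qed.

Lemma tau_hi (i : itv) : filterlim (tau i) (hi_end i) (locally 1%R).
Proof.
  apply limR_ext with (fun t => (1 - wt i t)%R); [typeclasses eauto| |].
  - generalize (hi_dom i). apply filter_imp. intros t Ht. assert (E := tau_wt i t Ht). lra.
  - replace 1%R with (1 - 0)%R at 1 by ring. apply limR_minus; [typeclasses eauto|apply filterlim_const|].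
    apply at_right_locally, wt_hi.
Qed.

Lemma Rpower_pos (x y : R) : (0 < Rpower x y)%R.
Proof. apply exp_pos. Qed.

Lemma Rpower_lim_0 (s : R) : (0 < s)%R -> filterlim (fun x => Rpower x s) (at_right 0%R) (locally 0%R).
Proof.
  intros Hs. apply limR_eps; [typeclasses eauto|]. intros eps He.
  exists (mkposreal _ (Rpower_pos eps (/ s))). intros y Hy Hp.
  apply ball_Rabs in Hy. simpl in Hy. rewrite Rminus_0_r in *.
  assert (P := Rpower_pos y s).
  rewrite Rabs_right in * by lra.
  replace eps with (Rpower (Rpower eps (/ s)) s).
  - unfold Rpower at 1 2. apply exp_increasing. apply Rmult_lt_compat_l; auto. apply ln_increasing; auto.
  - rewrite Rpower_mult. replace (/ s * s)%R with 1%R by (field; lra). apply Rpower_1; auto.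
Qed.

Lemma is_derive_Rpower (x s : R) : (0 < x)%R ->
  is_derive (fun y => Rpower y s) x (s * Rpower x (s - 1))%R.
Proof. intros H. apply is_derive_Reals. apply derivable_pt_lim_power; auto. Qed.

Lemma Rpower_lim_1 (s : R) : filterlim (fun x => Rpower x s) (locally 1%R) (locally 1%R).
Proof.
  assert (H := is_derive_continuity _ _ _ (is_derive_Rpower 1 s Rlt_0_1)).
  unfold continuous in H. replace (Rpower 1 s) with 1%R in H; [exact H|].
  unfold Rpower. rewrite ln_1, Rmult_0_r, exp_0. reflexivity.
Qed.

Lemma Rpower_le_exp (x p : R) : (1 / 2 <= x <= 1)%R -> (Rpower x p <= exp (Rabs p * ln 2))%R.
Proof.
  intros H. unfold Rpower.
  assert (L : (- ln 2 <= ln x <= 0)%R).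
  { split.
    - rewrite <- ln_Rinv by lra. apply ln_le; lra.
    - rewrite <- ln_1. apply ln_le; lra. }
  assert (X : (p * ln x <= Rabs p * ln 2)%R).
  { eapply Rle_trans; [apply Rle_abs|]. rewrite Rabs_mult.
    apply Rmult_le_compat_l; [apply Rabs_pos|]. apply Rabs_le. lra. }
  destruct X as [X|X]; [left; apply exp_increasing; auto|rewrite X; right; auto].
Qed.

(** The pull-back by [tau] of the density of Euler's Beta integral: the
    dominating function for every convergence proof below. *)
Definition beta_density (i : itv) (s r : R) (t : R) : R :=
  (Rpower (tau i t) (s - 1) * Rpower (wt i t) (r - 1) * dtau i t)%R.

(** Near either end one of the two powers is bounded, so the product is
    controlled by the sum, which has an elementary antiderivative. *)
Lemma beta_density_split (i : itv) (s r : R) :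
  exists K, (0 < K)%R /\ forall t, dom i t ->
    (beta_density i s r t <= K * (Rpower (tau i t) (s - 1) + Rpower (wt i t) (r - 1)) * dtau i t)%R.
Proof.
  set (K1 := exp (Rabs (r - 1) * ln 2)). set (K2 := exp (Rabs (s - 1) * ln 2)).
  assert (P1 : (0 < K1)%R) by apply exp_pos. assert (P2 : (0 < K2)%R) by apply exp_pos.
  exists (K1 + K2)%R. split; [lra|]. intros t Ht.
  assert (A := tau_pos i t Ht). assert (B := wt_pos i t Ht). assert (S := tau_wt i t Ht).
  assert (D := dtau_pos i t Ht). unfold beta_density. apply Rmult_le_compat_r; [lra|].
  assert (X := Rpower_pos (tau i t) (s - 1)). assert (Y := Rpower_pos (wt i t) (r - 1)).
  set (x := Rpower (tau i t) (s - 1)) in *. set (y := Rpower (wt i t) (r - 1)) in *.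
  destruct (Rle_dec (tau i t) (1 / 2)) as [L|L].
  - assert (y <= K1)%R by (apply Rpower_le_exp; lra).
    assert (x * y <= x * K1)%R by (apply Rmult_le_compat_l; lra). nra.
  - assert (x <= K2)%R by (apply Rpower_le_exp; lra).
    assert (x * y <= K2 * y)%R by (apply Rmult_le_compat_r; lra). nra.
Qed.

Lemma dominating_antiderivative (i : itv) (s r K : R) : (0 < s)%R -> (0 < r)%R ->
  let G := fun t => (K * (Rpower (tau i t) s / s - Rpower (wt i t) r / r))%R in
  (forall t, dom i t ->
     is_derive G t (K * (Rpower (tau i t) (s - 1) + Rpower (wt i t) (r - 1)) * dtau i t)%R) /\
  filterlim G (at_right 0%R) (locally (K * (0 / s - 1 / r))%R) /\
  filterlim G (hi_end i) (locally (K * (1 / s - 0 / r))%R).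
Proof.
  intros Hs Hr G. split; [|split].
  - intros t Ht. unfold G.
    assert (A := tau_pos i t Ht). assert (B := wt_pos i t Ht).
    eapply is_derive_eq.
    + apply (is_deriveR_mult (fun _ => K)); [apply is_deriveR_const|].
      apply (is_deriveR_minus (fun t => Rpower (tau i t) s / s)%R (fun t => Rpower (wt i t) r / r)%R).
      * apply (is_deriveR_mult (fun t => Rpower (tau i t) s) (fun _ => / s)%R); [|exact (is_deriveR_const _ _)].
        apply (is_deriveR_comp (fun y => Rpower y s)); [apply is_derive_Rpower; auto|apply is_derive_tau; auto].
      * apply (is_deriveR_mult (fun t => Rpower (wt i t) r) (fun _ => / r)%R); [|exact (is_deriveR_const _ _)].
        apply (is_deriveR_comp (fun y => Rpower y r)); [apply is_derive_Rpower; auto|apply is_derive_wt; auto].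
    + simpl. field. lra.
  - unfold G. apply (limR_mult (at_right 0%R)); [apply filterlim_const|].
    apply (limR_minus (at_right 0%R)); apply (limR_mult (at_right 0%R)); try apply filterlim_const.
    + exact (filterlim_comp _ _ _ (tau i) (fun x => Rpower x s) _ _ _ (tau_lo i) (Rpower_lim_0 s Hs)).
    + exact (filterlim_comp _ _ _ (wt i) (fun x => Rpower x r) _ _ _ (wt_lo i) (Rpower_lim_1 r)).
  - unfold G. apply (limR_mult (hi_end i)); [apply filterlim_const|].
    apply (limR_minus (hi_end i)); apply (limR_mult (hi_end i)); try apply filterlim_const.
    + exact (filterlim_comp _ _ _ (tau i) (fun x => Rpower x s) _ _ _ (tau_hi i) (Rpower_lim_1 s)).
    + exact (filterlim_comp _ _ _ (wt i) (fun x => Rpower x r) _ _ _ (wt_hi i) (Rpower_lim_0 r Hr)).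
Qed.

Lemma dominated_integrable (i : itv) (s r C0 : R) (f : R -> C) : (0 < s)%R -> (0 < r)%R ->
  (forall t, dom i t -> continuousC f t) ->
  (forall t, dom i t -> (Cmod (f t) <= C0 * beta_density i s r t)%R) -> integrable i f.
Proof.
  intros Hs Hr Hc Hb. destruct (beta_density_split i s r) as [K [HK HKb]].
  destruct (dominating_antiderivative i s r (Rabs C0 * K) Hs Hr) as [H1 [H2 H3]].
  eapply nint_exists; [exact Hc|exact H1| |exact H2|exact H3].
  intros t Ht. eapply Rle_trans; [apply Hb; auto|].
  assert (P : (0 <= beta_density i s r t)%R).
  { unfold beta_density. assert (X := Rpower_pos (tau i t) (s - 1)). assert (Y := Rpower_pos (wt i t) (r - 1)).
    assert (D := dtau_pos i t Ht). apply Rmult_le_pos; [apply Rmult_le_pos|]; lra. }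
  specialize (HKb t Ht).
  apply Rle_trans with (Rabs C0 * beta_density i s r t)%R.
  - apply Rmult_le_compat_r; [auto|apply Rle_abs].
  - rewrite !Rmult_assoc. apply Rmult_le_compat_l; [apply Rabs_pos|].
    rewrite <- Rmult_assoc. exact HKb.
Qed.

Lemma dominated_bound (i : itv) (s r : R) : (0 < s)%R -> (0 < r)%R ->
  exists K, (0 < K)%R /\ forall (C0 : R) (f : R -> C) (v : C), (0 <= C0)%R -> nint i f v ->
    (forall t, dom i t -> (Cmod (f t) <= C0 * beta_density i s r t)%R) -> (Cmod v <= C0 * K)%R.
Proof.
  intros Hs Hr. destruct (beta_density_split i s r) as [K [HK HKb]].
  assert (Is := Rinv_0_lt_compat _ Hs). assert (Ir := Rinv_0_lt_compat _ Hr).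
  exists (K * (/ s + / r))%R. split; [nra|]. intros C0 f v HC Hv Hb.
  destruct (dominating_antiderivative i s r (C0 * K) Hs Hr) as [H1 [H2 H3]].
  replace (C0 * (K * (/ s + / r)))%R
    with (C0 * K * (1 / s - 0 / r) - C0 * K * (0 / s - 1 / r))%R by (field; lra).
  eapply nint_le; [exact Hv|exact H1| |exact H2|exact H3].
  intros t Ht. eapply Rle_trans; [apply Hb; auto|].
  rewrite !Rmult_assoc. apply Rmult_le_compat_l; auto.
  rewrite <- Rmult_assoc. auto.
Qed.

Lemma nint_reflect (f : R -> C) (v : C) :
  nint Unit f v -> nint Unit (fun t => f (1 - t)%R) v.
Proof.
  intros (F & A & B & HF & HA & HB & ->).
  exists (fun t => - F (1 - t)%R), (- B), (- A). split; [|split; [|split]].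
  - intros t Ht. simpl in Ht. eapply der_eq.
    + apply (der_opp (fun t => F (1 - t)%R)).
      apply (der_comp F (fun t => (1 - t)%R) t (-1)%R); [apply HF; simpl; lra|].
      auto_derive; [auto|ring].
    + ring.
  - assert (L : filterlim (fun t => (1 - t)%R) (at_right 0%R) (at_left 1%R)).
    { intros P [eps HP]. exists eps. intros y Hy Hp. apply ball_Rabs in Hy.
      apply HP; [|lra]. change (Rabs (1 - y - 1) < eps)%R.
      replace (1 - y - 1)%R with (- (y - 0))%R by ring. rewrite Rabs_Ropp. exact Hy. }
    destruct HB as [H1 H2]. split; simpl.
    + apply limR_opp; [typeclasses eauto|].
      apply (filterlim_comp _ _ _ (fun t => (1 - t)%R) (fun t => Re (F t)) _ _ _ L H1).
    + apply limR_opp; [typeclasses eauto|].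
      apply (filterlim_comp _ _ _ (fun t => (1 - t)%R) (fun t => Im (F t)) _ _ _ L H2).
  - assert (L : filterlim (fun t => (1 - t)%R) (at_left 1%R) (at_right 0%R)).
    { intros P [eps HP]. exists eps. intros y Hy Hp. apply ball_Rabs in Hy.
      apply HP; [|lra]. change (Rabs (1 - y - 0) < eps)%R.
      replace (1 - y - 0)%R with (- (y - 1))%R by ring. rewrite Rabs_Ropp. exact Hy. }
    destruct HA as [H1 H2]. split; simpl.
    + apply limR_opp; [typeclasses eauto|].
      apply (filterlim_comp _ _ _ (fun t => (1 - t)%R) (fun t => Re (F t)) _ _ _ L H1).
    + apply limR_opp; [typeclasses eauto|].
      apply (filterlim_comp _ _ _ (fun t => (1 - t)%R) (fun t => Im (F t)) _ _ _ L H2).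
  - ring.
Qed.

Lemma nint_scale (f : R -> C) (v : C) (c : R) : (0 < c)%R ->
  nint Half f v -> nint Half (fun t => RtoC c * f (c * t)%R) v.
Proof.
  intros Hc (F & A & B & HF & HA & HB & ->).
  exists (fun t => F (c * t)%R), A, B. split; [|split; [|split]]; auto.
  - intros t Ht. simpl in Ht. apply (der_comp F (fun t => (c * t)%R)); [apply HF; simpl; nra|].
    auto_derive; [auto|ring].
  - assert (L : filterlim (fun t => (c * t)%R) (at_right 0%R) (at_right 0%R)).
    { intros P [eps HP].
      assert (Q : (0 < eps / c)%R) by (apply Rdiv_lt_0_compat; auto; apply cond_pos).
      exists (mkposreal _ Q). intros y Hy Hp. apply ball_Rabs in Hy. simpl in Hy.
      apply HP; [|nra]. change (Rabs (c * y - 0) < eps)%R. rewrite Rminus_0_r in *.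
      rewrite Rabs_mult, (Rabs_right c) by lra.
      replace (pos eps) with (c * (eps / c))%R by (field; lra).
      apply Rmult_lt_compat_l; auto. }
    destruct HA as [H1 H2]. split.
    + apply (filterlim_comp _ _ _ (fun t => (c * t)%R) (fun t => Re (F t)) _ _ _ L H1).
    + apply (filterlim_comp _ _ _ (fun t => (c * t)%R) (fun t => Im (F t)) _ _ _ L H2).
  - assert (L : filterlim (fun t => (c * t)%R) (Rbar_locally p_infty) (Rbar_locally p_infty)).
    { intros P [M HP]. exists (M / c)%R. intros y Hy. apply HP.
      apply Rmult_lt_reg_r with (/ c)%R; [apply Rinv_0_lt_compat; auto|].
      replace (c * y * / c)%R with y by (field; lra). exact Hy. }
    destruct HB as [H1 H2]. split.
    + apply (filterlim_comp _ _ _ (fun t => (c * t)%R) (fun t => Re (F t)) _ _ _ L H1).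
    + apply (filterlim_comp _ _ _ (fun t => (c * t)%R) (fun t => Im (F t)) _ _ _ L H2).
Qed.

Lemma nint_to_half (f : R -> C) (v : C) :
  nint Unit f v -> nint Half (fun t => RtoC (dtau Half t) * f (tau Half t)) v.
Proof.
  intros (F & A & B & HF & HA & HB & ->).
  exists (fun t => F (tau Half t)), A, B. split; [|split; [|split]]; auto.
  - intros t Ht. apply (der_comp F (tau Half)); [|apply is_derive_tau; auto].
    apply HF. assert (X := tau_pos Half t Ht). assert (Y := wt_pos Half t Ht).
    assert (Z := tau_wt Half t Ht). unfold dom; simpl in *; split; lra.
  - destruct HA as [H1 H2]. split.
    + apply (filterlim_comp _ _ _ (tau Half) (fun t => Re (F t)) _ _ _ (tau_lo Half) H1).
    + apply (filterlim_comp _ _ _ (tau Half) (fun t => Im (F t)) _ _ _ (tau_lo Half) H2).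
  - assert (L : filterlim (tau Half) (hi_end Half) (at_left 1%R)).
    { intros P HP. assert (Q := tau_hi Half _ HP). unfold filtermap in *.
      generalize (filter_and _ _ Q (hi_dom Half)). apply filter_imp. intros t [X Y]. apply X.
      assert (Z := wt_pos Half t Y). assert (W := tau_wt Half t Y). lra. }
    destruct HB as [H1 H2]. split.
    + apply (filterlim_comp _ _ _ (tau Half) (fun t => Re (F t)) _ _ _ L H1).
    + apply (filterlim_comp _ _ _ (tau Half) (fun t => Im (F t)) _ _ _ L H2).
Qed.

Lemma lim_ends_zero (i : itv) (p q C0 : R) (F : R -> C) : (0 < p)%R -> (0 < q)%R ->
  (forall t, dom i t -> (Cmod (F t) <= C0 * (Rpower (tau i t) p * Rpower (wt i t) q))%R) ->
  lim_at (at_right 0%R) F 0 /\ lim_at (hi_end i) F 0.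
Proof.
  intros Hp Hq H.
  split; eapply lim_squeeze; try typeclasses eauto.
  - generalize (lo_dom i). apply filter_imp. exact H.
  - replace 0%R with (C0 * (0 * 1))%R at 2 by ring.
    apply (limR_mult (at_right 0%R)); [apply filterlim_const|].
    apply (limR_mult (at_right 0%R)).
    + exact (filterlim_comp _ _ _ (tau i) (fun x => Rpower x p) _ _ _ (tau_lo i) (Rpower_lim_0 p Hp)).
    + exact (filterlim_comp _ _ _ (wt i) (fun x => Rpower x q) _ _ _ (wt_lo i) (Rpower_lim_1 q)).
  - generalize (hi_dom i). apply filter_imp. exact H.
  - replace 0%R with (C0 * (1 * 0))%R by ring.
    apply (limR_mult (hi_end i)); [apply filterlim_const|].
    apply (limR_mult (hi_end i)).
    + exact (filterlim_comp _ _ _ (tau i) (fun x => Rpower x p) _ _ _ (tau_hi i) (Rpower_lim_1 p)).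
    + exact (filterlim_comp _ _ _ (wt i) (fun x => Rpower x q) _ _ _ (wt_hi i) (Rpower_lim_0 q Hq)).
Qed.

(** * Pochhammer symbols and the Gamma function *)

Lemma poch_S (z : C) (n : nat) : poch z (S n) = poch z n * (z + natC n).
Proof. reflexivity. Qed.

Lemma poch_head (z : C) (n : nat) : poch z (S n) = z * poch (z + 1) n.
Proof.
  induction n as [|n IH].
  - simpl. rewrite natC_0. ring.
  - rewrite poch_S, IH, poch_S, natC_S. ring.
Qed.

Lemma natC_S_neq_0 (n : nat) : natC (S n) <> 0.
Proof. intros H. apply RtoC_inj in H. revert H. apply not_0_INR. discriminate. Qed.

Lemma factC_S (n : nat) : factC (S n) = natC (S n) * factC n.
Proof. unfold factC, natC. rewrite <- RtoC_mult, <- mult_INR. reflexivity. Qed.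

Lemma factC_neq_0 (n : nat) : factC n <> 0.
Proof. intros H. apply RtoC_inj in H. exact (INR_fact_neq_0 n H). Qed.

Lemma poch_1 (n : nat) : poch 1 n = factC n.
Proof.
  induction n as [|n IH].
  - reflexivity.
  - rewrite poch_S, IH, factC_S, natC_S. ring.
Qed.

Lemma Re_plus_natC (z : C) (n : nat) : Re (z + natC n) = (Re z + INR n)%R.
Proof. reflexivity. Qed.

Lemma Re_pos_neq_0 (z : C) : (0 < Re z)%R -> z <> 0.
Proof. intros H ->. simpl in H. lra. Qed.

Lemma poch_neq_0 (z : C) (n : nat) : (0 < Re z)%R -> poch z n <> 0.
Proof.
  intros H; induction n as [|n IH]; [exact C1_nz|].
  rewrite poch_S. apply Cmult_neq_0; auto. apply Re_pos_neq_0.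
  rewrite Re_plus_natC. generalize (pos_INR n). lra.
Qed.

Lemma ln_le_sub_1 (y : R) : (0 < y)%R -> (ln y <= y - 1)%R.
Proof. intros H. assert (E := exp_ineq1_le (ln y)). rewrite exp_ln in E; lra. Qed.

Lemma exp_le_compat (x y : R) : (x <= y)%R -> (exp x <= exp y)%R.
Proof. intros [H| ->]; [left; apply exp_increasing; auto|right; auto]. Qed.

(** The tangent inequality for the logarithm at k. *)
Lemma exp_neg_le (k t : R) : (0 < k)%R -> (0 < t)%R ->
  (exp (- t) <= exp (1 - k + k * ln k) * Rpower (wt Half t) k)%R.
Proof.
  intros Hk Ht. unfold Rpower, wt. rewrite ln_Rinv, <- exp_plus by lra.
  apply exp_le_compat.
  assert (P : (0 < (1 + t) / k)%R) by (apply Rdiv_lt_0_compat; lra).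
  assert (L := ln_le_sub_1 _ P).
  unfold Rdiv in L at 1. rewrite ln_mult, ln_Rinv in L; try lra; [|apply Rinv_0_lt_compat; auto].
  assert (k * (ln (1 + t) + - ln k) <= k * ((1 + t) / k - 1))%R by (apply Rmult_le_compat_l; lra).
  replace (k * ((1 + t) / k - 1))%R with (1 + t - k)%R in H by (field; lra). lra.
Qed.

Lemma Rpower_half (t q : R) : (0 < t)%R ->
  Rpower t q = (Rpower (tau Half t) q * Rpower (wt Half t) (- q))%R.
Proof.
  intros H. assert (D : dom Half t) by exact H.
  assert (A := tau_pos Half t D). assert (B := wt_pos Half t D).
  assert (E : t = (tau Half t * / wt Half t)%R) by (simpl; field; lra).
  rewrite E at 1. unfold Rpower. rewrite <- exp_plus, ln_mult, ln_Rinv; auto;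
    [f_equal; ring|apply Rinv_0_lt_compat; auto].
Qed.

Lemma dtau_half (t : R) : (0 < t)%R -> dtau Half t = Rpower (wt Half t) 2.
Proof.
  intros H. assert (B := wt_pos Half t H).
  replace 2%R with (INR 2) by reflexivity. rewrite Rpower_pow; auto. simpl. ring.
Qed.

Lemma Rpower_decr (x p q : R) : (0 < x <= 1)%R -> (p <= q)%R -> (Rpower x q <= Rpower x p)%R.
Proof.
  intros [H1 H2] H. unfold Rpower. apply exp_le_compat.
  assert (ln x <= 0)%R by (rewrite <- ln_1; apply ln_le; lra). nra.
Qed.

Lemma gamma_kernel_le (sg p : R) : (0 < sg)%R -> (0 < p)%R -> exists C0, (0 < C0)%R /\
  forall t, (0 < t)%R ->
    (Rpower t (sg - 1) * exp (- t) <=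
     C0 * (Rpower (tau Half t) (sg - 1) * Rpower (wt Half t) p))%R.
Proof.
  intros Hs Hp.
  exists (exp (1 - (p + sg) + (p + sg) * ln (p + sg))). split; [apply exp_pos|].
  intros t Ht. assert (D : dom Half t) by exact Ht.
  assert (A := tau_pos Half t D). assert (B := wt_pos Half t D).
  rewrite Rpower_half by auto.
  assert (E := exp_neg_le (p + sg) t ltac:(lra) Ht).
  set (c := exp (1 - (p + sg) + (p + sg) * ln (p + sg))) in *.
  assert (X := Rpower_pos (tau Half t) (sg - 1)).
  assert (Y := Rpower_pos (wt Half t) (- (sg - 1))).
  set (x := Rpower (tau Half t) (sg - 1)) in *.
  apply Rle_trans with (x * Rpower (wt Half t) (- (sg - 1)) * (c * Rpower (wt Half t) (p + sg)))%R.
  { apply Rmult_le_compat_l; [|exact E]. left; apply Rmult_lt_0_compat; auto. }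
  apply Rle_trans with (c * (x * Rpower (wt Half t) (p + 1)))%R.
  { right. replace (p + 1)%R with (- (sg - 1) + (p + sg))%R by ring. rewrite (Rpower_plus (- (sg - 1)) (p + sg)). ring. }
  apply Rmult_le_compat_l; [left; apply exp_pos|]. apply Rmult_le_compat_l; [lra|].
  apply Rpower_decr; [|lra]. split; [auto|apply wt_le1; auto].
Qed.

Lemma Cmod_Cexp_neg (t : R) : Cmod (Cexp (- RtoC t)) = exp (- t).
Proof. rewrite Cmod_Cexp. f_equal. Qed.

Lemma Cmod_Cexp_i (u : R) : Cmod (Cexp (Ci * RtoC u)) = 1%R.
Proof.
  rewrite Cmod_Cexp, <- exp_0. f_equal. unfold Re, Ci, RtoC; simpl. ring.
Qed.

(** The integrand of the Laplace transform of t ^ (s - 1) on the line of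
    abscissa 1; at [lam] = 0 it is that of Gamma. *)
Definition laplace_kernel (s : C) (lam t : R) : C :=
  Cpower (RtoC t) (s - 1) * Cexp (- RtoC t) * Cexp (Ci * RtoC (lam * t)).

Lemma der_Cexp_neg (t : R) : der (fun t => Cexp (- RtoC t)) t (- Cexp (- RtoC t)).
Proof.
  eapply der_eq; [apply der_Cexp, der_opp, der_id|]. cbv beta. ring.
Qed.

Lemma der_Cexp_i (lam t : R) :
  der (fun t => Cexp (Ci * RtoC (lam * t))) t (Ci * RtoC lam * Cexp (Ci * RtoC (lam * t))).
Proof.
  eapply der_eq.
  - apply der_Cexp, der_scal, der_RtoC. auto_derive; [auto|]. reflexivity.
  - cbv beta. rewrite Rmult_1_r. reflexivity.
Qed.

Lemma continuousC_laplace_kernel (s : C) (lam t : R) : (0 < t)%R -> continuousC (laplace_kernel s lam) t.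
Proof.
  intros H. apply continuousC_mult; [apply continuousC_mult|].
  - eapply der_cont, der_Cpower_pos; auto.
  - eapply der_cont, der_Cexp_neg.
  - eapply der_cont, der_Cexp_i.
Qed.

Lemma Cmod_laplace_kernel (s : C) (lam t : R) : (0 < t)%R ->
  Cmod (laplace_kernel s lam t) = (Rpower t (Re s - 1) * exp (- t))%R.
Proof.
  intros H. unfold laplace_kernel. rewrite !Cmod_mult, Cmod_Cexp_i, Cmod_Cexp_neg, Cmod_Cpower_pos; auto.
  change (Re (s - 1)) with (Re s - 1)%R. ring.
Qed.

Lemma beta_density_half (s r t : R) : (0 < t)%R ->
  beta_density Half s r t = (Rpower (tau Half t) (s - 1) * Rpower (wt Half t) (r + 1))%R.
Proof.
  intros H. unfold beta_density. rewrite dtau_half, Rmult_assoc, <- Rpower_plus; auto.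
  do 2 f_equal. ring.
Qed.

Lemma integrable_laplace_kernel (s : C) (lam : R) : (0 < Re s)%R -> integrable Half (laplace_kernel s lam).
Proof.
  intros Hs. destruct (gamma_kernel_le (Re s) 2 Hs ltac:(lra)) as [C0 [_ HC]].
  apply (dominated_integrable Half (Re s) 1%R C0); [auto|lra| |]; intros t Ht.
  - apply continuousC_laplace_kernel; auto.
  - rewrite Cmod_laplace_kernel, beta_density_half by auto. replace (1 + 1)%R with 2%R by ring. auto.
Qed.

Definition laplace (s : C) (lam : R) : C := Nint Half (laplace_kernel s lam).

Lemma laplace_spec (s : C) (lam : R) : (0 < Re s)%R -> nint Half (laplace_kernel s lam) (laplace s lam).
Proof. intros H. apply Nint_spec, integrable_laplace_kernel, H. Qed.

(** The fundamental theorem of calculus on each compact interval links the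
    antiderivatives to the limit of Riemann integrals by which Gamma is
    defined. *)
Lemma nint_is_RInt_gen (f : R -> C) (v : C) :
  nint Half f v -> (forall t, (0 < t)%R -> continuousC f t) ->
  is_RInt_gen (V := C_R_CompleteNormedModule) f (at_right 0%R) (Rbar_locally p_infty) v.
Proof.
  intros (F & A & B & HF & HA & HB & ->) Hc P [eps HP].
  assert (HA' := proj1 (lim_eps _ F A) HA). assert (HB' := proj1 (lim_eps _ F B) HB).
  assert (He : (0 < eps / 2)%R) by (generalize (cond_pos eps); lra).
  apply (Filter_prod _ _ _ (fun a => (0 < a)%R /\ (Cmod (F a - A) < eps / 2)%R)
                        (fun b => (0 < b)%R /\ (Cmod (F b - B) < eps / 2)%R)).
  - apply filter_and; [apply (lo_dom Half)|apply HA'; auto].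
  - apply filter_and; [apply (hi_dom Half)|apply HB'; auto].
  - intros a b [Ha Ka] [Hb Kb]. exists (F b - F a). split.
    + assert (HI : forall g G : R -> R, (forall t, (0 < t)%R -> is_derive G t (g t)) ->
        (forall t, (0 < t)%R -> continuous g t) -> is_RInt g a b (G b - G a)%R).
      { intros g G H1 H2. apply (is_RInt_derive G g); intros x Hx;
          assert (0 < x)%R by (generalize (Rmin_glb_lt a b 0 Ha Hb); lra); auto. }
      simpl. apply (is_RInt_fct_extend_pair (U := R_NormedModule) (V := R_NormedModule)
        f a b (Re (F b - F a)) (Im (F b - F a))).
      * apply (HI (fun t => Re (f t)) (fun t => Re (F t))); intros t Ht; [apply HF; auto|apply Hc; auto].
      * apply (HI (fun t => Im (f t)) (fun t => Im (F t))); intros t Ht; [apply HF; auto|apply Hc; auto].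
    + apply HP.
      assert (K : (Cmod (F b - F a - (B - A)) < eps)%R).
      { replace (F b - F a - (B - A)) with ((F b - B) - (F a - A)) by ring.
        eapply Rle_lt_trans; [apply Cmod_triangle_minus|]. lra. }
      split; simpl.
      * eapply Rle_lt_trans; [|exact K]. apply (re_le_Cmod (F b - F a - (B - A))).
      * eapply Rle_lt_trans; [|exact K]. apply (im_le_Cmod (F b - F a - (B - A))).
Qed.

Lemma laplace_kernel_0 (s : C) (t : R) : laplace_kernel s 0 t = Cpower (RtoC t) (s - 1) * Cexp (- RtoC t).
Proof. unfold laplace_kernel. rewrite Rmult_0_l, Cmult_0_r, Cexp_0. ring. Qed.

Lemma laplace_0 (s : C) : (0 < Re s)%R -> laplace s 0 = Gamma s.
Proof.
  intros Hs. symmetry.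
  refine (is_RInt_gen_unique (V := C_R_CompleteNormedModule) (Fa := at_right 0%R)
            (Fb := Rbar_locally p_infty) _ _ _).
  apply nint_is_RInt_gen.
  - apply nint_ext with (laplace_kernel s 0); [intros; apply laplace_kernel_0|apply laplace_spec; auto].
  - intros t Ht. apply continuousC_ext_loc with (laplace_kernel s 0).
    + apply filter_forall. intros; apply laplace_kernel_0.
    + apply continuousC_laplace_kernel; auto.
Qed.

Lemma Gamma_nint (s : C) : (0 < Re s)%R ->
  nint Half (fun t => Cpower (RtoC t) (s - 1) * Cexp (- RtoC t)) (Gamma s).
Proof.
  intros Hs. rewrite <- laplace_0 by auto.
  apply nint_ext with (laplace_kernel s 0); [intros; apply laplace_kernel_0|apply laplace_spec; auto].
Qed.

(** Integration by parts: t ^ s exp (- t + i lam t) vanishes at both ends. *)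
Lemma laplace_succ (s : C) (lam : R) : (0 < Re s)%R ->
  (1 - Ci * RtoC lam) * laplace (s + 1) lam = s * laplace s lam.
Proof.
  intros Hs.
  assert (H1 := laplace_spec s lam Hs).
  assert (Hs1 : (0 < Re (s + 1))%R) by (simpl; unfold Re in *; lra).
  assert (H2 := laplace_spec (s + 1) lam Hs1).
  assert (E : s + 1 - 1 = s) by ring.
  assert (H3 : nint Half (fun t => s * laplace_kernel s lam t - (1 - Ci * RtoC lam) * laplace_kernel (s + 1) lam t) 0).
  { destruct (gamma_kernel_le (Re (s + 1)) 1 Hs1 ltac:(lra)) as [C0 [_ HC]].
    destruct (lim_ends_zero Half (Re s) 1 C0 (laplace_kernel (s + 1) lam)) as [L1 L2]; [auto|lra| |].
    - intros t Ht. rewrite Cmod_laplace_kernel by auto. eapply Rle_trans; [apply HC; auto|].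
      replace (Re (s + 1) - 1)%R with (Re s) by (unfold Re; simpl; ring). lra.
    - apply nint_der_zero with (laplace_kernel (s + 1) lam); auto.
      intros t Ht. unfold laplace_kernel. eapply der_eq.
      + apply (der_mult (fun t => Cpower (RtoC t) (s + 1 - 1) * Cexp (- RtoC t))
                 (fun t => Cexp (Ci * RtoC (lam * t)))).
        * apply der_mult; [apply der_Cpower_pos; auto|apply der_Cexp_neg].
        * apply der_Cexp_i.
      + cbv beta. rewrite E. ring. }
  assert (X := nint_minus _ _ _ _ _ (nint_scal _ s _ _ H1) (nint_scal _ (1 - Ci * RtoC lam) _ _ H2)).
  assert (Y := nint_unique _ _ _ _ X H3).
  symmetry. apply Ceq_minus. exact Y.
Qed.

Lemma Gamma_succ (s : C) : (0 < Re s)%R -> Gamma (s + 1) = s * Gamma s.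
Proof.
  intros Hs. assert (Hs1 : (0 < Re (s + 1))%R) by (simpl; unfold Re in *; lra).
  rewrite <- !laplace_0 by auto. rewrite <- laplace_succ by auto. ring.
Qed.

Lemma Gamma_plus_nat (s : C) (n : nat) : (0 < Re s)%R -> Gamma (s + natC n) = poch s n * Gamma s.
Proof.
  intros Hs. induction n as [|n IH].
  - rewrite natC_0, Cplus_0_r. simpl. ring.
  - rewrite natC_S, Cplus_assoc, Gamma_succ, IH, poch_S.
    + ring.
    + rewrite Re_plus_natC. generalize (pos_INR n). lra.
Qed.

(** The form in which differentiation under the integral sign is carried out.
    *)
Lemma der_of_quadratic (F : R -> C) (t K d : R) (l : C) : (0 < d)%R ->
  (forall h, (Rabs h < d)%R -> (Cmod (F (t + h)%R - F t - RtoC h * l) <= K * (h * h))%R) -> der F t l.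
Proof.
  intros Hd H.
  assert (Hr : forall (G : R -> R) (m : R),
    (forall h, (Rabs h < d)%R -> (Rabs (G (t + h) - G t - h * m) <= K * (h * h))%R) -> is_derive G t m).
  { intros G m HG. apply is_derive_Reals. intros eps He.
    assert (KP : (0 < Rabs K + 1)%R) by (generalize (Rabs_pos K); lra).
    assert (P : (0 < eps / (Rabs K + 1))%R) by (apply Rdiv_lt_0_compat; auto).
    exists (mkposreal _ (Rmin_glb_lt _ _ _ Hd P)). intros h Hh Hl. simpl in Hl.
    assert (Hld := Rlt_le_trans _ _ _ Hl (Rmin_l _ _)). apply Rlt_le_trans with (2 := Rmin_r _ _) in Hl.
    replace ((G (t + h) - G t) / h - m)%R with ((G (t + h) - G t - h * m) / h)%R by (field; auto).
    unfold Rdiv. rewrite Rabs_mult, Rabs_inv by auto.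
    assert (Q := Rabs_pos_lt h Hh).
    apply Rmult_lt_reg_r with (Rabs h); auto. rewrite Rmult_assoc, Rinv_l, Rmult_1_r by lra.
    eapply Rle_lt_trans; [apply HG; exact Hld|].
    apply Rle_lt_trans with (Rabs K * (Rabs h * Rabs h))%R.
    - rewrite <- (Rabs_mult h h), (Rabs_right (h * h)) by nra.
      apply Rmult_le_compat_r; [nra|apply Rle_abs].
    - rewrite <- Rmult_assoc. apply Rmult_lt_compat_r; auto.
      apply Rlt_le_trans with ((Rabs K + 1) * (eps / (Rabs K + 1)))%R; [|right; field; lra].
      generalize (Rabs_pos K); intros. nra. }
  split; apply Hr; intros h Hh; eapply Rle_trans; [|apply (H h Hh)| |apply (H h Hh)].
  - replace (Re (F (t + h)%R) - Re (F t) - h * Re l)%R with (Re (F (t + h)%R - F t - RtoC h * l))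
      by (unfold Re; simpl; ring). apply re_le_Cmod.
  - replace (Im (F (t + h)%R) - Im (F t) - h * Im l)%R with (Im (F (t + h)%R - F t - RtoC h * l))
      by (unfold Im; simpl; ring). apply im_le_Cmod.
Qed.

Lemma Cexp_i_taylor (w : R) : (Cmod (Cexp (Ci * RtoC w) - 1 - Ci * RtoC w) <= w * w)%R.
Proof.
  assert (H1 : forall u, (0 <= u)%R -> (Cmod (Cexp (Ci * RtoC (w * u)) - 1) <= Rabs w * u)%R).
  { intros u Hu.
    assert (X := mean_value_le (fun u => Cexp (Ci * RtoC (w * u)))
      (fun u => Ci * RtoC w * Cexp (Ci * RtoC (w * u))) (fun u => (Rabs w * u)%R) (fun _ => Rabs w) 0 u Hu).
    cbv beta in X. rewrite !Rmult_0_r, Cmult_0_r, Cexp_0, Rminus_0_r in X. apply X.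
    - intros; apply der_Cexp_i.
    - intros; auto_derive; [auto|ring].
    - intros; rewrite !Cmod_mult, Cmod_Cexp_i, Cmod_Ci, Cmod_R. lra. }
  assert (X := mean_value_le (fun u => Cexp (Ci * RtoC (w * u)) - Ci * RtoC (w * u))
      (fun u => Ci * RtoC w * (Cexp (Ci * RtoC (w * u)) - 1))
      (fun u => (w * w * (u * u / 2))%R) (fun u => (w * w * u)%R) 0 1 ltac:(lra)).
  cbv beta in X. rewrite !Rmult_0_r, !Rmult_1_r, Cmult_0_r, Cexp_0 in X.
  replace (Cexp (Ci * RtoC w) - 1 - Ci * RtoC w) with
    (Cexp (Ci * RtoC w) - Ci * RtoC w - (1 - 0)) by ring.
  eapply Rle_trans; [apply X|].
  - intros t _. eapply der_eq.
    + apply der_minus; [apply der_Cexp_i|]. apply der_scal, der_RtoC. auto_derive; [auto|reflexivity].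
    + rewrite Rmult_1_r. ring.
  - intros; auto_derive; [auto|field].
  - intros t Ht. rewrite !Cmod_mult, Cmod_Ci, Cmod_R. specialize (H1 t (proj1 Ht)).
    assert (Q : (Rabs w * Rabs w = w * w)%R) by (rewrite <- Rabs_mult, Rabs_right; nra).
    assert (P := Rabs_pos w). rewrite Rmult_1_l.
    apply Rle_trans with (Rabs w * (Rabs w * t))%R; [apply Rmult_le_compat_l; auto|]. rewrite <- Rmult_assoc, Q. lra.
  - nra.
Qed.

(** Differentiation under the integral sign: the second-order error of exp (i
    h t) costs two powers of t, which the exponential absorbs. *)
Lemma der_laplace (s : C) (lam : R) : (0 < Re s)%R ->
  der (laplace s) lam (Ci * laplace (s + 1) lam).
Proof.
  intros Hs.
  assert (Hs1 : (0 < Re (s + 1))%R) by (simpl; unfold Re in *; lra).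
  destruct (gamma_kernel_le (Re s + 2) 2 ltac:(lra) ltac:(lra)) as [C0 [HC0 HC]].
  destruct (dominated_bound Half (Re s + 2) 1 ltac:(lra) ltac:(lra)) as [K [HK Hb]].
  apply der_of_quadratic with (C0 * K)%R 1%R; [lra|]. intros h _.
  assert (X := nint_minus _ _ _ _ _ (nint_minus _ _ _ _ _ (laplace_spec s (lam + h) Hs) (laplace_spec s lam Hs))
    (nint_scal _ (RtoC h * Ci) _ _ (laplace_spec (s + 1) lam Hs1))).
  replace (laplace s (lam + h) - laplace s lam - RtoC h * (Ci * laplace (s + 1) lam))
    with (laplace s (lam + h) - laplace s lam - RtoC h * Ci * laplace (s + 1) lam) by ring.
  apply Rle_trans with ((h * h * C0) * K)%R; [|lra].
  eapply Hb; [nra|exact X|]. intros t Ht. simpl in Ht.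
  assert (E : laplace_kernel s (lam + h) t - laplace_kernel s lam t - RtoC h * Ci * laplace_kernel (s + 1) lam t =
    laplace_kernel s lam t * (Cexp (Ci * RtoC (h * t)) - 1 - Ci * RtoC (h * t))).
  { unfold laplace_kernel. replace (s + 1 - 1) with (s - 1 + 1) by ring.
    rewrite Cpower_plus, Cpower_1 by (apply offcut_pos; auto).
    replace (Ci * RtoC ((lam + h) * t)) with (Ci * RtoC (lam * t) + Ci * RtoC (h * t))
      by (rewrite Rmult_plus_distr_r, RtoC_plus; ring).
    rewrite Cexp_plus, !(RtoC_mult h t). ring. }
  cbv beta. rewrite E, Cmod_mult, Cmod_laplace_kernel, beta_density_half by auto.
  assert (T := Cexp_i_taylor (h * t)). specialize (HC t Ht).
  replace (Re s + 2 - 1)%R with (Re s - 1 + INR 2)%R in * by (simpl; ring).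
  rewrite Rpower_plus, Rpower_pow in HC by auto.
  assert (P := Rpower_pos t (Re s - 1)). assert (Q := exp_pos (- t)).
  apply Rle_trans with ((Rpower t (Re s - 1) * exp (- t)) * (h * t * (h * t)))%R.
  { apply Rmult_le_compat_l; auto. left; apply Rmult_lt_0_compat; auto. }
  apply Rle_trans with (h * h * (Rpower t (Re s - 1) * t ^ 2 * exp (- t)))%R; [right; ring|].
  rewrite (Rmult_assoc (h * h) C0). apply Rmult_le_compat_l; [nra|].
  replace (1 + 1)%R with 2%R by ring. exact HC.
Qed.

Lemma offcut_1_minus_i (lam : R) : offcut (1 - Ci * RtoC lam).
Proof. apply offcut_re. unfold Re, Ci, RtoC; simpl. lra. Qed.

(** By [der_laplace] and [laplace_succ] the product of the transform with (1 -
    i lam) ^ s has derivative zero. *)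
Lemma laplace_eq (s : C) (lam : R) : (0 < Re s)%R ->
  laplace s lam = Gamma s * Cpower (1 - Ci * RtoC lam) (- s).
Proof.
  intros Hs.
  set (h := fun u => laplace s u * Cpower (1 - Ci * RtoC u) s).
  assert (D : forall u, der h u 0).
  { intros u. eapply der_eq.
    - apply der_mult; [apply der_laplace; auto|].
      apply der_Cpower; [apply offcut_1_minus_i|].
      apply der_minus; [apply der_const|apply der_scal, der_id].
    - cbv beta. assert (E := laplace_succ s u Hs).
      rewrite (Cpower_pred (1 - Ci * RtoC u) s) by apply offcut_1_minus_i.
      set (p := Cpower (1 - Ci * RtoC u) (s - 1)) in *.
      transitivity (Ci * p * ((1 - Ci * RtoC u) * laplace (s + 1) u - s * laplace s u)); [ring|].
      rewrite E. ring. }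
  assert (E : h lam = h 0%R).
  { destruct (Rle_dec 0 lam); [symmetry|]; apply der_zero_const; auto; lra. }
  unfold h in E. rewrite laplace_0 in E by auto.
  replace (1 - Ci * RtoC 0) with (RtoC 1) in E by ring. rewrite Cpower_one_base, Cmult_1_r in E.
  rewrite <- E, Cpower_opp. field. apply Cpower_neq_0.
Qed.

(** * The Beta function *)

Definition beta_kernel (a b : C) (t : R) : C := Cpower (RtoC t) (a - 1) * Cpower (RtoC (1 - t)) (b - 1).

Definition Beta (a b : C) : C := Nint Unit (beta_kernel a b).

Lemma der_Cpower_reflect (t : R) (w : C) : (t < 1)%R ->
  der (fun s => Cpower (RtoC (1 - s)) w) t (- (w * Cpower (RtoC (1 - t)) (w - 1))).
Proof.
  intros H. eapply der_eq.
  - apply (der_comp (fun s => Cpower (RtoC s) w) (fun s => (1 - s)%R) t (-1)%R).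
    + apply der_Cpower_pos. lra.
    + auto_derive; [auto|ring].
  - ring.
Qed.

Lemma continuousC_beta_kernel (a b : C) (t : R) : (0 < t < 1)%R -> continuousC (beta_kernel a b) t.
Proof.
  intros H. apply continuousC_mult; eapply der_cont; [apply der_Cpower_pos|apply der_Cpower_reflect]; lra.
Qed.

Lemma Cmod_beta_kernel (a b : C) (t : R) : (0 < t < 1)%R -> Cmod (beta_kernel a b t) = beta_density Unit (Re a) (Re b) t.
Proof.
  intros H. unfold beta_kernel, beta_density. rewrite Cmod_mult, !Cmod_Cpower_pos by lra.
  change (Re (a - 1)) with (Re a - 1)%R. change (Re (b - 1)) with (Re b - 1)%R. simpl. ring.
Qed.

Lemma integrable_beta_kernel (a b : C) : (0 < Re a)%R -> (0 < Re b)%R -> integrable Unit (beta_kernel a b).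
Proof.
  intros Ha Hb. apply (dominated_integrable Unit (Re a) (Re b) 1%R); auto.
  - intros; apply continuousC_beta_kernel; auto.
  - intros; rewrite Cmod_beta_kernel by auto. lra.
Qed.

Lemma Beta_spec (a b : C) : (0 < Re a)%R -> (0 < Re b)%R -> nint Unit (beta_kernel a b) (Beta a b).
Proof. intros; apply Nint_spec, integrable_beta_kernel; auto. Qed.

Lemma Re_succ (a : C) : (0 < Re a)%R -> (0 < Re (a + 1))%R.
Proof. unfold Re; simpl; lra. Qed.

Lemma Beta_sym (a b : C) : (0 < Re a)%R -> (0 < Re b)%R -> Beta a b = Beta b a.
Proof.
  intros Ha Hb. apply (nint_unique Unit (beta_kernel a b)); [apply Beta_spec; auto|].
  apply nint_ext with (fun t => beta_kernel b a (1 - t)%R); [|apply nint_reflect, Beta_spec; auto].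
  intros t _. unfold beta_kernel. replace (1 - (1 - t))%R with t by ring. ring.
Qed.

(** The function t ^ a (1 - t) ^ b vanishes at both ends. *)
Lemma Beta_parts (a b : C) : (0 < Re a)%R -> (0 < Re b)%R ->
  a * Beta a (b + 1) = b * Beta (a + 1) b.
Proof.
  intros Ha Hb.
  assert (H3 : nint Unit (fun t => a * beta_kernel a (b + 1) t - b * beta_kernel (a + 1) b t) 0).
  { destruct (lim_ends_zero Unit (Re a) (Re b) 1%R (beta_kernel (a + 1) (b + 1))) as [L1 L2]; auto.
    - intros t Ht. rewrite Cmod_beta_kernel by auto. unfold beta_density.
      replace (Re (a + 1) - 1)%R with (Re a) by (unfold Re; simpl; ring).
      replace (Re (b + 1) - 1)%R with (Re b) by (unfold Re; simpl; ring). simpl. lra.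
    - apply nint_der_zero with (beta_kernel (a + 1) (b + 1)); auto.
      intros t Ht. simpl in Ht. eapply der_eq.
      + apply der_mult; [apply der_Cpower_pos; lra|apply der_Cpower_reflect; lra].
      + unfold beta_kernel. replace (a + 1 - 1) with a by ring. replace (b + 1 - 1) with b by ring. ring. }
  assert (X := nint_minus _ _ _ _ _ (nint_scal _ a _ _ (Beta_spec a (b + 1) Ha (Re_succ b Hb)))
    (nint_scal _ b _ _ (Beta_spec (a + 1) b (Re_succ a Ha) Hb))).
  apply Ceq_minus. exact (nint_unique _ _ _ _ X H3).
Qed.

Lemma Beta_split (a b : C) : (0 < Re a)%R -> (0 < Re b)%R ->
  Beta a b = Beta (a + 1) b + Beta a (b + 1).
Proof.
  intros Ha Hb. apply (nint_unique Unit (beta_kernel a b)); [apply Beta_spec; auto|].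
  eapply nint_ext; [|apply nint_plus; apply Beta_spec; auto; apply Re_succ; auto].
  intros t Ht. simpl in Ht. unfold beta_kernel.
  replace (a + 1 - 1) with (a - 1 + 1) by ring. replace (b + 1 - 1) with (b - 1 + 1) by ring.
  rewrite !Cpower_plus, !Cpower_1 by (apply offcut_pos; lra). rewrite RtoC_minus. ring.
Qed.

(** Combines the integration by parts with the splitting 1 = t + (1 - t). *)
Lemma Beta_succ (a b : C) : (0 < Re a)%R -> (0 < Re b)%R ->
  (a + b) * Beta (a + 1) b = a * Beta a b.
Proof.
  intros Ha Hb. rewrite (Beta_split a b); auto.
  transitivity (a * Beta (a + 1) b + b * Beta (a + 1) b); [ring|].
  rewrite <- Beta_parts; auto. ring.
Qed.

Lemma Beta_plus_nat (a b : C) (n : nat) : (0 < Re a)%R -> (0 < Re b)%R ->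
  poch (a + b) n * Beta (a + natC n) b = poch a n * Beta a b.
Proof.
  intros Ha Hb. induction n as [|n IH].
  - rewrite natC_0, Cplus_0_r. reflexivity.
  - rewrite natC_S, Cplus_assoc, !poch_S.
    assert (H : (0 < Re (a + natC n))%R) by (rewrite Re_plus_natC; generalize (pos_INR n); lra).
    assert (E := Beta_succ (a + natC n) b H Hb).
    replace (poch (a + b) n * (a + b + natC n) * Beta (a + natC n + 1) b)
      with (poch (a + b) n * ((a + natC n + b) * Beta (a + natC n + 1) b)) by ring.
    rewrite E. transitivity ((a + natC n) * (poch (a + b) n * Beta (a + natC n) b)); [ring|].
    rewrite IH. ring.
Qed.

Lemma Beta_1_l (b : C) : (0 < Re b)%R -> b * Beta 1 b = 1.
Proof.
  intros Hb.
  assert (H : nint Unit (fun t => b * beta_kernel 1 b t) 1).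
  { exists (fun t => - Cpower (RtoC (1 - t)) b), (-1), 0. split; [|split; [|split]].
    - intros t Ht. simpl in Ht. eapply der_eq; [apply der_opp, der_Cpower_reflect; lra|].
      unfold beta_kernel. replace (RtoC 1 - 1) with (RtoC 0) by ring. rewrite Cpower_0. ring.
    - replace (-1 : C) with ((-1) * 1) by ring.
      apply lim_ext with (fun t => (-1) * Cpower (RtoC (1 - t)) b); [typeclasses eauto|apply filter_forall; intros; ring|].
      apply lim_scal; [typeclasses eauto|].
      assert (D := der_Cpower_reflect 0 b Rlt_0_1). apply der_cont in D.
      replace (RtoC 1) with (Cpower (RtoC (1 - 0)) b) by (rewrite Rminus_0_r; apply Cpower_one_base).
      destruct D as [D1 D2].
      split; (eapply filterlim_filter_le_1; [apply filter_le_within|]); [exact D1|exact D2].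
    - apply lim_squeeze with (fun t => Rpower (wt Unit t) (Re b)); [typeclasses eauto| |].
      + generalize (hi_dom Unit). apply filter_imp. intros t Ht. simpl in Ht.
        rewrite Cmod_opp, Cmod_Cpower_pos by lra. simpl. lra.
      + exact (filterlim_comp _ _ _ (wt Unit) (fun x => Rpower x (Re b)) _ _ _ (wt_hi Unit) (Rpower_lim_0 _ Hb)).
    - ring. }
  apply (nint_unique Unit (fun t => b * beta_kernel 1 b t)); auto.
  apply nint_scal, Beta_spec; auto. simpl. lra.
Qed.

(** The Beta integrand after the substitution t / (1 + t) and a dilation by n;
    as n grows it tends to that of Gamma. *)
Definition beta_kernel_half (a : C) (n : R) (c : C) (t : R) : C :=
  Cpower (RtoC t) (a - 1) * Cexp (- c * RtoC (ln (1 + t / n))).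

Lemma Beta_half (a b : C) (n : R) : (0 < Re a)%R -> (0 < Re b)%R -> (0 < n)%R ->
  nint Half (beta_kernel_half a n (a + b)) (Cpower (RtoC n) a * Beta a b).
Proof.
  intros Ha Hb Hn.
  assert (Hi : (0 < / n)%R) by (apply Rinv_0_lt_compat; auto).
  assert (X := nint_scale _ _ (/ n) Hi (nint_to_half _ _ (Beta_spec a b Ha Hb))).
  apply (nint_scal _ (Cpower (RtoC n) a)) in X. revert X. apply nint_ext.
  intros t Ht. simpl in Ht. unfold beta_kernel_half, beta_kernel.
  assert (P : (0 < / n * t)%R) by nra.
  assert (D : dom Half (/ n * t)) by exact P.
  assert (A := tau_pos Half _ D). assert (B := wt_pos Half _ D). assert (S := tau_wt Half _ D).
  replace (1 - tau Half (/ n * t))%R with (wt Half (/ n * t)) by lra.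
  assert (E : tau Half (/ n * t) = (/ n * t * wt Half (/ n * t))%R) by reflexivity.
  rewrite E. rewrite !Cpower_pos_mult by (auto; nra).
  replace (RtoC (dtau Half (/ n * t))) with (Cpower (RtoC (wt Half (/ n * t))) 2).
  2:{ change (dtau Half (/ n * t)) with (wt Half (/ n * t) * wt Half (/ n * t))%R.
      replace (RtoC 2) with (RtoC 1 + 1) by (rewrite <- RtoC_plus; f_equal).
      rewrite Cpower_plus, Cpower_1, RtoC_mult by (apply offcut_pos; auto). reflexivity. }
  rewrite Cpower_pos_inv by auto.
  replace (RtoC (/ n)) with (Cpower (RtoC n) (-1)).
  2:{ replace (RtoC (-1)) with (- RtoC 1) by (rewrite <- RtoC_opp; f_equal; ring).
      rewrite Cpower_opp, Cpower_1 by (apply offcut_pos; auto). rewrite RtoC_inv by lra. reflexivity. }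
  replace (Cexp (- (a + b) * RtoC (ln (1 + t / n)))) with (Cpower (RtoC (wt Half (/ n * t))) (a + b)).
  2:{ rewrite Cpower_pos by auto. f_equal. change (wt Half (/ n * t)) with (/ (1 + / n * t))%R.
      rewrite ln_Rinv by lra. replace (/ n * t)%R with (t / n)%R by (unfold Rdiv; ring).
      rewrite RtoC_opp. ring. }
  set (N := RtoC n). set (T := RtoC t). set (W := RtoC (wt Half (/ n * t))).
  replace (Cpower W (a + b)) with (Cpower W 2 * (Cpower W (a - 1) * Cpower W (b - 1)))
    by (rewrite <- !Cpower_plus; f_equal; ring).
  transitivity (Cpower N a * Cpower N (-1) * Cpower N (- (a - 1)) *
     (Cpower T (a - 1) * (Cpower W 2 * (Cpower W (a - 1) * Cpower W (b - 1))))); [ring|].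
  rewrite <- !(Cpower_plus N). replace (a + -1 + - (a - 1)) with (RtoC 0) by ring.
  rewrite Cpower_0. ring.
Qed.

(** * Gamma as a limit of Beta functions *)

Lemma Cexp_diff_le (z w : C) (M : R) : (exp (Re z) <= M)%R -> (exp (Re w) <= M)%R ->
  (Cmod (Cexp z - Cexp w) <= Cmod (z - w) * M)%R.
Proof.
  intros H1 H2.
  assert (X := mean_value_le (fun u => Cexp (w + RtoC u * (z - w)))
    (fun u => (z - w) * Cexp (w + RtoC u * (z - w))) (fun u => (Cmod (z - w) * M * u)%R)
    (fun _ => (Cmod (z - w) * M)%R) 0 1 ltac:(lra)).
  cbv beta in X.
  replace (w + RtoC 1 * (z - w)) with z in X by ring.
  replace (w + RtoC 0 * (z - w)) with w in X by ring.
  replace (Cmod (z - w) * M)%R with (Cmod (z - w) * M * 1 - Cmod (z - w) * M * 0)%R by ring.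
  apply X.
  - intros u _. eapply der_eq.
    + apply der_Cexp, der_plus; [apply der_const|apply der_mult; [apply der_id|apply der_const]].
    + cbv beta. ring.
  - intros; auto_derive; [auto|ring].
  - intros u Hu. rewrite Cmod_mult, Cmod_Cexp. apply Rmult_le_compat_l; [apply Cmod_ge_0|].
    replace (Re (w + RtoC u * (z - w))) with (Re w + u * (Re z - Re w))%R by (unfold Re; simpl; ring).
    destruct (Rle_dec (Re z) (Re w)).
    + eapply Rle_trans; [|exact H2]. apply exp_le_compat. nra.
    + eapply Rle_trans; [|exact H1]. apply exp_le_compat. nra.
Qed.

Lemma monotone_le (h h' : R -> R) (b : R) : (0 <= b)%R ->
  (forall t, (0 <= t <= b)%R -> is_derive h t (h' t)) ->
  (forall t, (0 <= t <= b)%R -> (0 <= h' t)%R) -> (h 0 <= h b)%R.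
Proof.
  intros Hb Hd Hp.
  assert (X := mean_value_le (fun _ => 0) (fun _ => 0) h h' 0 b Hb).
  assert (0 <= h b - h 0)%R; [|lra].
  eapply Rle_trans; [apply Cmod_ge_0|apply X]; auto.
  - intros; apply der_const.
  - intros; rewrite Cmod_0; auto.
Qed.

Lemma ln_1p_le (y : R) : (0 <= y)%R -> (ln (1 + y) <= y)%R.
Proof. intros H. assert (L := ln_le_sub_1 (1 + y) ltac:(lra)). lra. Qed.

Lemma ln_1p_ge0 (y : R) : (0 <= y)%R -> (0 <= ln (1 + y))%R.
Proof. intros H. rewrite <- ln_1. apply ln_le; lra. Qed.

Lemma ln_1p_ge (y : R) : (0 <= y)%R -> (y - y * y / 2 <= ln (1 + y))%R.
Proof.
  intros H.
  assert (X := monotone_le (fun y => (ln (1 + y) - (y - y * y / 2))%R)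
    (fun y => (/ (1 + y) - (1 - y))%R) y H).
  cbv beta in X. rewrite Rplus_0_r, ln_1 in X.
  enough (0 - (0 - 0 * 0 / 2) <= ln (1 + y) - (y - y * y / 2))%R by lra.
  apply X; intros t Ht.
  - auto_derive; [lra|]. field. lra.
  - replace (/ (1 + t) - (1 - t))%R with (t * t * / (1 + t))%R by (field; lra).
    assert (0 < / (1 + t))%R by (apply Rinv_0_lt_compat; lra). nra.
Qed.

(** Bernoulli's inequality for a real exponent, in logarithmic form: it makes
    (1 + t / n) ^ n nondecreasing in n. *)
Lemma ln_bernoulli (r y : R) : (1 <= r)%R -> (0 <= y)%R -> (ln (1 + r * y) <= r * ln (1 + y))%R.
Proof.
  intros Hr H.
  assert (X := monotone_le (fun y => (r * ln (1 + y) - ln (1 + r * y))%R)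
    (fun y => (r / (1 + y) - r / (1 + r * y))%R) y H).
  cbv beta in X. rewrite Rmult_0_r, !Rplus_0_r, ln_1 in X.
  enough (r * 0 - 0 <= r * ln (1 + y) - ln (1 + r * y))%R by lra.
  apply X; intros t Ht.
  - auto_derive; [split; [lra|split; [nra|auto]]|]. field. split; nra.
  - assert (P : (1 + t <= 1 + r * t)%R) by nra.
    assert (/ (1 + r * t) <= / (1 + t))%R by (apply Rinv_le_contravar; lra).
    unfold Rdiv. nra.
Qed.

(** On (0, +oo) the Beta integrand becomes t ^ (a - 1) (1 + t / n) ^ (- n -
    g), which differs from t ^ (a - 1) exp (- t) by O(1 / n), uniformly under
    an integrable bound. *)
Lemma Beta_Gamma_limit (a g : C) : (0 < Re a)%R -> (0 < Re g)%R ->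
  exists C0 n0, forall (n : R) (b : C), (n0 <= n)%R -> (0 < Re b)%R -> a + b = RtoC n + g ->
    (Cmod (Cpower (RtoC n) a * Beta a b - Gamma a) <= C0 / n)%R.
Proof.
  intros Ha Hg. set (K := (3 + Re a)%R). set (c := exp (K * ln K)).
  destruct (dominated_bound Half (Re a) 1 Ha ltac:(lra)) as [K0 [HK0 Hb]].
  assert (Pg := Cmod_ge_0 g).
  exists ((1 + Cmod g) * c * K0)%R, K. intros n b Hn Hre Hab.
  assert (HK : (3 < K)%R) by (unfold K; lra).
  assert (Hc : (0 < c)%R) by apply exp_pos.
  assert (X := nint_minus _ _ _ _ _ (Beta_half a b n Ha Hre ltac:(lra)) (Gamma_nint a Ha)).
  assert (Hn' : (0 < / n)%R) by (apply Rinv_0_lt_compat; lra).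
  replace ((1 + Cmod g) * c * K0 / n)%R with ((1 + Cmod g) * c * / n * K0)%R by (unfold Rdiv; ring).
  eapply Hb; [|exact X|].
  { apply Rmult_le_pos; [apply Rmult_le_pos|]; lra. }
  intros t Ht. simpl in Ht. unfold beta_kernel_half. rewrite Hab.
  set (f := ln (1 + t / n)).
  assert (Hy : (0 < t / n)%R) by (apply Rdiv_lt_0_compat; lra).
  assert (F1 : (f <= t / n)%R) by (apply ln_1p_le; lra).
  assert (F2 : (t / n - t / n * (t / n) / 2 <= f)%R) by (apply ln_1p_ge; lra).
  assert (F0 : (0 <= f)%R) by (apply ln_1p_ge0; lra).
  assert (D : dom Half t) by exact Ht.
  assert (W := wt_pos Half t D). assert (W1 := wt_le1 Half t D).
  (* both exponentials are below (1 + t / K) ^ (- K) *)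
  set (M := (c * Rpower (wt Half t) K)%R).
  assert (HM : forall u, (K * ln (1 + t / K) <= u)%R -> (exp (- u) <= M)%R).
  { intros u Hu. unfold M, c, Rpower. rewrite <- exp_plus. apply exp_le_compat.
    unfold wt. rewrite ln_Rinv by lra.
    assert (ln (1 + t) - ln K <= ln (1 + t / K))%R; [|nra].
    unfold Rminus. rewrite <- ln_Rinv, <- ln_mult by (try apply Rinv_0_lt_compat; lra).
    assert (Q : (0 < / K)%R) by (apply Rinv_0_lt_compat; lra).
    assert (Q1 : (/ K <= 1)%R) by (rewrite <- Rinv_1; apply Rinv_le_contravar; lra).
    apply ln_le; unfold Rdiv; nra. }
  assert (HtK : (0 < t / K)%R) by (apply Rdiv_lt_0_compat; lra).
  assert (HB : (K * ln (1 + t / K) <= n * f)%R).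
  { assert (L := ln_bernoulli (n / K) (t / n)).
    replace (n / K * (t / n))%R with (t / K)%R in L by (field; lra).
    assert (1 <= n / K)%R by (apply Rle_div_r; lra).
    specialize (L ltac:(lra) ltac:(lra)). fold f in L.
    replace (n * f)%R with (K * (n / K * f))%R by (field; lra).
    apply Rmult_le_compat_l; lra. }
  assert (HT : (K * ln (1 + t / K) <= t)%R).
  { assert (L := ln_1p_le (t / K) ltac:(lra)).
    replace t with (K * (t / K))%R at 2 by (field; lra). apply Rmult_le_compat_l; lra. }
  assert (E1 := Cexp_diff_le (- (RtoC n + g) * RtoC f) (- RtoC t) M).
  replace (Cpower (RtoC t) (a - 1) * Cexp (- (RtoC n + g) * RtoC f) -
    Cpower (RtoC t) (a - 1) * Cexp (- RtoC t)) with
    (Cpower (RtoC t) (a - 1) * (Cexp (- (RtoC n + g) * RtoC f) - Cexp (- RtoC t))) by ring.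
  rewrite Cmod_mult, Cmod_Cpower_pos by auto. change (Re (a - 1)) with (Re a - 1)%R.
  assert (E2 : (Cmod (Cexp (- (RtoC n + g) * RtoC f) - Cexp (- RtoC t)) <=
     (1 + Cmod g) * / n * (/ wt Half t * / wt Half t) * M)%R).
  { eapply Rle_trans; [apply E1|].
    - replace (Re (- (RtoC n + g) * RtoC f)) with (- (n * f + Re g * f))%R by (unfold Re; simpl; ring).
      apply HM. nra.
    - replace (Re (- RtoC t)) with (- t)%R by (unfold Re; simpl; ring). apply HM; auto.
    - apply Rmult_le_compat_r; [unfold M; assert (Y := Rpower_pos (wt Half t) K); nra|].
      replace (- (RtoC n + g) * RtoC f - - RtoC t) with (RtoC (t - n * f) - g * RtoC f)
        by (rewrite RtoC_minus, RtoC_mult; ring).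
      eapply Rle_trans; [apply Cmod_triangle_minus|]. rewrite Cmod_mult, !Cmod_R, (Rabs_right f) by lra.
      assert (G1 : (n * f <= t)%R).
      { replace t with (n * (t / n))%R at 1 by (field; lra). apply Rmult_le_compat_l; lra. }
      assert (G2 : (t - n * f <= t * t / 2 * / n)%R).
      { assert (n * (t / n - t / n * (t / n) / 2) <= n * f)%R by (apply Rmult_le_compat_l; lra).
        replace (n * (t / n - t / n * (t / n) / 2))%R with (t - t * t / 2 * / n)%R in H by (field; lra). lra. }
      rewrite Rabs_right by lra.
      replace (/ wt Half t)%R with (1 + t)%R by (simpl; field; lra).
      assert (Cmod g * f <= Cmod g * (t * / n))%R by (apply Rmult_le_compat_l; auto).
      assert (t * t / 2 * / n <= (1 + t) * (1 + t) * / n)%R by (apply Rmult_le_compat_r; nra).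
      assert (Cmod g * (t * / n) <= Cmod g * ((1 + t) * (1 + t) * / n))%R.
      { apply Rmult_le_compat_l; auto. apply Rmult_le_compat_r; nra. }
      nra. }
  eapply Rle_trans; [apply Rmult_le_compat_l; [left; apply Rpower_pos|exact E2]|].
  rewrite beta_density_half, (Rpower_half t) by auto. unfold M.
  right.
  replace (Rpower (wt Half t) (1 + 1))%R with
    (Rpower (wt Half t) (- (Re a - 1)) * (/ wt Half t * / wt Half t) * Rpower (wt Half t) K)%R; [ring|].
  replace (/ wt Half t)%R with (Rpower (wt Half t) (- (1))) by (rewrite Rpower_Ropp, Rpower_1; auto).
  rewrite <- !Rpower_plus. f_equal. unfold K. ring.
Qed.

Lemma lim_of_rate (u : nat -> C) (l : C) (C0 n0 : R) :
  (forall n, (0 < n)%nat -> (n0 <= INR n)%R -> (Cmod (u n - l) <= C0 / INR n)%R) ->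
  lim_at eventually u l.
Proof.
  intros H. apply lim_eps; [typeclasses eauto|]. intros eps He.
  destruct (INR_unbounded (Rmax n0 (Rabs C0 / eps))) as [N HN].
  exists (S N). intros n Hn.
  assert (L : (INR N < INR n)%R) by (apply lt_INR; lia).
  assert (P : (0 < INR n)%R) by (apply lt_0_INR; lia).
  assert (M1 := Rmax_l n0 (Rabs C0 / eps)). assert (M2 := Rmax_r n0 (Rabs C0 / eps)).
  eapply Rle_lt_trans; [apply H; [lia|lra]|].
  apply Rmult_lt_reg_r with (INR n); auto. unfold Rdiv.
  rewrite Rmult_assoc, Rinv_l, Rmult_1_r by lra.
  eapply Rle_lt_trans; [apply Rle_abs|].
  replace (Rabs C0) with (eps * (Rabs C0 / eps))%R by (field; lra).
  apply Rmult_lt_compat_l; lra.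
Qed.

Lemma Re_natC_pos (z : C) (n : nat) : (0 < Re z)%R -> (0 < Re (z + natC n))%R.
Proof. intros H. rewrite Re_plus_natC. generalize (pos_INR n). lra. Qed.

Lemma Beta_nat_eq (z : C) (n : nat) : (0 < Re z)%R ->
  poch z (S n) * Beta z (1 + natC n) = factC n.
Proof.
  intros Hz. assert (H1 : (0 < Re 1)%R) by (simpl; lra).
  rewrite Beta_sym by (auto; apply Re_natC_pos; auto).
  rewrite poch_head. replace (z + 1) with (1 + z) by ring.
  transitivity (z * (poch (1 + z) n * Beta (1 + natC n) z)); [ring|].
  rewrite Beta_plus_nat by auto.
  transitivity (poch 1 n * (z * Beta 1 z)); [ring|].
  rewrite Beta_1_l, poch_1 by auto. ring.
Qed.

(** By [Beta_nat_eq] the sequence is n! n ^ z / (z)_(n+1), Euler's product for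
    Gamma. *)
Lemma Gamma_euler_limit (z : C) : (0 < Re z)%R ->
  lim_at eventually (fun n => Cpower (natC n) z * Beta z (1 + natC n)) (Gamma z).
Proof.
  intros Hz. destruct (Beta_Gamma_limit z (z + 1) Hz (Re_succ z Hz)) as [C0 [n0 H]].
  apply lim_of_rate with C0 n0. intros n Hn Hn0.
  apply (H (INR n) (1 + natC n)); auto.
  - apply Re_natC_pos. simpl. lra.
  - unfold natC. ring.
Qed.

(** Write n ^ a B(a, b + n), which tends to Gamma a, as B(a, b) (b)_n n ^ a /
    (a + b)_n and recognise Euler's products for b and a + b. *)
Lemma Gamma_mult_Beta (a b : C) : (0 < Re a)%R -> (0 < Re b)%R ->
  Gamma a * Gamma b = Beta a b * Gamma (a + b).
Proof.
  intros Ha Hb. assert (Hab : (0 < Re (a + b))%R) by (unfold Re in *; simpl; lra).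
  assert (L1 : lim_at eventually (fun n => Cpower (natC n) a * Beta a (b + natC n)) (Gamma a)).
  { destruct (Beta_Gamma_limit a (a + b) Ha Hab) as [C0 [n0 H]].
    apply lim_of_rate with C0 n0. intros n Hn Hn0. apply (H (INR n) (b + natC n)); auto.
    - apply Re_natC_pos; auto.
    - unfold natC. ring. }
  assert (Lq : forall z, lim_at eventually (fun n => (z + natC n) / natC n) 1).
  { intros z. apply lim_of_rate with (Cmod z) 0%R. intros n Hn _.
    assert (P : (0 < INR n)%R) by (apply lt_0_INR; auto).
    assert (N : natC n <> 0) by (intros E; apply RtoC_inj in E; lra).
    replace ((z + natC n) / natC n - 1) with (z / natC n) by (field; auto).
    rewrite Cmod_div by auto. unfold natC. rewrite Cmod_RtoC_pos by lra. lra. }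
  assert (L2 := lim_mult eventually _ _ _ _ (lim_mult eventually _ _ _ _ L1 (Gamma_euler_limit b Hb)) (Lq b)).
  assert (L3 := lim_mult eventually _ _ _ _ (lim_scal eventually (Beta a b) _ _ (Gamma_euler_limit (a + b) Hab)) (Lq (a + b))).
  replace (Gamma a * Gamma b) with (Gamma a * Gamma b * 1) by ring.
  replace (Beta a b * Gamma (a + b)) with (Beta a b * Gamma (a + b) * 1) by ring.
  eapply lim_unique; [|exact L2|]; [typeclasses eauto|].
  eapply lim_ext; [| |exact L3]; [typeclasses eauto|].
  exists 1%nat. intros n Hn.
  assert (P : (0 < INR n)%R) by (apply lt_0_INR; lia).
  assert (N : natC n <> 0) by (intros E; apply RtoC_inj in E; lra).
  assert (E1 := Beta_nat_eq b n Hb). assert (E2 := Beta_nat_eq (a + b) n Hab).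
  assert (E3 := Beta_plus_nat b a n Hb Ha).
  rewrite (Beta_sym b a), (Beta_sym (b + natC n) a) in E3 by (auto; apply Re_natC_pos; auto).
  replace (b + a) with (a + b) in E3 by ring.
  rewrite !poch_S in E1, E2.
  assert (Nb := poch_neq_0 b n Hb). assert (Nab := poch_neq_0 (a + b) n Hab).
  rewrite Cpower_plus.
  set (X := Cpower (natC n) a) in *. set (Y := Cpower (natC n) b) in *.
  set (B1 := Beta (a + b) (1 + natC n)) in *. set (B2 := Beta b (1 + natC n)) in *.
  set (B3 := Beta a (b + natC n)) in *. set (pb := poch b n) in *. set (pab := poch (a + b) n) in *.
  assert (K : Beta a b * B1 * (a + b + natC n) = B3 * B2 * (b + natC n)).
  { transitivity (Beta a b * (pab * (a + b + natC n) * B1) / pab); [field; auto|].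
    rewrite E2, <- E1.
    transitivity (pb * Beta a b * (b + natC n) * B2 / pab); [field; auto|].
    rewrite <- E3. field. auto. }
  transitivity (X * Y * (Beta a b * B1 * (a + b + natC n)) / natC n); [field; auto|].
  rewrite K. field. auto.
Qed.

Lemma Cmod_plus_pos_le (z : C) (k : R) : (0 < k)%R ->
  (Cmod (z + RtoC k) <= k * exp (Re z / k + Cmod z * Cmod z / (2 * (k * k))))%R.
Proof.
  intros Hk. apply Rsqr_incr_0_var.
  2:{ apply Rmult_le_pos; [lra|left; apply exp_pos]. }
  unfold Rsqr. rewrite Cmod_sqr.
  set (e := (Re z / k + Cmod z * Cmod z / (2 * (k * k)))%R).
  replace (k * exp e * (k * exp e))%R with (k * k * exp (2 * e))%R
    by (replace (2 * e)%R with (e + e)%R by ring; rewrite exp_plus; ring).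
  apply Rle_trans with (k * k * (1 + 2 * e))%R.
  - unfold e. rewrite Cmod_sqr. right. unfold Re, Im; simpl. field. lra.
  - apply Rmult_le_compat_l; [nra|]. apply exp_ineq1_le.
Qed.

(** Each factor of (z)_n / n! is at most exp (Re z / k + |z| ^ 2 / (2 k ^ 2));
    the harmonic sum is below 1 + ln n and the sum of inverse squares below 2.
    *)
Lemma poch_growth (z : C) (n : nat) : (0 < Re z)%R ->
  (Cmod (poch z (S (S n))) <= Cmod z * INR (fact (S n)) *
     exp (Re z * (1 + ln (INR (S n))) + Cmod z * Cmod z / 2 * (2 - / INR (S n))))%R.
Proof.
  intros Hz. set (m := (Cmod z * Cmod z / 2)%R).
  assert (Hm : (0 <= m)%R) by (unfold m; generalize (Cmod_ge_0 z); intros; nra).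
  induction n as [|n IH].
  - assert (X := Cmod_plus_pos_le z 1 Rlt_0_1).
    rewrite poch_S, poch_S, !Cmod_mult. simpl poch. rewrite Cmod_1, natC_0, Cplus_0_r, Rmult_1_l.
    unfold natC. simpl fact. simpl INR. rewrite Rmult_1_r. apply Rmult_le_compat_l; [apply Cmod_ge_0|].
    eapply Rle_trans; [exact X|]. rewrite Rmult_1_l. apply exp_le_compat.
    rewrite ln_1. unfold m. right. field.
  - rewrite poch_S, Cmod_mult.
    set (k := S (S n)) in *. set (N := INR (S n)) in *.
    assert (HN : (1 <= N)%R) by (unfold N; rewrite S_INR; generalize (pos_INR n); lra).
    assert (Hk : INR k = (N + 1)%R) by (unfold k, N; rewrite (S_INR (S n)); ring).
    assert (X := Cmod_plus_pos_le z (INR k) ltac:(lra)). unfold natC.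
    replace (fact k) with (k * fact (S n))%nat by reflexivity. rewrite mult_INR.
    eapply Rle_trans; [apply Rmult_le_compat; [apply Cmod_ge_0|apply Cmod_ge_0|exact IH|exact X]|].
    rewrite Hk in *.
    set (A := (Re z * (1 + ln N) + m * (2 - / N))%R).
    set (B := (Re z / (N + 1) + Cmod z * Cmod z / (2 * ((N + 1) * (N + 1))))%R).
    replace (Cmod z * INR (fact (S n)) * exp A * ((N + 1) * exp B))%R
      with (Cmod z * ((N + 1) * INR (fact (S n))) * exp (A + B))%R by (rewrite exp_plus; ring).
    apply Rmult_le_compat_l.
    { apply Rmult_le_pos; [apply Cmod_ge_0|]. apply Rmult_le_pos; [lra|apply pos_INR]. }
    apply exp_le_compat. unfold A, B.
    assert (L : (/ (N + 1) <= ln (N + 1) - ln N)%R).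
    { assert (P : (0 < N / (N + 1))%R) by (apply Rdiv_lt_0_compat; lra).
      assert (Y := ln_le_sub_1 _ P). unfold Rdiv in Y at 1.
      rewrite ln_mult, ln_Rinv in Y by (try apply Rinv_0_lt_compat; lra).
      replace (N / (N + 1) - 1)%R with (- / (N + 1))%R in Y by (field; lra). lra. }
    assert (S : (/ ((N + 1) * (N + 1)) <= / N - / (N + 1))%R).
    { replace (/ N - / (N + 1))%R with (/ (N * (N + 1)))%R by (field; lra).
      apply Rinv_le_contravar; nra. }
    replace (Cmod z * Cmod z / (2 * ((N + 1) * (N + 1))))%R with (m * / ((N + 1) * (N + 1)))%R
      by (unfold m; field; lra).
    assert (Re z * / (N + 1) <= Re z * (ln (N + 1) - ln N))%R by (apply Rmult_le_compat_l; lra).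
    assert (m * / ((N + 1) * (N + 1)) <= m * (/ N - / (N + 1)))%R by (apply Rmult_le_compat_l; lra).
    unfold Rdiv. lra.
Qed.

(** Euler's product stays away from 0, because (z)_(n+1) is O(n! n ^ (Re z))
    by [poch_growth]. *)
Lemma Gamma_neq_0 (z : C) : (0 < Re z)%R -> Gamma z <> 0.
Proof.
  intros Hz H0. assert (L := Gamma_euler_limit z Hz). rewrite H0 in L.
  assert (Nz := Re_pos_neq_0 z Hz). assert (Pz := proj1 (Cmod_gt_0 z) Nz).
  set (m := (Cmod z * Cmod z / 2)%R). assert (Hm : (0 <= m)%R) by (unfold m; nra).
  set (d := (/ (Cmod z * exp (Re z + m * 2)))%R).
  assert (Pd : (0 < Cmod z * exp (Re z + m * 2))%R) by (apply Rmult_lt_0_compat; [auto|apply exp_pos]).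
  assert (Hd : (0 < d)%R) by (apply Rinv_0_lt_compat; auto).
  assert (L' := proj1 (lim_eps _ _ _) L d Hd). destruct L' as [N HN].
  specialize (HN (S N) ltac:(lia)). cbv beta in HN.
  set (n := S N) in *. assert (G := poch_growth z N Hz). fold n in G.
  assert (E := Beta_nat_eq z n Hz). apply (f_equal Cmod) in E. rewrite Cmod_mult in E.
  unfold factC, natC in E. rewrite (Cmod_RtoC_pos (INR (fact n))) in E by apply pos_INR.
  assert (Pn : (0 < INR n)%R) by (apply lt_0_INR; unfold n; lia).
  assert (Pf := INR_fact_lt_0 n).
  replace (Cpower (natC n) z * Beta z (1 + natC n) - 0) with (Cpower (natC n) z * Beta z (1 + natC n)) in HN by ring.
  rewrite Cmod_mult in HN. unfold natC in HN. rewrite Cmod_Cpower_pos in HN by auto.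
  set (B := Cmod (Beta z (1 + RtoC (INR n)))) in *.
  assert (PB : (0 <= B)%R) by apply Cmod_ge_0.
  assert (PR := Rpower_pos (INR n) (Re z)).
  assert (G2 : (Cmod (poch z (S n)) <= Cmod z * exp (Re z + m * 2) * (INR (fact n) * Rpower (INR n) (Re z)))%R).
  { eapply Rle_trans; [exact G|]. fold m. unfold Rpower.
    replace (Cmod z * exp (Re z + m * 2) * (INR (fact n) * exp (Re z * ln (INR n))))%R with
      (Cmod z * INR (fact n) * exp (Re z + m * 2 + Re z * ln (INR n)))%R by (rewrite !exp_plus; ring).
    apply Rmult_le_compat_l; [nra|]. apply exp_le_compat.
    assert (0 < / INR n)%R by (apply Rinv_0_lt_compat; auto). nra. }
  assert (X : (INR (fact n) <= Cmod z * exp (Re z + m * 2) * (INR (fact n) * Rpower (INR n) (Re z)) * B)%R).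
  { rewrite <- E at 1. apply Rmult_le_compat_r; auto. }
  set (D := (Cmod z * exp (Re z + m * 2))%R) in *.
  assert (Y : (D * (Rpower (INR n) (Re z) * B) < 1)%R).
  { replace 1%R with (D * d)%R by (unfold d; field; lra). apply Rmult_lt_compat_l; auto. }
  nra.
Qed.

(** * Taylor expansion of complex powers *)

Lemma Csum_O (u : nat -> C) : sum_n u 0 = u 0%nat :> C.
Proof. apply sum_O. Qed.

Lemma Csum_S (u : nat -> C) (n : nat) : sum_n u (S n) = sum_n u n + u (S n) :> C.
Proof. rewrite sum_Sn. reflexivity. Qed.

Lemma Csum_ext (u v : nat -> C) (n : nat) : (forall k, (k <= n)%nat -> u k = v k) -> sum_n u n = sum_n v n :> C.
Proof. apply sum_n_ext_loc. Qed.

Lemma Csum_scal (c : C) (u : nat -> C) (n : nat) : sum_n (fun k => c * u k) n = c * sum_n u n :> C.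
Proof.
  induction n as [|n IH]; [rewrite !Csum_O; reflexivity|]. rewrite !Csum_S, IH. ring.
Qed.

Lemma Csum_plus (u v : nat -> C) (n : nat) : sum_n (fun k => u k + v k) n = sum_n u n + sum_n v n :> C.
Proof.
  induction n as [|n IH]; [rewrite !Csum_O; reflexivity|]. rewrite !Csum_S, IH. ring.
Qed.

Lemma Csum_first (u : nat -> C) (n : nat) : (forall k, (0 < k <= n)%nat -> u k = 0) -> sum_n u n = u 0%nat :> C.
Proof.
  induction n as [|n IH]; intros H; [apply Csum_O|].
  rewrite Csum_S, IH, (H (S n)) by (try (intros; apply H); lia). ring.
Qed.

Lemma Cmod_sum_le (u : nat -> C) (v : nat -> R) (n : nat) :
  (forall k, (k <= n)%nat -> (Cmod (u k) <= v k)%R) -> (Cmod (sum_n u n) <= sum_n v n)%R.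
Proof.
  induction n as [|n IH]; intros H.
  - rewrite Csum_O, sum_O. apply H. lia.
  - rewrite Csum_S, sum_Sn. eapply Rle_trans; [apply Cmod_triangle|].
    apply Rplus_le_compat; [apply IH; intros; apply H; lia|apply H; lia].
Qed.

(** Moving the centre of a Taylor polynomial telescopes all but the last term.
    *)
Lemma der_taylor_sum (p q b : C) (n : nat) (s : R) : offcut (p - RtoC s * q) ->
  der (fun s => sum_n (fun m => poch b m / factC m * q ^ m *
         (Cpower (p - RtoC s * q) (- b - natC m) * (1 - RtoC s) ^ m)) n) s
    (poch b (S n) / factC n * q ^ (S n) *
       (Cpower (p - RtoC s * q) (- b - natC (S n)) * (1 - RtoC s) ^ n)).
Proof.
  intros Ho.
  assert (Dp : forall w, der (fun s => Cpower (p - RtoC s * q) w) s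
    (- (w * q * Cpower (p - RtoC s * q) (w - 1)))).
  { intros w. eapply der_eq.
    - apply der_Cpower; [exact Ho|]. apply der_minus; [apply der_const|].
      apply der_mult; [apply der_id|apply der_const].
    - cbv beta. ring. }
  assert (D1 : forall m, der (fun s => (1 - RtoC s) ^ m) s (- (natC m * (1 - RtoC s) ^ (m - 1)))).
  { intros m. eapply der_eq.
    - apply der_pow, der_minus; [apply der_const|apply der_id].
    - cbv beta. ring. }
  assert (X : forall w, w - natC n - 1 = w - natC (S n)) by (intros; rewrite natC_S; ring).
  induction n as [|n IH].
  - apply der_ext with (fun s => Cpower (p - RtoC s * q) (- b)).
    { intros s'. rewrite Csum_O, natC_0. simpl. replace (- b - 0) with (- b) by ring.
      unfold factC, natC; simpl. field. }
    eapply der_eq; [apply Dp|]. rewrite <- X, natC_0.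
    replace (- b - 0 - 1) with (- b - 1) by ring. rewrite poch_S, natC_0.
    unfold factC, natC; simpl. field.
  - eapply der_ext; [intros s'; symmetry; apply Csum_S|].
    eapply der_eq.
    + apply der_plus; [apply IH; intros; rewrite natC_S; ring|].
      apply der_scal, der_mult; [apply Dp|apply D1].
    + cbv beta. rewrite X. replace (S n - 1)%nat with n by lia.
      rewrite (poch_S b (S n)), factC_S, !Cpow_S.
      assert (N1 := natC_S_neq_0 n). assert (N2 := factC_neq_0 n).
      field. auto.
Qed.

(** The remainder is the increment between s = 0 and s = 1 of the sum in
    [der_taylor_sum]. The factor ((1 - s) q / (p - s q)) ^ n of its derivative
    is at most rho ^ n, which gives convergence in the whole disc |q| < |p| in
    which the power is defined. *)
Lemma power_taylor (p q b : C) (n : nat) (rho K : R) :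
  (forall s, (0 <= s <= 1)%R -> offcut (p - RtoC s * q)) ->
  (rho <= 1)%R -> (Cmod q <= rho * Cmod p)%R ->
  (forall s, (0 <= s <= 1)%R -> (Cmod q * Cmod (Cpower (p - RtoC s * q) (- b - 1)) <= K)%R) ->
  (Cmod (Cpower (p - q) (- b) -
     sum_n (fun m => (poch b m / factC m * Cpower p (- b - natC m) * q ^ m)%C) n)
   <= K * (Cmod (poch b (S n)) / INR (fact n) * rho ^ n))%R.
Proof.
  intros Ho Hr Hq HK.
  set (L := (K * (Cmod (poch b (S n)) / INR (fact n) * rho ^ n))%R).
  assert (Pp : (0 < Cmod p)%R).
  { assert (H := offcut_Cmod_pos _ (Ho 0%R ltac:(lra))).
    replace (p - RtoC 0 * q) with p in H by ring. exact H. }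
  assert (Pq := Cmod_ge_0 q). assert (Pf := INR_fact_lt_0 n).
  assert (Hr0 : (0 <= rho)%R) by nra.
  assert (X := mean_value_le (fun s => sum_n (fun m => poch b m / factC m * q ^ m *
         (Cpower (p - RtoC s * q) (- b - natC m) * (1 - RtoC s) ^ m)) n)
    (fun s => poch b (S n) / factC n * q ^ (S n) *
       (Cpower (p - RtoC s * q) (- b - natC (S n)) * (1 - RtoC s) ^ n))
    (fun s => (L * s)%R) (fun _ => L) 0 1 ltac:(lra)).
  cbv beta in X.
  rewrite (Csum_first (fun m => poch b m / factC m * q ^ m *
         (Cpower (p - RtoC 1 * q) (- b - natC m) * (1 - RtoC 1) ^ m))) in X.
  2:{ intros [|k] Hk; [lia|]. rewrite (Cpow_S (1 - RtoC 1) k). ring. }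
  replace (poch b 0 / factC 0 * q ^ 0 * (Cpower (p - 1 * q) (- b - natC 0) * (1 - 1) ^ 0))
    with (Cpower (p - q) (- b)) in X.
  2:{ rewrite natC_0, Cmult_1_l. replace (- b - 0) with (- b) by ring.
      unfold factC, natC; simpl. field. }
  rewrite (Csum_ext _ (fun m => poch b m / factC m * Cpower p (- b - natC m) * q ^ m)) in X.
  2:{ intros k _. replace (1 - RtoC 0) with (RtoC 1) by ring.
      replace (p - RtoC 0 * q) with p by ring. rewrite Cpow_1_l. ring. }
  replace (L * 1 - L * 0)%R with L in X by ring. apply X.
  - intros s Hs. apply der_taylor_sum, Ho; auto.
  - intros; auto_derive; [auto|ring].
  - intros s Hs. specialize (Ho s Hs). specialize (HK s Hs).
    set (z := p - RtoC s * q) in *. assert (Nz := offcut_neq_0 z Ho). assert (Pz := offcut_Cmod_pos z Ho).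
    replace (- b - natC (S n)) with (- b - 1 - natC n) by (rewrite natC_S; ring).
    rewrite Cpower_sub_nat by auto. unfold L.
    replace (poch b (S n) / factC n * q ^ S n * (Cpower z (- b - 1) / z ^ n * (1 - RtoC s) ^ n))
      with (poch b (S n) / factC n * (q * Cpower z (- b - 1)) * (q * (1 - RtoC s) / z) ^ n).
    2:{ unfold Cdiv. rewrite !Cpow_mult_l, Cpow_S, Cpow_inv by auto. ring. }
    rewrite !Cmod_mult, Cmod_pow, Cmod_div by apply factC_neq_0.
    unfold factC, natC at 1. rewrite (Cmod_RtoC_pos (INR (fact n))) by lra.
    assert (Hz : (Cmod p - s * Cmod q <= Cmod z)%R).
    { unfold z. eapply Rle_trans; [|apply Cmod_triangle_rev].
      rewrite Cmod_mult, (Cmod_RtoC_pos s) by lra. lra. }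
    assert (Hrat : (Cmod (q * (1 - RtoC s) / z) <= rho)%R).
    { rewrite Cmod_div, Cmod_mult by auto. rewrite <- RtoC_minus, Cmod_RtoC_pos by lra.
      apply Rmult_le_reg_r with (Cmod z); auto. unfold Rdiv. rewrite Rmult_assoc, Rinv_l, Rmult_1_r by lra.
      assert (rho * (Cmod p - s * Cmod q) <= rho * Cmod z)%R by (apply Rmult_le_compat_l; auto).
      assert (rho * s * Cmod q <= s * Cmod q)%R.
      { rewrite Rmult_assoc. rewrite <- (Rmult_1_l (s * Cmod q)) at 2. apply Rmult_le_compat_r; auto. nra. }
      assert (Cmod q * (1 - s) <= rho * Cmod p - s * Cmod q)%R by lra. lra. }
    assert (Hpow : (Cmod (q * (1 - RtoC s) / z) ^ n <= rho ^ n)%R).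
    { apply pow_incr. split; [apply Cmod_ge_0|auto]. }
    assert (Pb : (0 <= Cmod (poch b (S n)) / INR (fact n))%R).
    { apply Rmult_le_pos; [apply Cmod_ge_0|]. left; apply Rinv_0_lt_compat; auto. }
    assert (Pr : (0 <= Cmod (q * (1 - RtoC s) / z) ^ n)%R) by (apply pow_le, Cmod_ge_0).
    rewrite (Rmult_comm K), Rmult_assoc, Rmult_assoc, Rmult_assoc.
    apply Rmult_le_compat_l; auto. rewrite (Rmult_comm (rho ^ n)), <- Rmult_assoc.
    apply Rmult_le_compat; auto. apply Rmult_le_pos; apply Cmod_ge_0.
Qed.

Lemma taylor_factor_lim (b : C) (rho : R) : (0 <= rho < 1)%R ->
  filterlim (fun n => (Cmod (poch b (S n)) / INR (fact n) * rho ^ n)%R) eventually (locally 0%R).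
Proof.
  intros Hr. set (a := fun n => (Cmod (poch b (S n)) / INR (fact n) * rho ^ n)%R).
  assert (Pa : forall n, (0 <= a n)%R).
  { intros n. apply Rmult_le_pos; [|apply pow_le; lra].
    apply Rmult_le_pos; [apply Cmod_ge_0|left; apply Rinv_0_lt_compat, INR_fact_lt_0]. }
  set (r := ((1 + rho) / 2)%R).
  destruct (INR_unbounded (Cmod b * 2 / (1 - rho))) as [N HN].
  assert (Hb := Cmod_ge_0 b).
  assert (Hstep : forall n, (N <= n)%nat -> (a (S n) <= r * a n)%R).
  { intros n Hn. unfold a. rewrite (poch_S b (S n)), fact_simpl, mult_INR, Cmod_mult. simpl pow.
    assert (Pf := INR_fact_lt_0 n). assert (Pn : (0 < INR (S n))%R) by (apply lt_0_INR; lia).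
    assert (Hx : (Cmod (b + natC (S n)) * rho <= r * INR (S n))%R).
    { assert (Cmod (b + natC (S n)) <= Cmod b + INR (S n))%R.
      { eapply Rle_trans; [apply Cmod_triangle|]. unfold natC at 1. rewrite Cmod_RtoC_pos by lra. lra. }
      assert (INR N <= INR (S n))%R by (apply le_INR; lia).
      assert (Cmod b * 2 <= INR (S n) * (1 - rho))%R.
      { replace (Cmod b * 2)%R with (Cmod b * 2 / (1 - rho) * (1 - rho))%R by (field; lra).
        apply Rmult_le_compat_r; lra. }
      assert (Cmod (b + natC (S n)) * rho <= (Cmod b + INR (S n)) * rho)%R by (apply Rmult_le_compat_r; lra).
      unfold r. nra. }
    set (P := Cmod (poch b (S n))). assert (PP : (0 <= P)%R) by apply Cmod_ge_0.
    assert (Prn : (0 <= rho ^ n)%R) by (apply pow_le; lra).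
    replace (P * Cmod (b + natC (S n)) / (INR (S n) * INR (fact n)) * (rho * rho ^ n))%R
      with (P / INR (fact n) * rho ^ n * (Cmod (b + natC (S n)) * rho * / INR (S n)))%R by (field; lra).
    replace (r * (P / INR (fact n) * rho ^ n))%R
      with (P / INR (fact n) * rho ^ n * (r * INR (S n) * / INR (S n)))%R by (field; lra).
    apply Rmult_le_compat_l; [apply (Pa n)|].
    apply Rmult_le_compat_r; [left; apply Rinv_0_lt_compat; auto|auto]. }
  assert (Hgeo : forall j, (a (N + j)%nat <= a N * r ^ j)%R).
  { induction j as [|j IH]; [rewrite Nat.add_0_r; simpl; lra|].
    rewrite Nat.add_succ_r. eapply Rle_trans; [apply Hstep; lia|].
    simpl. replace (a N * (r * r ^ j))%R with (r * (a N * r ^ j))%R by ring.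
    apply Rmult_le_compat_l; [unfold r; lra|exact IH]. }
  apply limR_eps; [typeclasses eauto|]. intros eps He.
  destruct (pow_lt_1_zero r) with (eps / (a N + 1))%R as [J HJ].
  - unfold r. rewrite Rabs_right; lra.
  - apply Rdiv_lt_0_compat; auto. specialize (Pa N). lra.
  - exists (N + J)%nat. intros n Hn. rewrite Rminus_0_r, Rabs_right by (apply Rle_ge, Pa).
    replace n with (N + (n - N))%nat by lia. eapply Rle_lt_trans; [apply Hgeo|].
    specialize (HJ (n - N)%nat ltac:(lia)). assert (Q := Pa N).
    assert (Pr : (0 <= r ^ (n - N))%R) by (apply pow_le; unfold r; lra).
    rewrite Rabs_right in HJ by lra.
    apply Rle_lt_trans with ((a N + 1) * r ^ (n - N))%R; [nra|].
    replace eps with ((a N + 1) * (eps / (a N + 1)))%R by (field; lra).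
    apply Rmult_lt_compat_l; lra.
Qed.

(** * Power series and the identity theorem *)

Lemma pow_n_Cpow (z : C) (n : nat) : pow_n (K := C_AbsRing) z n = z ^ n.
Proof. induction n as [|n IH]; [reflexivity|]. rewrite Cpow_S, <- IH. reflexivity. Qed.

Lemma filterlim_C_lim_at {T : Type} (Fl : (T -> Prop) -> Prop) {FF : Filter Fl} (f : T -> C) (l : C) :
  filterlim f Fl (locally (T := C_UniformSpace) l) <-> lim_at Fl f l.
Proof.
  split.
  - intros H. apply lim_eps; auto. intros eps He.
    assert (P : (0 < eps / 2)%R) by lra.
    apply (H (fun y => (Cmod (y - l) < eps)%R)). exists (mkposreal _ P).
    intros y [H1 H2]. eapply Rle_lt_trans; [apply Cmod_le_re_im|].
    change (Rabs (Re (y - l)) < eps / 2)%R in H1. change (Rabs (Im (y - l)) < eps / 2)%R in H2. lra.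
  - intros H P [eps HP]. unfold filtermap.
    generalize (proj1 (lim_eps Fl f l) H eps (cond_pos eps)). apply filter_imp.
    intros t Ht. apply HP. split.
    + eapply Rle_lt_trans; [apply (re_le_Cmod (f t - l))|exact Ht].
    + eapply Rle_lt_trans; [apply (im_le_Cmod (f t - l))|exact Ht].
Qed.

Definition pser (u : nat -> C) (z l : C) : Prop :=
  lim_at eventually (fun n => sum_n (fun k => u k * z ^ k) n) l.

Lemma is_pseries_lim (u : nat -> C) (z l : C) :
  @is_pseries C_AbsRing C_NormedModule u z l <->
  pser u z l.
Proof.
  unfold pser. rewrite <- filterlim_C_lim_at by typeclasses eauto. unfold is_pseries, is_series.
  assert (E : forall n, sum_n (fun k => u k * z ^ k) n =
    sum_n (G := NormedModule.AbelianGroup C_AbsRing C_NormedModule)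
      (fun k => scal (pow_n (K := C_AbsRing) z k) (u k)) n).
  { intros n. apply Csum_ext. intros k _. rewrite <- (pow_n_Cpow z k). apply Cmult_comm. }
  split; intros H; (eapply filterlim_ext; [|exact H]); intros n; [exact (eq_sym (E n))|exact (E n)].
Qed.

Lemma pseries_plus (u v : nat -> C) (z k l : C) :
  pser u z k ->
  pser v z l ->
  pser (fun n => u n + v n) z (k + l).
Proof.
  intros H1 H2. eapply lim_ext; [typeclasses eauto| |exact (lim_plus eventually _ _ _ _ H1 H2)].
  apply filter_forall. intros n. cbv beta. rewrite <- Csum_plus. apply Csum_ext. intros; ring.
Qed.

Lemma pseries_scal (c : C) (u : nat -> C) (z l : C) :
  pser u z l ->
  pser (fun n => c * u n) z (c * l).
Proof.
  intros H1. eapply lim_ext; [typeclasses eauto| |exact (lim_scal eventually c _ _ H1)].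
  apply filter_forall. intros n. cbv beta. rewrite <- Csum_scal. apply Csum_ext. intros; ring.
Qed.

Definition shift_coeff (u : nat -> C) (n : nat) : C := match n with O => 0 | S k => u k end.

Lemma pseries_shift (u : nat -> C) (z l : C) :
  pser u z l ->
  pser (shift_coeff u) z (z * l).
Proof.
  intros H1. apply lim_eps; [typeclasses eauto|]. intros eps He.
  destruct (proj1 (lim_eps eventually _ _) (lim_scal eventually z _ _ H1) eps He) as [N HN].
  exists (S N). intros [|n] Hn; [lia|]. specialize (HN n ltac:(lia)). cbv beta in HN.
  replace (sum_n (fun k => shift_coeff u k * z ^ k) (S n)) with (z * sum_n (fun k => u k * z ^ k) n : C); auto.
  clear. induction n as [|n IH].
  - rewrite Csum_S, !Csum_O. simpl. ring.
  - rewrite (Csum_S _ (S n)), <- IH, Csum_S. simpl shift_coeff. rewrite (Cpow_S z (S n)). ring.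
Qed.

Lemma pseries_const (c z : C) :
  pser (fun k => match k with O => c | _ => 0 end) z c.
Proof.
  eapply lim_ext; [typeclasses eauto| |apply lim_const; typeclasses eauto].
  apply filter_forall. intros n. symmetry.
  rewrite Csum_first; [simpl; ring|]. intros [|k] Hk; [lia|ring].
Qed.

(** The first nonzero term would dominate the tail near the centre. *)
Lemma pseries_zero (d : nat -> C) (e : C) (s0 : R) : e <> 0 -> (0 < s0)%R ->
  (forall s, (0 < s <= s0)%R ->
     pser d (RtoC s * e) 0) ->
  forall k, d k = 0.
Proof.
  intros Ne Hs0 H. assert (Pe := proj1 (Cmod_gt_0 e) Ne).
  (* the terms at s0 are eventually bounded by 1 *)
  destruct (proj1 (lim_eps eventually _ _) (H s0 ltac:(lra)) (1/2)%R ltac:(lra)) as [N HN].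
  assert (HT : forall k, (N < k)%nat -> (Cmod (d k) * (s0 * Cmod e) ^ k <= 1)%R).
  { intros [|k] Hk; [lia|].
    assert (A := HN k ltac:(lia)). assert (B := HN (S k) ltac:(lia)). cbv beta in A, B.
    rewrite Csum_S in B. set (S0 := sum_n _ k : C) in *.
    set (T := d (S k) * (RtoC s0 * e) ^ S k) in *.
    replace (Cmod (d (S k)) * (s0 * Cmod e) ^ S k)%R with (Cmod T).
    2:{ unfold T. rewrite Cmod_mult, Cmod_pow, Cmod_mult, Cmod_RtoC_pos by lra. reflexivity. }
    replace T with ((S0 + T - 0) - (S0 - 0)) by ring.
    eapply Rle_trans; [apply Cmod_triangle_minus|]. lra. }
  assert (HM : exists M, (0 < M)%R /\ forall k, (Cmod (d k) * (s0 * Cmod e) ^ k <= M)%R).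
  { assert (G : forall n, exists M, (0 < M)%R /\ forall k, (k <= n)%nat -> (Cmod (d k) * (s0 * Cmod e) ^ k <= M)%R).
    { induction n as [|n [M [HM0 HM]]].
      - exists (Cmod (d 0%nat) + 1)%R. split; [generalize (Cmod_ge_0 (d 0%nat)); lra|].
        intros k Hk. replace k with 0%nat by lia. simpl. lra.
      - set (T := (Cmod (d (S n)) * (s0 * Cmod e) ^ S n)%R).
        exists (Rmax M T). split; [eapply Rlt_le_trans; [exact HM0|apply Rmax_l]|].
        intros k Hk. destruct (Nat.eq_dec k (S n)) as [->|Hne]; [apply Rmax_r|].
        eapply Rle_trans; [apply HM; lia|apply Rmax_l]. }
    destruct (G N) as [M [HM0 HM]]. exists (Rmax M 1). split; [eapply Rlt_le_trans; [exact HM0|apply Rmax_l]|].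
    intros k. destruct (Compare_dec.le_lt_dec k N); [eapply Rle_trans; [apply HM; auto|apply Rmax_l]|].
    eapply Rle_trans; [apply HT; auto|apply Rmax_r]. }
  destruct HM as [M [HM0 HM]].
  intros k. induction k as [m IH] using (well_founded_induction Wf_nat.lt_wf).
  apply Cmod_eq_0, Rle_antisym; [|apply Cmod_ge_0].
  apply le_epsilon. intros eps He. rewrite Rplus_0_l.
  (* s is taken so small that the tail is at most eps times the m-th monomial *)
  set (x := Rmin (1 / 2) (eps * (s0 * Cmod e) ^ m / (2 * M))).
  assert (Pse : (0 < (s0 * Cmod e) ^ m)%R) by (apply pow_lt, Rmult_lt_0_compat; auto).
  assert (Px : (0 < x)%R).
  { apply Rmin_glb_lt; [lra|]. apply Rdiv_lt_0_compat; [|lra]. apply Rmult_lt_0_compat; auto. }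
  assert (Px1 : (x <= 1 / 2)%R) by apply Rmin_l.
  assert (Px2 : (x <= eps * (s0 * Cmod e) ^ m / (2 * M))%R) by apply Rmin_r.
  assert (Hs : (0 < x * s0 <= s0)%R) by nra.
  assert (L := H (x * s0)%R Hs).
  set (y := (Cmod (RtoC (x * s0) * e))%R).
  assert (Ey : y = (x * (s0 * Cmod e))%R).
  { unfold y. rewrite Cmod_mult, Cmod_RtoC_pos by lra. ring. }
  assert (Hbd : forall n, (m <= n)%nat ->
    (Cmod (sum_n (fun k => d k * (RtoC (x * s0) * e) ^ k) n - d m * (RtoC (x * s0) * e) ^ m)%C
       <= 2 * M * x ^ (S m) * (1 - (1 / 2) ^ (n - m)))%R).
  { induction n as [|n IHn]; intros Hn.
    - replace m with 0%nat by lia. rewrite Csum_O. simpl.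
      replace (d 0%nat * 1 - d 0%nat * 1) with (RtoC 0) by ring. rewrite Cmod_0. lra.
    - rewrite Csum_S. destruct (Nat.eq_dec m (S n)) as [Em|Em].
      + replace (S n - m)%nat with 0%nat by lia.
        replace (sum_n (fun k => d k * (RtoC (x * s0) * e) ^ k) n) with (RtoC 0).
        2:{ symmetry. clear - IH Em. assert (G : forall j, (j <= n)%nat -> sum_n (fun k => d k * (RtoC (x * s0) * e) ^ k) j = 0 :> C).
            { induction j as [|j IHj]; intros Hj.
              - rewrite Csum_O, IH by lia. ring.
              - rewrite Csum_S, IHj, IH by lia. ring. }
            apply G; lia. }
        rewrite <- Em. match goal with |- (Cmod ?c <= _)%R => replace c with (RtoC 0) by ring end.
        rewrite Cmod_0. simpl. lra.
      + specialize (IHn ltac:(lia)).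
        set (S0 := sum_n (fun k => d k * (RtoC (x * s0) * e) ^ k) n : C) in *.
        set (T := d (S n) * (RtoC (x * s0) * e) ^ S n).
        replace (S0 + T - d m * (RtoC (x * s0) * e) ^ m) with (S0 - d m * (RtoC (x * s0) * e) ^ m + T) by ring.
        eapply Rle_trans; [apply Cmod_triangle|].
        assert (HTn : (Cmod T <= M * x ^ (S m) * (1 / 2) ^ (n - m))%R).
        { unfold T. rewrite Cmod_mult, Cmod_pow. fold y. rewrite Ey, Rpow_mult_distr.
          replace (Cmod (d (S n)) * (x ^ S n * (s0 * Cmod e) ^ S n))%R
            with (Cmod (d (S n)) * (s0 * Cmod e) ^ S n * x ^ S n)%R by ring.
          replace (S n) with (S m + (n - m))%nat at 3 by lia. rewrite pow_add.
          rewrite (Rmult_assoc M).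
          apply Rmult_le_compat; [| |apply HM|].
          - apply Rmult_le_pos; [apply Cmod_ge_0|]. apply pow_le. apply Rmult_le_pos; lra.
          - apply Rmult_le_pos; apply pow_le; lra.
          - apply Rmult_le_compat_l; [apply pow_le; lra|]. apply pow_incr; lra. }
        replace (S n - m)%nat with (S (n - m)) by lia. simpl pow.
        replace (2 * M * (x * x ^ m) * (1 - 1 / 2 * (1 / 2) ^ (n - m)))%R
          with (2 * M * x ^ S m * (1 - (1 / 2) ^ (n - m)) + M * x ^ S m * (1 / 2) ^ (n - m))%R
          by (simpl; field).
        lra. }
  assert (Hlim : (Cmod (0 - d m * (RtoC (x * s0) * e) ^ m) <= 2 * M * x ^ S m)%R).
  { apply (limR_le eventually
      (fun n => Cmod (sum_n (fun k => d k * (RtoC (x * s0) * e) ^ k) n - d m * (RtoC (x * s0) * e) ^ m))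
      (fun _ => (2 * M * x ^ S m)%R)).
    - exists m. intros n Hn. eapply Rle_trans; [apply Hbd; auto|].
      assert (0 < (1 / 2) ^ (n - m))%R by (apply pow_lt; lra).
      assert (0 < x ^ S m)%R by (apply pow_lt; lra).
      assert (0 < 2 * M * x ^ S m)%R by (apply Rmult_lt_0_compat; lra). nra.
    - apply lim_Cmod; [typeclasses eauto|]. apply lim_minus; [typeclasses eauto|exact L|apply lim_const; typeclasses eauto].
    - apply filterlim_const. }
  replace (0 - d m * (RtoC (x * s0) * e) ^ m) with (- (d m * (RtoC (x * s0) * e) ^ m)) in Hlim by ring.
  rewrite Cmod_opp, Cmod_mult, Cmod_pow in Hlim. fold y in Hlim. rewrite Ey, Rpow_mult_distr in Hlim.
  simpl pow in Hlim.
  assert (Pxm : (0 < x ^ m)%R) by (apply pow_lt; auto).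
  apply Rmult_le_reg_r with (x ^ m * (s0 * Cmod e) ^ m)%R; [apply Rmult_lt_0_compat; auto|].
  eapply Rle_trans; [exact Hlim|].
  replace (2 * M * (x * x ^ m))%R with (x * (2 * M) * x ^ m)%R by ring.
  replace (eps * (x ^ m * (s0 * Cmod e) ^ m))%R
    with (eps * (s0 * Cmod e) ^ m / (2 * M) * (2 * M) * x ^ m)%R by (field; lra).
  apply Rmult_le_compat_r; [lra|]. apply Rmult_le_compat_r; lra.
Qed.

Lemma slit_plane_offcut (z : C) : slit_plane z <-> offcut (1 - z).
Proof.
  unfold slit_plane. rewrite offcut_iff.
  destruct z as [u v]; unfold Re, Im; simpl.
  split; intros H [H1 H2]; apply H; lra.
Qed.

Lemma pser_unique (u : nat -> C) (z k l : C) : pser u z k -> pser u z l -> k = l.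
Proof. apply lim_unique. typeclasses eauto. Qed.

Lemma pser_ext (u v : nat -> C) (z l : C) : (forall n, u n = v n) -> pser u z l -> pser v z l.
Proof.
  intros E. apply lim_ext; [typeclasses eauto|]. apply filter_forall. intros n.
  apply Csum_ext. intros k _. rewrite E. reflexivity.
Qed.

Lemma analytic_at_pser (F : C -> C) (z : C) :
  analytic_at F z <-> exists (r : R) (u : nat -> C), (0 < r)%R /\
    forall w, (Cmod (w - z) < r)%R -> pser u (w - z) (F w).
Proof.
  split; intros (r & u & Hr & H); exists r, u; split; auto; intros w Hw; apply is_pseries_lim; auto.
Qed.

Lemma analytic_plus (F G : C -> C) (z : C) :
  analytic_at F z -> analytic_at G z -> analytic_at (fun w => F w + G w) z.
Proof.
  rewrite !analytic_at_pser. intros (r & u & Hr & HF) (r' & v & Hr' & HG).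
  exists (Rmin r r'), (fun n => u n + v n). split; [apply Rmin_glb_lt; auto|].
  intros w Hw. apply pseries_plus; [apply HF|apply HG]; eapply Rlt_le_trans; try exact Hw;
    [apply Rmin_l|apply Rmin_r].
Qed.

Lemma analytic_scal (c : C) (F : C -> C) (z : C) : analytic_at F z -> analytic_at (fun w => c * F w) z.
Proof.
  rewrite !analytic_at_pser. intros (r & u & Hr & HF).
  exists r, (fun n => c * u n). split; auto. intros w Hw. apply pseries_scal; auto.
Qed.

Lemma analytic_const (c z : C) : analytic_at (fun _ => c) z.
Proof.
  apply analytic_at_pser. exists 1%R, (fun k => match k with O => c | _ => 0 end). split; [lra|].
  intros; apply pseries_const.
Qed.

Lemma analytic_ext (F G : C -> C) (z : C) : (forall w, F w = G w) -> analytic_at F z -> analytic_at G z.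
Proof.
  intros E (r & u & Hr & HF). exists r, u. split; auto. intros w Hw. rewrite <- E. auto.
Qed.

Lemma analytic_mul_id (F : C -> C) (z : C) : analytic_at F z -> analytic_at (fun w => w * F w) z.
Proof.
  rewrite !analytic_at_pser. intros (r & u & Hr & HF).
  exists r, (fun n => z * u n + shift_coeff u n). split; auto. intros w Hw.
  replace (w * F w) with (z * F w + (w - z) * F w) by ring.
  apply pseries_plus; [apply pseries_scal|apply pseries_shift]; auto.
Qed.

Lemma analytic_mul_pow (F : C -> C) (z : C) (n : nat) : analytic_at F z -> analytic_at (fun w => w ^ n * F w) z.
Proof.
  intros H; induction n as [|n IH].
  - apply analytic_ext with F; [intros; simpl; ring|auto].
  - apply analytic_ext with (fun w => w * (w ^ n * F w)); [intros; rewrite Cpow_S; ring|].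
    apply analytic_mul_id; auto.
Qed.

Lemma analytic_sum (F : nat -> C -> C) (z : C) (n : nat) : (forall k, (k <= n)%nat -> analytic_at (F k) z) ->
  analytic_at (fun w => sum_n (fun k => F k w) n) z.
Proof.
  induction n as [|n IH]; intros H.
  - apply analytic_ext with (F 0%nat); [intros; rewrite Csum_O; reflexivity|auto].
  - apply analytic_ext with (fun w => sum_n (fun k => F k w) n + F (S n) w); [intros; rewrite Csum_S; reflexivity|].
    apply analytic_plus; auto.
Qed.

(** Agreement along a single segment issuing from the centre suffices; this is
    all that is known at the supremum in [principal_unique]. *)
Lemma pser_identity (u v : nat -> C) (F G : C -> C) (z e : C) (r s0 : R) : e <> 0 -> (0 < s0)%R ->
  (forall w, (Cmod (w - z) < r)%R -> pser u (w - z) (F w)) ->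
  (forall w, (Cmod (w - z) < r)%R -> pser v (w - z) (G w)) ->
  (forall s, (0 < s <= s0)%R -> (Cmod (RtoC s * e) < r)%R /\ F (z + RtoC s * e) = G (z + RtoC s * e)) ->
  forall w, (Cmod (w - z) < r)%R -> F w = G w.
Proof.
  intros Ne Hs0 HF HG HE.
  assert (Z : forall k, u k + (-1) * v k = 0).
  { apply (pseries_zero _ e s0 Ne Hs0). intros s Hs. destruct (HE s Hs) as [H1 H2].
    assert (E : z + RtoC s * e - z = RtoC s * e) by ring.
    assert (A := HF (z + RtoC s * e)). assert (B := HG (z + RtoC s * e)). rewrite E in A, B.
    specialize (A H1). specialize (B H1).
    replace (RtoC 0) with (F (z + RtoC s * e) + (-1) * G (z + RtoC s * e)) by (rewrite H2; ring).
    apply pseries_plus; [exact A|apply pseries_scal; exact B]. }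
  intros w Hw. apply (pser_unique u (w - z)); auto.
  apply pser_ext with v; auto. intros n. specialize (Z n).
  replace (u n) with (u n + (-1) * v n + v n) by ring. rewrite Z. ring.
Qed.

Lemma offcut_segment (x : C) (t : R) : (0 <= t <= 1)%R -> offcut (1 - x) -> offcut (1 - x * RtoC t).
Proof.
  intros Ht H. replace (1 - x * RtoC t) with (RtoC (1 - t) + RtoC t * (1 - x)) by (rewrite RtoC_minus; ring).
  apply offcut_star; auto; lra.
Qed.

(** The slit plane is star-shaped about 0: follow the segment from 0 to x up
    to the supremum of the parameters of agreement and continue past it by
    [pser_identity]. *)
Lemma principal_unique (a b c : C) (F G : C -> C) (x : C) :
  is_principal_hyp2F1 a b c F -> is_principal_hyp2F1 a b c G -> offcut (1 - x) -> F x = G x.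
Proof.
  intros [FA F0] [GA G0] Hx.
  assert (H0 : forall w, (Cmod w < 1)%R -> F w = G w).
  { intros w Hw. apply (pser_unique (hyp2F1_coeff a b c) w); apply is_pseries_lim; auto. }
  destruct (classic (x = 0)) as [->|Nx]; [apply H0; rewrite Cmod_0; lra|].
  assert (Px := proj1 (Cmod_gt_0 x) Nx).
  (* the supremum of the parameters up to which F and G agree along [0, x] *)
  set (E := fun s => (0 <= s <= 1)%R /\ forall s', (0 <= s' <= s)%R -> F (x * RtoC s') = G (x * RtoC s')).
  set (s0 := (/ (2 * (1 + Cmod x)))%R).
  assert (Ps0 : (0 < s0)%R) by (apply Rinv_0_lt_compat; lra).
  assert (Es0 : E s0).
  { assert (s0 <= / 1)%R by (apply Rinv_le_contravar; lra). rewrite Rinv_1 in H.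
    split; [lra|]. intros s' Hs'. apply H0. rewrite Cmod_mult, Cmod_RtoC_pos by lra.
    apply Rle_lt_trans with (Cmod x * s0)%R; [apply Rmult_le_compat_l; lra|].
    apply Rmult_lt_reg_r with (2 * (1 + Cmod x))%R; [lra|].
    rewrite Rmult_assoc. unfold s0. rewrite Rinv_l by lra. lra. }
  destruct (completeness E) as [sg [Hub Hlub]].
  { exists 1%R. intros s [H _]. lra. }
  { exists s0; auto. }
  assert (Hsg0 : (s0 <= sg)%R) by (apply Hub; auto).
  assert (Hsg1 : (sg <= 1)%R) by (apply Hlub; intros s [H _]; lra).
  assert (Hbelow : forall s, (0 <= s < sg)%R -> F (x * RtoC s) = G (x * RtoC s)).
  { intros s Hs. destruct (classic (exists s1, E s1 /\ (s < s1)%R)) as [[s1 [[_ H1] H2]]|N].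
    - apply H1. lra.
    - exfalso. assert (sg <= s)%R; [|lra]. apply Hlub. intros s1 Hs1.
      apply Rnot_lt_le. intros L. apply N. exists s1; auto. }
  assert (Hslit : slit_plane (x * RtoC sg)).
  { apply slit_plane_offcut, offcut_segment; auto. lra. }
  destruct (proj1 (analytic_at_pser _ _) (FA _ Hslit)) as (r1 & u & Hr1 & HF).
  destruct (proj1 (analytic_at_pser _ _) (GA _ Hslit)) as (r2 & v & Hr2 & HG).
  set (r := Rmin r1 r2). assert (Hr : (0 < r)%R) by (apply Rmin_glb_lt; auto).
  assert (Hr1' : (r <= r1)%R) by apply Rmin_l. assert (Hr2' : (r <= r2)%R) by apply Rmin_r.
  assert (Near : forall w, (Cmod (w - x * RtoC sg) < r)%R -> F w = G w).
  { set (d := Rmin sg (r / (2 * Cmod x))).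
    assert (Pd1 : (0 < r / (2 * Cmod x))%R) by (apply Rdiv_lt_0_compat; lra).
    assert (Pd : (0 < d)%R) by (apply Rmin_glb_lt; lra).
    assert (Pd2 : (d <= sg)%R) by apply Rmin_l. assert (Pd3 : (d <= r / (2 * Cmod x))%R) by apply Rmin_r.
    apply (pser_identity u v F G (x * RtoC sg) (- x) r d).
    - intros Z. apply Nx. replace x with (- - x) by ring. rewrite Z. ring.
    - auto.
    - intros w Hw. apply HF. lra.
    - intros w Hw. apply HG. lra.
    - intros s Hs. split.
      + rewrite Cmod_mult, Cmod_opp, Cmod_RtoC_pos by lra.
        apply Rle_lt_trans with (r / (2 * Cmod x) * Cmod x)%R; [apply Rmult_le_compat_r; lra|].
        replace (r / (2 * Cmod x) * Cmod x)%R with (r / 2)%R by (field; lra). lra.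
      + replace (x * RtoC sg + RtoC s * - x) with (x * RtoC (sg - s)) by (rewrite RtoC_minus; ring).
        apply Hbelow. lra. }
  assert (Hstep : forall s, (0 <= s <= sg + r / (2 * Cmod x))%R -> F (x * RtoC s) = G (x * RtoC s)).
  { intros s Hs. destruct (Rlt_le_dec s sg); [apply Hbelow; lra|].
    apply Near. replace (x * RtoC s - x * RtoC sg) with (x * RtoC (s - sg)) by (rewrite RtoC_minus; ring).
    rewrite Cmod_mult, Cmod_RtoC_pos by lra.
    apply Rle_lt_trans with (Cmod x * (r / (2 * Cmod x)))%R; [apply Rmult_le_compat_l; lra|].
    replace (Cmod x * (r / (2 * Cmod x)))%R with (r / 2)%R by (field; lra). lra. }
  assert (Pr : (0 < r / (2 * Cmod x))%R) by (apply Rdiv_lt_0_compat; lra).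
  assert (sg = 1)%R as Esg.
  { destruct (Rlt_le_dec sg 1); [exfalso|lra].
    set (s1 := Rmin 1 (sg + r / (2 * Cmod x))).
    assert (L1 : (s1 <= 1)%R) by apply Rmin_l.
    assert (L2 : (s1 <= sg + r / (2 * Cmod x))%R) by apply Rmin_r.
    assert (L3 : (sg < s1)%R) by (apply Rmin_glb_lt; lra).
    assert (s1 <= sg)%R; [|lra]. apply Hub. split; [lra|]. intros; apply Hstep; lra. }
  replace x with (x * RtoC 1) by ring. apply Hstep. lra.
Qed.

(** Turns every evaluation of the hypergeometric function into the
    construction of one analytic function with the right series at 0. *)
Lemma hyp2F1_eq (a b c x : C) (G : C -> C) :
  is_principal_hyp2F1 a b c G -> offcut (1 - x) -> hyp2F1 a b c x = G x.
Proof.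
  intros HG. apply (principal_unique a b c); auto.
  exact (epsilon_spec _ (is_principal_hyp2F1 a b c) (ex_intro _ G HG)).
Qed.

(** * Expansion of (1 - x t) ^ (- b) in x, uniformly in t *)

Lemma slit_distance (z : C) : offcut (1 - z) ->
  exists d, (0 < d)%R /\ forall t, (0 <= t <= 1)%R -> (d <= Cmod (1 - z * RtoC t))%R.
Proof.
  intros Hz.
  destruct (continuity_ab_min (fun t => Cmod (1 - z * RtoC t)) 0 1 ltac:(lra)) as [m [Hm1 Hm2]].
  - intros t Ht. apply continuity_pt_filterlim. eapply is_derive_continuity.
    apply (is_derive_Cmod (fun t => 1 - z * RtoC t)).
    + apply offcut_neq_0, offcut_segment; auto.
    + apply der_minus; [apply der_const|apply der_scal, der_id].
  - exists (Cmod (1 - z * RtoC m)). split; [|auto].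
    apply offcut_Cmod_pos, offcut_segment; auto.
Qed.

(** If 1 - w t lay on the cut, then w would be 1 / t' for some t' in [0, t],
    at distance at least d from z. *)
Lemma disc_offcut (z w : C) (d : R) : (0 < d)%R ->
  (forall t, (0 <= t <= 1)%R -> (d <= Cmod (1 - z * RtoC t))%R) -> (Cmod (w - z) < d)%R ->
  forall t, (0 <= t <= 1)%R -> offcut (1 - w * RtoC t).
Proof.
  intros Hd Hz Hw t Ht. apply NNPP. intros N. apply offcut_not in N. destruct N as [N1 N2].
  set (k := Re (w * RtoC t)).
  assert (E : w * RtoC t = RtoC k).
  { apply C_eq; [reflexivity|]. unfold k in *. unfold Im, Re in *. simpl in *. lra. }
  assert (Hk : (1 <= k)%R) by (unfold k, Re in *; simpl in *; lra).
  assert (I : (0 < / k <= 1)%R).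
  { split; [apply Rinv_0_lt_compat; lra|]. rewrite <- Rinv_1. apply Rinv_le_contravar; lra. }
  assert (Ht' : (0 <= t / k <= 1)%R) by (unfold Rdiv; nra).
  specialize (Hz (t / k)%R Ht').
  assert (E2 : w * RtoC (t / k) = 1).
  { unfold Rdiv. rewrite RtoC_mult, RtoC_inv, Cmult_assoc, E by lra. field.
    intros Z. apply RtoC_inj in Z. lra. }
  replace (1 - z * RtoC (t / k)) with ((w - z) * RtoC (t / k)) in Hz by (rewrite <- E2; ring).
  rewrite Cmod_mult, Cmod_RtoC_pos in Hz by lra.
  generalize (Cmod_ge_0 (w - z)). nra.
Qed.

(** The bound is uniform in t, so the expansion can be integrated against the
    Beta density. *)
Lemma power_expansion (z w b : C) (d : R) : (0 < d)%R ->
  (forall t, (0 <= t <= 1)%R -> (d <= Cmod (1 - z * RtoC t))%R) -> (Cmod (w - z) < d)%R ->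
  exists eps : nat -> R, (forall n, (0 <= eps n)%R) /\ filterlim eps eventually (locally 0%R) /\
    forall t n, (0 <= t <= 1)%R ->
      (Cmod (Cpower (1 - w * RtoC t) (- b) -
         sum_n (fun m => (poch b m / factC m * Cpower (1 - z * RtoC t) (- b - natC m) * RtoC t ^ m
                         * (w - z) ^ m)%C) n) <= eps n)%R.
Proof.
  intros Hd Hz Hw. assert (P := Cmod_ge_0 (w - z)).
  destruct (Cpower_bound (d - Cmod (w - z)) (1 + Cmod z + Cmod (w - z)) (- b - 1) ltac:(lra)) as [K1 [HK1 HK]].
  set (rho := (Cmod (w - z) / d)%R).
  assert (Hrho : (0 <= rho < 1)%R).
  { split; [apply Rdiv_le_0_compat; lra|]. apply Rmult_lt_reg_r with d; auto.
    unfold rho, Rdiv. rewrite Rmult_assoc, Rinv_l by lra. lra. }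
  set (K := (Cmod (w - z) * K1)%R).
  exists (fun n => (K * (Cmod (poch b (S n)) / INR (fact n) * rho ^ n))%R).
  split; [|split].
  - intros n. apply Rmult_le_pos; [apply Rmult_le_pos; lra|].
    apply Rmult_le_pos; [|apply pow_le; lra].
    apply Rmult_le_pos; [apply Cmod_ge_0|left; apply Rinv_0_lt_compat, INR_fact_lt_0].
  - replace 0%R with (K * 0)%R by ring.
    apply (limR_mult eventually); [apply filterlim_const|]. apply taylor_factor_lim; auto.
  - intros t n Ht. replace (1 - w * RtoC t) with (1 - z * RtoC t - (w - z) * RtoC t) by ring.
    rewrite (Csum_ext _ (fun m => poch b m / factC m * Cpower (1 - z * RtoC t) (- b - natC m) *
       ((w - z) * RtoC t) ^ m)) by (intros; rewrite Cpow_mult_l; ring).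
    assert (Emod : Cmod ((w - z) * RtoC t) = (Cmod (w - z) * t)%R) by (rewrite Cmod_mult, Cmod_RtoC_pos; lra).
    assert (Eq : forall s, 1 - z * RtoC t - RtoC s * ((w - z) * RtoC t) = 1 - (z + RtoC s * (w - z)) * RtoC t)
      by (intros; ring).
    apply power_taylor.
    + intros s Hs. rewrite Eq. apply (disc_offcut z _ d); auto.
      replace (z + RtoC s * (w - z) - z) with (RtoC s * (w - z)) by ring.
      rewrite Cmod_mult, Cmod_RtoC_pos by lra. nra.
    + lra.
    + rewrite Emod. apply Rle_trans with (rho * d)%R.
      * unfold rho. replace (Cmod (w - z) / d * d)%R with (Cmod (w - z)) by (field; lra). nra.
      * apply Rmult_le_compat_l; [lra|auto].
    + intros s Hs. rewrite Emod. unfold K. apply Rmult_le_compat; [nra|apply Cmod_ge_0|nra|].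
      apply HK.
      assert (Q : (Cmod (RtoC s * ((w - z) * RtoC t)) <= Cmod (w - z))%R).
      { rewrite Cmod_mult, Emod, Cmod_RtoC_pos by lra.
        assert (0 <= s * t <= 1)%R by (split; nra). nra. }
      split.
      * eapply Rle_trans; [|apply Cmod_triangle_rev]. specialize (Hz t Ht). lra.
      * eapply Rle_trans; [apply Cmod_triangle_minus|].
        assert (Cmod (1 - z * RtoC t) <= 1 + Cmod z)%R; [|lra].
        eapply Rle_trans; [apply Cmod_triangle_minus|]. rewrite Cmod_1, Cmod_mult, Cmod_RtoC_pos by lra.
        generalize (Cmod_ge_0 z). nra.
Qed.

Lemma power_pser (z w b : C) (d : R) : (0 < d)%R ->
  (forall t, (0 <= t <= 1)%R -> (d <= Cmod (1 - z * RtoC t))%R) -> (Cmod (w - z) < d)%R ->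
  pser (fun m => poch b m / factC m * Cpower (1 - z) (- b - natC m)) (w - z) (Cpower (1 - w) (- b)).
Proof.
  intros Hd Hz Hw. destruct (power_expansion z w b d Hd Hz Hw) as [eps [_ [L H]]].
  apply lim_eps; [typeclasses eauto|]. intros e He.
  generalize (proj1 (limR_eps eventually _ _) L e He). apply filter_imp. intros n Hn.
  rewrite Rminus_0_r in Hn. apply Rabs_def2 in Hn.
  eapply Rle_lt_trans; [|exact (proj1 Hn)].
  specialize (H 1%R n ltac:(lra)). rewrite Cmod_minus_sym.
  replace (w * RtoC 1) with w in H by ring.
  erewrite Csum_ext in H; [exact H|].
  intros k _. cbv beta. rewrite Cpow_1_l. replace (z * RtoC 1) with z by ring. ring.
Qed.

Lemma analytic_power (b z : C) : offcut (1 - z) -> analytic_at (fun w => Cpower (1 - w) (- b)) z.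
Proof.
  intros Hz. destruct (slit_distance z Hz) as [d [Hd Hzd]].
  apply analytic_at_pser. exists d, (fun m => poch b m / factC m * Cpower (1 - z) (- b - natC m)).
  split; auto. intros w Hw. apply (power_pser z w b d); auto.
Qed.

Lemma zero_distance (t : R) : (0 <= t <= 1)%R -> (1 <= Cmod (1 - 0 * RtoC t))%R.
Proof. intros _. replace (1 - 0 * RtoC t) with (RtoC 1) by ring. rewrite Cmod_1. lra. Qed.

Lemma power_pser_0 (w b : C) : (Cmod w < 1)%R ->
  pser (fun m => poch b m / factC m) w (Cpower (1 - w) (- b)).
Proof.
  intros Hw. assert (X := power_pser 0 w b 1 Rlt_0_1 zero_distance).
  replace (w - 0) with w in X by ring. specialize (X Hw). revert X. apply pser_ext.
  intros n. replace (1 - 0) with (RtoC 1) by ring. rewrite Cpower_one_base. ring.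
Qed.

(** * The hypergeometric coefficients of the expansion *)

(** These are the Taylor coefficients at t = 0 of (1 - t) ^ (- s) (1 - x t) ^
    (- b); up to a factorial they are the coefficients of the theorem, by
    [coeff0_eq] and [coeff1_eq]. *)
Definition regular_coef (s b x : C) (n : nat) : C :=
  sum_n (fun k => poch s (n - k) / factC (n - k) * (poch b k / factC k * x ^ k)) n.

Lemma Csum_head (u : nat -> C) (n : nat) : sum_n u (S n) = u 0%nat + sum_n (fun k => u (S k)) n :> C.
Proof.
  induction n as [|n IH]; [rewrite Csum_S, !Csum_O; reflexivity|].
  rewrite (Csum_S u (S n)), IH, (Csum_S (fun k => u (S k))). ring.
Qed.

Lemma poch_div_fact (s : C) (n : nat) :
  natC (S n) * (poch s (S n) / factC (S n)) = s * (poch (s + 1) n / factC n).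
Proof.
  rewrite poch_head, factC_S. assert (N1 := natC_S_neq_0 n). assert (N2 := factC_neq_0 n).
  field. auto.
Qed.

Lemma natC_plus (m n : nat) : natC (m + n) = natC m + natC n.
Proof. unfold natC. rewrite plus_INR, RtoC_plus. reflexivity. Qed.

(** The product rule for (1 - t) ^ (- s) (1 - x t) ^ (- b), read on
    coefficients. *)
Lemma regular_coef_succ (s b x : C) (n : nat) :
  natC (S n) * regular_coef s b x (S n) = s * regular_coef (s + 1) b x n + b * x * regular_coef s (b + 1) x n.
Proof.
  unfold regular_coef. rewrite <- !Csum_scal.
  rewrite (Csum_ext _ (fun k =>
    natC (S n - k) * (poch s (S n - k) / factC (S n - k)) * (poch b k / factC k * x ^ k) +
    poch s (S n - k) / factC (S n - k) * (natC k * (poch b k / factC k) * x ^ k))).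
  2:{ intros k Hk. replace (natC (S n)) with (natC (S n - k) + natC k)
        by (rewrite <- natC_plus; f_equal; lia). ring. }
  rewrite Csum_plus. f_equal.
  - rewrite Csum_S. rewrite Nat.sub_diag, natC_0.
    match goal with |- _ + ?z = _ => replace z with (RtoC 0) by ring end. rewrite Cplus_0_r.
    apply Csum_ext. intros k Hk. replace (S n - k)%nat with (S (n - k)) by lia.
    rewrite poch_div_fact. ring.
  - rewrite Csum_head, natC_0.
    match goal with |- ?z + _ = _ => replace z with (RtoC 0) by ring end. rewrite Cplus_0_l.
    apply Csum_ext. intros k Hk. simpl Nat.sub. rewrite poch_div_fact, Cpow_S. ring.
Qed.

Lemma regular_coef_0 (s b x : C) : regular_coef s b x 0 = 1.
Proof. unfold regular_coef. rewrite Csum_O. unfold factC, natC. simpl. field. Qed.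

(** At x = 1 the product is (1 - t) ^ (- s - b); [regular_coef_succ] gives the
    induction. *)
Lemma regular_coef_vandermonde (n : nat) (s b : C) : regular_coef s b 1 n = poch (s + b) n / factC n.
Proof.
  revert s b. induction n as [|n IH]; intros s b.
  - rewrite regular_coef_0. unfold factC, natC. simpl. field.
  - assert (N1 := natC_S_neq_0 n). assert (N2 := factC_neq_0 n).
    assert (E := regular_coef_succ s b 1 n). rewrite !IH in E.
    replace (regular_coef s b 1 (S n)) with (natC (S n) * regular_coef s b 1 (S n) / natC (S n)) by (field; auto).
    rewrite E, poch_head, factC_S.
    replace (s + (b + 1)) with (s + b + 1) by ring. replace (s + 1 + b) with (s + b + 1) by ring.
    field. auto.
Qed.

Lemma poch_neg_nat (n k : nat) : (k <= n)%nat ->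
  (-1) ^ k * poch (- natC n) k * factC (n - k) = factC n.
Proof.
  induction k as [|k IH]; intros Hk.
  - rewrite Nat.sub_0_r. simpl. ring.
  - rewrite <- IH by lia. rewrite poch_S, Cpow_S.
    replace (n - k)%nat with (S (n - S k)) by lia. rewrite factC_S.
    replace (natC (S (n - S k))) with (natC n - natC k).
    + ring.
    + replace n with (S (n - S k) + k)%nat at 1 by lia. rewrite natC_plus. ring.
Qed.

Lemma poch_neg_nat_0 (n k : nat) : (n < k)%nat -> poch (- natC n) k = 0.
Proof.
  induction k as [|k IH]; intros Hk; [lia|]. rewrite poch_S.
  destruct (Nat.eq_dec n k) as [->|]; [ring|]. rewrite IH by lia. ring.
Qed.

Lemma poch_reflect (s : C) (n k : nat) : (k <= n)%nat ->
  (-1) ^ k * poch s (n - k) * poch (1 - s - natC n) k = poch s n.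
Proof.
  induction k as [|k IH]; intros Hk.
  - rewrite Nat.sub_0_r. simpl. ring.
  - rewrite <- IH by lia. rewrite (poch_S _ k), Cpow_S.
    replace (n - k)%nat with (S (n - S k)) by lia. rewrite poch_S.
    assert (E : natC n = natC (n - S k) + 1 + natC k)
      by (rewrite <- natC_S, <- natC_plus; f_equal; lia).
    rewrite E. ring.
Qed.

(** Since (-1) ^ k (- n)_k = n! / (n - k)!, the sums that define the
    exceptional coefficients are Cauchy products. *)
Lemma exceptional_sum (s b x : C) (n : nat) :
  sum_n (fun k => (-1) ^ k * (poch (- natC n) k * poch b k / factC k) * poch s (n - k) * x ^ k) n
  = factC n * regular_coef s b x n.
Proof.
  unfold regular_coef. rewrite <- Csum_scal. apply Csum_ext. intros k Hk.
  assert (N1 := factC_neq_0 k). assert (N2 := factC_neq_0 (n - k)).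
  rewrite <- (poch_neg_nat n k Hk). field. auto.
Qed.

(** With first parameter - n the series terminates. *)
Lemma poly_principal (n : nat) (b c : C) :
  is_principal_hyp2F1 (- natC n) b c
    (fun z => sum_n (fun k => hyp2F1_coeff (- natC n) b c k * z ^ k) n).
Proof.
  split.
  - intros z _. apply analytic_sum. intros k _.
    apply analytic_ext with (fun w => w ^ k * hyp2F1_coeff (- natC n) b c k); [intros; ring|].
    apply analytic_mul_pow, analytic_const.
  - intros z _. apply is_pseries_lim. unfold pser.
    eapply lim_ext; [typeclasses eauto| |apply lim_const; typeclasses eauto].
    exists n. intros m Hm. symmetry. induction Hm as [|m Hm IH]; [reflexivity|].
    rewrite Csum_S, IH. unfold hyp2F1_coeff at 2. rewrite poch_neg_nat_0 by lia.
    unfold Cdiv. ring.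
Qed.

Lemma poch_shift_neq_0 (z : C) (n k : nat) : (0 < Re z)%R -> ~ is_pos_integer z ->
  poch (z - natC n) k <> 0.
Proof.
  intros Hre Hz. induction k as [|k IH]; [exact C1_nz|].
  rewrite poch_S. apply Cmult_neq_0; auto. intros E.
  assert (Ez : z = natC n - natC k).
  { replace z with (z - natC n + natC k + (natC n - natC k)) by ring. rewrite E. ring. }
  destruct (Nat.le_gt_cases n k) as [L|L].
  - apply le_INR in L. rewrite Ez in Hre. unfold natC, Re in Hre. simpl in Hre. lra.
  - apply Hz. exists (n - k)%nat. split; [lia|]. rewrite Ez.
    replace n with (n - k + k)%nat at 1 by lia. rewrite natC_plus. ring.
Qed.

(** In the generic case (s)_n / (1 - s - n)_k = (-1) ^ k (s)_(n-k) turns the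
    terminating series into the sum of the exceptional case. *)
Lemma coeff0_eq (a b c x : C) (n : nat) : (0 < Re (c - a))%R -> offcut (1 - x) ->
  coeff0 a b c x n = factC n * regular_coef (a - c + 1) b x n.
Proof.
  intros Hca Hx. rewrite <- exceptional_sum. unfold coeff0.
  destruct (excluded_middle_informative (is_pos_integer (c - a))) as [H|H]; [reflexivity|].
  rewrite (hyp2F1_eq _ _ _ _ _ (poly_principal n b (c - a - natC n)) Hx).
  rewrite <- Csum_scal. apply Csum_ext. intros k Hk. unfold hyp2F1_coeff.
  rewrite <- (poch_reflect (a - c + 1) n k Hk).
  replace (1 - (a - c + 1) - natC n) with (c - a - natC n) by ring.
  assert (N1 := factC_neq_0 k). assert (N2 := poch_shift_neq_0 (c - a) n k Hca H).
  field. auto.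
Qed.

Fixpoint shiftn (k : nat) (u : nat -> C) : nat -> C :=
  match k with O => u | S k => shift_coeff (shiftn k u) end.

Lemma shiftn_lt (k m : nat) (u : nat -> C) : (m < k)%nat -> shiftn k u m = 0.
Proof.
  revert m; induction k as [|k IH]; intros m Hm; [lia|]. simpl.
  destruct m as [|m]; [reflexivity|]. simpl. apply IH. lia.
Qed.

Lemma shiftn_ge (k m : nat) (u : nat -> C) : (k <= m)%nat -> shiftn k u m = u (m - k)%nat.
Proof.
  revert m; induction k as [|k IH]; intros m Hm; [rewrite Nat.sub_0_r; reflexivity|].
  destruct m as [|m]; [lia|]. simpl. apply IH. lia.
Qed.

Lemma pser_shiftn (k : nat) (u : nat -> C) (z l : C) : pser u z l -> pser (shiftn k u) z (z ^ k * l).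
Proof.
  intros H; induction k as [|k IH].
  - replace (z ^ 0 * l) with l by (simpl; ring). exact H.
  - rewrite Cpow_S, <- Cmult_assoc. apply pseries_shift. exact IH.
Qed.

Lemma pser_sum (u : nat -> nat -> C) (z : C) (l : nat -> C) (n : nat) :
  (forall k, (k <= n)%nat -> pser (u k) z (l k)) ->
  pser (fun m => sum_n (fun k => u k m) n) z (sum_n l n).
Proof.
  induction n as [|n IH]; intros H.
  - rewrite Csum_O. apply pser_ext with (u 0%nat); [intros; rewrite Csum_O; reflexivity|auto].
  - rewrite Csum_S. apply pser_ext with (fun m => sum_n (fun k => u k m) n + u (S n) m);
      [intros; rewrite Csum_S; reflexivity|].
    apply pseries_plus; auto.
Qed.

Lemma poch_add (s : C) (m n : nat) : poch s (m + n) = poch s m * poch (s + natC m) n.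
Proof.
  induction n as [|n IH].
  - rewrite Nat.add_0_r. simpl. ring.
  - rewrite Nat.add_succ_r, !poch_S, IH, natC_plus. ring.
Qed.

Lemma poch_exchange (a : C) (m n : nat) :
  poch (1 - a - natC m) n * poch (a - natC n) m = poch (1 - a) n * poch a m.
Proof.
  induction m as [|m IH].
  - rewrite natC_0. replace (1 - a - 0) with (1 - a) by ring. simpl. ring.
  - destruct n as [|n].
    + simpl. rewrite natC_0. replace (a - 0) with a by ring. ring.
    + rewrite (poch_S a), (poch_S (a - natC (S n))).
      replace (poch (1 - a) (S n) * (poch a m * (a + natC m)))
        with (poch (1 - a) (S n) * poch a m * (a + natC m)) by ring.
      rewrite <- IH, (poch_head (1 - a - natC (S m))), (poch_S (1 - a - natC m)).
      rewrite !natC_S. replace (1 - a - (natC m + 1) + 1) with (1 - a - natC m) by ring. ring.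
Qed.

Lemma poch_1_minus_neq_0 (a : C) (n : nat) : (0 < Re a)%R -> ~ is_pos_integer a -> poch (1 - a) n <> 0.
Proof.
  intros Hre Ha E. assert (X := poch_reflect (1 - a) n n (le_n n)). rewrite Nat.sub_diag in X.
  replace (1 - (1 - a) - natC n) with (a - natC n) in X by ring.
  rewrite E in X. revert X. apply Cmult_neq_0; [|apply poch_shift_neq_0; auto].
  apply Cmult_neq_0; [apply Cpow_nz|exact C1_nz].
  intros Z. apply (f_equal Re) in Z. simpl in Z. lra.
Qed.

(** The coefficients of Pfaff's transform of the series, a terminating sum in
    x / (x - 1), rewritten as a combination of z ^ k (1 - z) ^ (- b - k). *)
Definition pfaff_coeff (a b : C) (n k : nat) : C :=
  (-1) ^ k * (poch (- natC n) k * poch b k / factC k) * poch (1 - a) (n - k) * (-1) ^ k / poch (1 - a) n.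

(** Expanding z ^ k (1 - z) ^ (- b - k) at 0 and summing over k by
    Vandermonde's identity gives back the hypergeometric coefficients. *)
Lemma pfaff_principal (a b : C) (n : nat) : (0 < Re a)%R -> ~ is_pos_integer a ->
  is_principal_hyp2F1 a b (a - natC n)
    (fun z => sum_n (fun k => pfaff_coeff a b n k * (z ^ k * Cpower (1 - z) (- (b + natC k)))) n).
Proof.
  intros Hre Ha.
  assert (N0 := poch_1_minus_neq_0 a n Hre Ha).
  split.
  - intros z Hz. apply analytic_sum. intros k _. apply analytic_scal, analytic_mul_pow, analytic_power.
    apply slit_plane_offcut; auto.
  - intros z Hz. apply is_pseries_lim.
    apply pser_ext with (fun m => sum_n (fun k => pfaff_coeff a b n k *
       shiftn k (fun m => poch (b + natC k) m / factC m) m) n).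
    2:{ apply (pser_sum (fun k m => pfaff_coeff a b n k * shiftn k (fun m => poch (b + natC k) m / factC m) m)).
        intros k _. apply pseries_scal, pser_shiftn, power_pser_0; auto. }
    intros m. unfold hyp2F1_coeff.
    transitivity (factC n / poch (1 - a) n * (poch b m / factC m) * regular_coef (1 - a) (- natC m) 1 n).
    + unfold regular_coef. rewrite <- Csum_scal. apply Csum_ext. intros k Hk.
      rewrite <- (poch_neg_nat n k Hk). unfold pfaff_coeff.
      assert (N1 := factC_neq_0 k). assert (N2 := factC_neq_0 (n - k)). assert (N3 := factC_neq_0 m).
      rewrite Cpow_1_l.
      destruct (Nat.le_gt_cases k m) as [L|L].
      * rewrite shiftn_ge by auto.
        assert (N4 := factC_neq_0 (m - k)).
        assert (E : poch b m = poch b k * poch (b + natC k) (m - k)).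
        { rewrite <- poch_add. f_equal. lia. }
        assert (E2 := poch_neg_nat m k L).
        rewrite E, <- E2.
        assert (Q : (-1) ^ k * (-1) ^ k = 1).
        { rewrite <- Cpow_mult_l. replace (-1 * -1) with (RtoC 1) by ring. apply Cpow_1_l. }
        set (sg := (-1) ^ k) in *.
        assert (Ns : sg <> 0) by (intros Z; rewrite Z in Q; apply C1_nz; rewrite <- Q; ring).
        assert (N5 : poch (- natC m) k <> 0).
        { intros Z. rewrite Z in E2. apply N3. rewrite <- E2. ring. }
        transitivity (sg * sg * (poch (- natC n) k * poch b k / factC k * poch (1 - a) (n - k)
           / poch (1 - a) n * (poch (b + natC k) (m - k) / factC (m - k)))).
        { unfold Cdiv. ring. }
        rewrite Q. field. repeat split; auto.
      * rewrite shiftn_lt, (poch_neg_nat_0 m k) by auto. unfold Cdiv. ring.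
    + rewrite regular_coef_vandermonde.
      replace (1 - a + - natC m) with (1 - a - natC m) by ring.
      assert (X := poch_exchange a m n).
      assert (N1 := factC_neq_0 n). assert (N3 := factC_neq_0 m).
      assert (Z := poch_shift_neq_0 a n m Hre Ha).
      replace (poch (1 - a - natC m) n) with (poch (1 - a - natC m) n * poch (a - natC n) m / poch (a - natC n) m)
        by (field; auto).
      rewrite X. field. auto.
Qed.

Lemma coeff1_eq (a b x : C) (n : nat) : (0 < Re a)%R -> offcut (1 - x) ->
  coeff1 a b x n = factC n * (Cpower (1 - x) (- b) * regular_coef (1 - a) b (x / (x - 1)) n).
Proof.
  intros Hre Hx. assert (Nx := offcut_neq_0 _ Hx).
  assert (Nx' : x - 1 <> 0) by (intros Z; apply Nx; replace (1 - x) with (- (x - 1)) by ring; rewrite Z; ring).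
  transitivity (Cpower (1 - x) (- b) * (factC n * regular_coef (1 - a) b (x / (x - 1)) n)); [|ring].
  rewrite <- exceptional_sum. unfold coeff1.
  destruct (excluded_middle_informative (is_pos_integer a)) as [H|H]; [reflexivity|].
  rewrite (hyp2F1_eq _ _ _ _ _ (pfaff_principal a b n Hre H) Hx).
  rewrite <- !Csum_scal. apply Csum_ext. intros k Hk. unfold pfaff_coeff.
  assert (N0 := poch_1_minus_neq_0 a n Hre H).
  replace (- (b + natC k)) with (- b - natC k) by ring. rewrite Cpower_sub_nat by auto.
  replace ((x / (x - 1)) ^ k) with ((-1) ^ k * x ^ k / (1 - x) ^ k).
  2:{ replace (x / (x - 1)) with (-1 * x * / (1 - x)) by (field; auto).
      rewrite !Cpow_mult_l, Cpow_inv by auto. reflexivity. }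
  assert (N1 := factC_neq_0 k). assert (N2 := Cpow_nz _ k Nx).
  field. auto.
Qed.

(** * Euler's integral and the Humbert function *)

Lemma Beta_neq_0 (a b : C) : (0 < Re a)%R -> (0 < Re b)%R -> Beta a b <> 0.
Proof.
  intros Ha Hb Z. assert (E := Gamma_mult_Beta a b Ha Hb). rewrite Z, Cmult_0_l in E.
  revert E. apply Cmult_neq_0; apply Gamma_neq_0; auto.
Qed.

Lemma beta_kernel_mult_integrable (a b : C) (h : R -> C) (M : R) : (0 < Re a)%R -> (0 < Re b)%R ->
  (forall t, (0 < t < 1)%R -> continuousC h t) -> (forall t, (0 < t < 1)%R -> (Cmod (h t) <= M)%R) ->
  integrable Unit (fun t => beta_kernel a b t * h t).
Proof.
  intros Ha Hb Hc Hh. apply (dominated_integrable Unit (Re a) (Re b) M); auto.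
  - intros t Ht. apply continuousC_mult; [apply continuousC_beta_kernel; auto|auto].
  - intros t Ht. rewrite Cmod_mult, Cmod_beta_kernel by auto. rewrite Rmult_comm.
    apply Rmult_le_compat_r; [|auto]. rewrite <- Cmod_beta_kernel by auto. apply Cmod_ge_0.
Qed.

Lemma beta_kernel_mult_bound (a b : C) : (0 < Re a)%R -> (0 < Re b)%R ->
  exists K, (0 < K)%R /\ forall (h : R -> C) (M : R) (v : C), (0 <= M)%R ->
    (forall t, (0 < t < 1)%R -> (Cmod (h t) <= M)%R) ->
    nint Unit (fun t => beta_kernel a b t * h t) v -> (Cmod v <= M * K)%R.
Proof.
  intros Ha Hb. destruct (dominated_bound Unit (Re a) (Re b) Ha Hb) as [K [HK HB]].
  exists K. split; auto. intros h M v HM Hh Hv. apply (HB M _ v HM Hv).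
  intros t Ht. rewrite Cmod_mult, Cmod_beta_kernel by auto. rewrite Rmult_comm.
  apply Rmult_le_compat_r; [|auto]. rewrite <- Cmod_beta_kernel by auto. apply Cmod_ge_0.
Qed.

Lemma der_linear_power (x w : C) (t : R) : offcut (1 - x * RtoC t) ->
  der (fun t => Cpower (1 - x * RtoC t) w) t (- (w * x * Cpower (1 - x * RtoC t) (w - 1))).
Proof.
  intros H. eapply der_eq.
  - apply der_Cpower; [exact H|]. apply der_minus; [apply der_const|apply der_scal, der_id].
  - cbv beta; ring.
Qed.

Lemma linear_power_bound (x w : C) : offcut (1 - x) ->
  exists K, (0 < K)%R /\ forall t, (0 <= t <= 1)%R -> (Cmod (Cpower (1 - x * RtoC t) w) <= K)%R.
Proof.
  intros Hx. destruct (slit_distance x Hx) as [d [Hd Hxd]].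
  destruct (Cpower_bound d (1 + Cmod x) w Hd) as [K [HK H]].
  exists K. split; auto. intros t Ht. apply H. split; auto.
  eapply Rle_trans; [apply Cmod_triangle_minus|]. rewrite Cmod_1, Cmod_mult, Cmod_RtoC_pos by lra.
  generalize (Cmod_ge_0 x). nra.
Qed.

Lemma continuousC_linear_power (x w : C) (t : R) : offcut (1 - x) -> (0 < t < 1)%R ->
  continuousC (fun t => Cpower (1 - x * RtoC t) w) t.
Proof. intros Hx Ht. eapply der_cont, der_linear_power, offcut_segment; auto; lra. Qed.

Lemma continuousC_pow (n : nat) (t : R) : continuousC (fun t => RtoC t ^ n) t.
Proof. eapply der_cont, der_pow, der_id. Qed.

Lemma Cmod_pow_le1 (t : R) (n : nat) : (0 <= t <= 1)%R -> (Cmod (RtoC t ^ n) <= 1)%R.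
Proof.
  intros Ht. rewrite Cmod_pow, Cmod_RtoC_pos by lra.
  rewrite <- (pow1 n). apply pow_incr; auto.
Qed.

Definition euler_int (a b be x : C) (h : R -> C) : C :=
  Nint Unit (fun t => beta_kernel a be t * (Cpower (1 - x * RtoC t) b * h t)).

Lemma euler_spec (a b be x : C) (h : R -> C) (M : R) : (0 < Re a)%R -> (0 < Re be)%R -> offcut (1 - x) ->
  (forall t, (0 < t < 1)%R -> continuousC h t) -> (forall t, (0 < t < 1)%R -> (Cmod (h t) <= M)%R) ->
  nint Unit (fun t => beta_kernel a be t * (Cpower (1 - x * RtoC t) b * h t)) (euler_int a b be x h).
Proof.
  intros Ha Hbe Hx Hc Hh. destruct (linear_power_bound x b Hx) as [K [HK HB]].
  apply Nint_spec, beta_kernel_mult_integrable with (K * M)%R; auto.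
  - intros t Ht. apply continuousC_mult; [apply continuousC_linear_power; auto|auto].
  - intros t Ht. rewrite Cmod_mult. apply Rmult_le_compat; try apply Cmod_ge_0; auto.
    apply HB; lra.
Qed.

Lemma euler_spec_pow (a b be x : C) (n : nat) : (0 < Re a)%R -> (0 < Re be)%R -> offcut (1 - x) ->
  nint Unit (fun t => beta_kernel a be t * (Cpower (1 - x * RtoC t) b * RtoC t ^ n))
    (euler_int a b be x (fun t => RtoC t ^ n)).
Proof.
  intros Ha Hbe Hx. apply euler_spec with 1%R; auto.
  - intros; apply continuousC_pow.
  - intros; apply Cmod_pow_le1; lra.
Qed.

(** The expansion of the integrand is uniform in t, so it is integrated term
    by term. *)
Lemma euler_pser (a b be z w : C) (d : R) : (0 < Re a)%R -> (0 < Re be)%R -> (0 < d)%R ->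
  (forall t, (0 <= t <= 1)%R -> (d <= Cmod (1 - z * RtoC t))%R) -> offcut (1 - z) -> (Cmod (w - z) < d)%R ->
  pser (fun m => poch b m / factC m * euler_int a (- b - natC m) be z (fun t => RtoC t ^ m)) (w - z)
    (euler_int a (- b) be w (fun t => RtoC t ^ 0)).
Proof.
  intros Ha Hbe Hd Hz Hz1 Hw.
  destruct (power_expansion z w b d Hd Hz Hw) as [eps [He0 [Hlim He]]].
  destruct (beta_kernel_mult_bound a be Ha Hbe) as [K [HK HB]].
  assert (Hw1 : offcut (1 - w)).
  { replace w with (w * RtoC 1) by ring. apply (disc_offcut z w d); auto. lra. }
  unfold pser. apply lim_eps; [typeclasses eauto|]. intros e Hee.
  assert (Hek : (0 < e / K)%R) by (apply Rdiv_lt_0_compat; auto).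
  generalize (proj1 (limR_eps eventually _ _) Hlim (e / K)%R Hek). apply filter_imp. intros n Hn.
  rewrite Rminus_0_r, Rabs_right in Hn by (apply Rle_ge, He0).
  rewrite Cmod_minus_sym.
  apply Rle_lt_trans with (eps n * K)%R.
  2:{ replace e with (e / K * K)%R by (field; lra). apply Rmult_lt_compat_r; auto. }
  apply (HB (fun t => Cpower (1 - w * RtoC t) (- b) -
         sum_n (fun m => poch b m / factC m * Cpower (1 - z * RtoC t) (- b - natC m) * RtoC t ^ m
                         * (w - z) ^ m) n) (eps n)); auto.
  { intros t Ht. apply He. lra. }
  apply nint_ext with (fun t => beta_kernel a be t * (Cpower (1 - w * RtoC t) (- b) * RtoC t ^ 0) -
     sum_n (fun m => poch b m / factC m * (w - z) ^ m *
        (beta_kernel a be t * (Cpower (1 - z * RtoC t) (- b - natC m) * RtoC t ^ m))) n).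
  { intros t _.
    transitivity (beta_kernel a be t * (Cpower (1 - w * RtoC t) (- b) * RtoC t ^ 0) -
      beta_kernel a be t * sum_n (fun m => poch b m / factC m * Cpower (1 - z * RtoC t) (- b - natC m) * RtoC t ^ m
                         * (w - z) ^ m) n).
    - f_equal. rewrite <- Csum_scal. apply Csum_ext. intros; ring.
    - simpl Cpow. ring. }
  apply nint_minus; [apply euler_spec_pow; auto|].
  rewrite (Csum_ext _ (fun m => poch b m / factC m * (w - z) ^ m *
     euler_int a (- b - natC m) be z (fun t => RtoC t ^ m))) by (intros; ring).
  apply (nint_sum Unit (fun m t => poch b m / factC m * (w - z) ^ m *
        (beta_kernel a be t * (Cpower (1 - z * RtoC t) (- b - natC m) * RtoC t ^ m)))).
  intros m _. apply nint_scal, euler_spec_pow; auto.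
Qed.

Lemma beta_kernel_shift (a be : C) (n : nat) (t : R) : (0 < t)%R ->
  beta_kernel (a + natC n) be t = beta_kernel a be t * RtoC t ^ n.
Proof.
  intros Ht. unfold beta_kernel. replace (a + natC n - 1) with (a - 1 + natC n) by ring.
  rewrite Cpower_plus, Cpower_nat by (apply offcut_pos; auto). ring.
Qed.

Lemma euler_at_0 (a b be : C) (m : nat) : (0 < Re a)%R -> (0 < Re be)%R ->
  euler_int a b be 0 (fun t => RtoC t ^ m) = Beta (a + natC m) be.
Proof.
  intros Ha Hbe. apply Nint_eq. eapply nint_ext; [|apply Beta_spec; auto; apply Re_natC_pos; auto].
  intros t Ht. cbv beta. rewrite beta_kernel_shift by apply Ht.
  replace (1 - 0 * RtoC t) with (RtoC 1) by ring. rewrite Cpower_one_base. ring.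
Qed.

Lemma offcut_1_minus_0 : offcut (1 - 0).
Proof. apply offcut_re. simpl. lra. Qed.

Lemma euler_principal (a b be : C) : (0 < Re a)%R -> (0 < Re be)%R ->
  is_principal_hyp2F1 a b (a + be)
    (fun z => / Beta a be * euler_int a (- b) be z (fun t => RtoC t ^ 0)).
Proof.
  intros Ha Hbe. assert (NB := Beta_neq_0 a be Ha Hbe). split.
  - intros z Hz. apply slit_plane_offcut in Hz. apply analytic_scal, analytic_at_pser.
    destruct (slit_distance z Hz) as [d [Hd Hzd]].
    exists d, (fun m => poch b m / factC m * euler_int a (- b - natC m) be z (fun t => RtoC t ^ m)).
    split; auto. intros w Hw. apply (euler_pser a b be z w d); auto.
  - intros z Hz. apply is_pseries_lim.
    assert (X := euler_pser a b be 0 z 1 Ha Hbe Rlt_0_1 zero_distance offcut_1_minus_0).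
    replace (z - 0) with z in X by ring. specialize (X Hz).
    apply (pseries_scal (/ Beta a be)) in X. revert X. apply pser_ext. intros m. cbv beta.
    rewrite euler_at_0 by auto. unfold hyp2F1_coeff.
    assert (E := Beta_plus_nat a be m Ha Hbe).
    assert (Hab : (0 < Re (a + be))%R) by (unfold Re in *; simpl; lra).
    assert (N1 := poch_neq_0 (a + be) m Hab). assert (N2 := factC_neq_0 m).
    replace (Beta (a + natC m) be) with (poch (a + be) m * Beta (a + natC m) be / poch (a + be) m)
      by (field; auto).
    rewrite E. field. auto.
Qed.

(** Same telescoping as in [der_taylor_sum]. *)
Lemma exp_taylor (z : C) (n : nat) :
  (Cmod (Cexp z - sum_n (fun m => (z ^ m / factC m)%C) n)
     <= exp (Cmod z) * Cmod z * (Cmod z ^ n / INR (fact n)))%R.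
Proof.
  set (L := (exp (Cmod z) * Cmod z * (Cmod z ^ n / INR (fact n)))%R).
  assert (D1 : forall m s, der (fun s => (1 - RtoC s) ^ m) s (- (natC m * (1 - RtoC s) ^ (m - 1)))).
  { intros m s. eapply der_eq.
    - apply der_pow, der_minus; [apply der_const|apply der_id].
    - cbv beta; ring. }
  assert (DE : forall s, der (fun s => Cexp (RtoC s * z)) s (z * Cexp (RtoC s * z))).
  { intros s. eapply der_eq; [apply der_Cexp, der_mult; [apply der_id|apply der_const]|]. cbv beta; ring. }
  assert (D : forall k s, der (fun s => sum_n (fun m => z ^ m / factC m * (Cexp (RtoC s * z) * (1 - RtoC s) ^ m)) k) s
     (z ^ (S k) / factC k * (Cexp (RtoC s * z) * (1 - RtoC s) ^ k))).
  { intros k s. induction k as [|k IH].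
    - apply der_ext with (fun s => Cexp (RtoC s * z)).
      + intros s'. rewrite Csum_O. unfold factC, natC; simpl. field.
      + eapply der_eq; [apply DE|]. unfold factC, natC; simpl. field.
    - eapply der_ext; [intros s'; symmetry; apply Csum_S|].
      eapply der_eq; [apply der_plus; [exact IH|apply der_scal, der_mult; [apply DE|apply D1]]|].
      cbv beta. replace (S k - 1)%nat with k by lia. rewrite factC_S, !Cpow_S.
      assert (N1 := natC_S_neq_0 k). assert (N2 := factC_neq_0 k). field. auto. }
  assert (X := mean_value_le _ _ (fun s => (L * s)%R) (fun _ => L) 0 1 ltac:(lra) (fun s _ => D n s)).
  cbv beta in X.
  rewrite (Csum_first (fun m => z ^ m / factC m * (Cexp (RtoC 1 * z) * (1 - RtoC 1) ^ m))) in X.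
  2:{ intros [|k] Hk; [lia|]. rewrite (Cpow_S (1 - RtoC 1)). ring. }
  replace (z ^ 0 / factC 0 * (Cexp (RtoC 1 * z) * (1 - RtoC 1) ^ 0)) with (Cexp z) in X.
  2:{ rewrite Cmult_1_l. unfold factC, natC; simpl. field. }
  rewrite (Csum_ext _ (fun m => z ^ m / factC m)) in X.
  2:{ intros k _. replace (1 - RtoC 0) with (RtoC 1) by ring. rewrite Cpow_1_l, Cmult_0_l, Cexp_0. ring. }
  replace (L * 1 - L * 0)%R with L in X by ring. apply X.
  - intros; auto_derive; [auto|ring].
  - intros s Hs. rewrite !Cmod_mult, Cmod_div, !Cmod_pow by apply factC_neq_0.
    unfold factC, natC. rewrite (Cmod_RtoC_pos (INR _)) by apply pos_INR.
    rewrite <- RtoC_minus, Cmod_RtoC_pos, Cmod_Cexp by lra.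
    assert (P := Cmod_ge_0 z). assert (F := Rinv_0_lt_compat _ (INR_fact_lt_0 n)).
    assert (E1 : (exp (Re (RtoC s * z)) <= exp (Cmod z))%R).
    { apply exp_le_compat. rewrite re_scal_l. eapply Rle_trans; [apply Rle_abs|].
      rewrite Rabs_mult, (Rabs_right s) by lra. assert (Q := re_le_Cmod z). assert (Rabs (Re z) >= 0)%R by apply Rle_ge, Rabs_pos. nra. }
    assert (E2 : ((1 - s) ^ n <= 1)%R) by (apply Rle_trans with (1 ^ n)%R; [apply pow_incr; lra|rewrite pow1; lra]).
    assert (E3 : (0 <= (1 - s) ^ n)%R) by (apply pow_le; lra).
    unfold L, Rdiv. simpl pow.
    replace (exp (Cmod z) * Cmod z * (Cmod z ^ n * / INR (fact n)))%R
      with (Cmod z * Cmod z ^ n * / INR (fact n) * (exp (Cmod z) * 1))%R by ring.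
    apply Rmult_le_compat_l.
    + apply Rmult_le_pos; [apply Rmult_le_pos; [auto|apply pow_le; auto]|lra].
    + apply Rmult_le_compat; auto. left; apply exp_pos.
Qed.

Lemma sum_n_Re_Im (u : nat -> C) (n : nat) :
  Re (sum_n u n) = sum_n (fun k => Re (u k)) n /\ Im (sum_n u n) = sum_n (fun k => Im (u k)) n.
Proof.
  induction n as [|n [IH1 IH2]]; [rewrite !sum_O; auto|].
  rewrite !sum_Sn, <- IH1, <- IH2. split; reflexivity.
Qed.

Lemma CSeries_lim (u : nat -> C) (l : C) : lim_at eventually (fun n => sum_n u n) l -> CSeries u = l.
Proof.
  intros [H1 H2]. apply C_eq; simpl; apply is_series_unique; unfold is_series.
  - eapply filterlim_ext; [|exact H1]. intros n. apply sum_n_Re_Im.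
  - eapply filterlim_ext; [|exact H2]. intros n. apply sum_n_Re_Im.
Qed.

(** Each hypergeometric coefficient of the single series is Euler's integral
    with an additional factor t ^ n, and the exponential series in y t
    converges uniformly on [0, 1]. *)
Lemma Phi1_integral (a b c x y : C) : (0 < Re a)%R -> (0 < Re (c - a))%R -> offcut (1 - x) ->
  Phi1 a b c x y = / Beta a (c - a) * euler_int a (- b) (c - a) x (fun t => Cexp (y * RtoC t)).
Proof.
  intros Ha Hca Hx. set (be := c - a) in *.
  assert (Ec : c = a + be) by (unfold be; ring).
  assert (Hc : (0 < Re c)%R) by (rewrite Ec; change (Re (a + be)) with (Re a + Re be)%R; lra).
  assert (NB := Beta_neq_0 a be Ha Hca).
  assert (Hcont : forall t, (0 < t < 1)%R -> continuousC (fun t => Cexp (y * RtoC t)) t).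
  { intros t _. eapply der_cont, der_Cexp, der_scal, der_id. }
  assert (Hbd : forall t, (0 < t < 1)%R -> (Cmod (Cexp (y * RtoC t)) <= exp (Cmod y))%R).
  { intros t Ht. rewrite Cmod_Cexp. apply exp_le_compat.
    rewrite re_scal_r. eapply Rle_trans; [apply Rle_abs|]. rewrite Rabs_mult, (Rabs_right t) by lra.
    assert (Q := re_le_Cmod y). assert (Rabs (Re y) >= 0)%R by apply Rle_ge, Rabs_pos. nra. }
  assert (HS := euler_spec a (- b) be x _ _ Ha Hca Hx Hcont Hbd).
  unfold Phi1. apply CSeries_lim.
  set (u := fun n => / Beta a be * (y ^ n / factC n * euler_int a (- b) be x (fun t => RtoC t ^ n))).
  assert (Hu : forall n, poch a n / poch c n * hyp2F1 (a + natC n) b (c + natC n) x * (y ^ n / factC n) = u n).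
  { intros n. assert (Han := Re_natC_pos a n Ha).
    replace (c + natC n) with (a + natC n + be) by (rewrite Ec; ring).
    rewrite (hyp2F1_eq _ _ _ _ _ (euler_principal (a + natC n) b be Han Hca) Hx).
    replace (euler_int (a + natC n) (- b) be x (fun t => RtoC t ^ 0))
      with (euler_int a (- b) be x (fun t => RtoC t ^ n)).
    2:{ symmetry. apply Nint_eq. eapply nint_ext; [|apply euler_spec_pow; auto].
        intros t Ht. cbv beta. rewrite beta_kernel_shift by apply Ht. simpl Cpow. ring. }
    unfold u. assert (E := Beta_plus_nat a be n Ha Hca). rewrite <- Ec in E.
    assert (N1 := poch_neq_0 a n Ha). assert (N2 := poch_neq_0 c n Hc).
    assert (N3 := factC_neq_0 n). assert (N4 := Beta_neq_0 (a + natC n) be Han Hca).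
    replace (/ Beta (a + natC n) be) with (poch c n / (poch c n * Beta (a + natC n) be)) by (field; auto).
    rewrite E. field. auto. }
  eapply lim_ext; [typeclasses eauto| |].
  { apply filter_forall. intros n. apply Csum_ext. intros k _. symmetry. apply Hu. }
  destruct (linear_power_bound x (- b) Hx) as [K1 [HK1 HP]].
  destruct (beta_kernel_mult_bound a be Ha Hca) as [K [HK HB]].
  unfold u.
  eapply lim_ext; [typeclasses eauto| |].
  { apply filter_forall. intros n. symmetry. apply Csum_scal. }
  apply lim_scal; [typeclasses eauto|].
  set (Q := (K1 * (exp (Cmod y) * Cmod y))%R).
  assert (PQ : (0 <= Q)%R).
  { apply Rmult_le_pos; [lra|]. apply Rmult_le_pos; [left; apply exp_pos|apply Cmod_ge_0]. }
  apply lim_eps; [typeclasses eauto|]. intros e He.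
  assert (He2 : (0 < e / (Q * K + 1))%R).
  { apply Rdiv_lt_0_compat; auto. assert (0 <= Q * K)%R by (apply Rmult_le_pos; lra). lra. }
  destruct (cv_speed_pow_fact (Cmod y) (e / (Q * K + 1))%R He2) as [N HN].
  exists N. intros n Hn. specialize (HN n Hn). unfold Rdist in HN. rewrite Rminus_0_r in HN.
  assert (Pt : (0 <= Cmod y ^ n / INR (fact n))%R).
  { apply Rmult_le_pos; [apply pow_le, Cmod_ge_0|left; apply Rinv_0_lt_compat, INR_fact_lt_0]. }
  rewrite Rabs_right in HN by lra.
  rewrite Cmod_minus_sym.
  apply Rle_lt_trans with (Q * (Cmod y ^ n / INR (fact n)) * K)%R.
  2:{ assert (PQK : (0 <= Q * K)%R) by (apply Rmult_le_pos; lra).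
      replace (Q * (Cmod y ^ n / INR (fact n)) * K)%R with (Q * K * (Cmod y ^ n / INR (fact n)))%R by ring.
      apply Rle_lt_trans with ((Q * K) * (e / (Q * K + 1)))%R; [apply Rmult_le_compat_l; lra|].
      apply Rmult_lt_reg_r with (Q * K + 1)%R; [lra|].
      replace (Q * K * (e / (Q * K + 1)) * (Q * K + 1))%R with (Q * K * e)%R by (field; lra). lra. }
  apply (HB (fun t => Cpower (1 - x * RtoC t) (- b) *
     (Cexp (y * RtoC t) - sum_n (fun m => (y * RtoC t) ^ m / factC m) n))); [nra| |].
  - intros t Ht. rewrite Cmod_mult. unfold Q. rewrite Rmult_assoc.
    apply Rmult_le_compat; try apply Cmod_ge_0; [apply HP; lra|].
    eapply Rle_trans; [apply exp_taylor|].
    assert (Hy : (Cmod (y * RtoC t) <= Cmod y)%R).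
    { rewrite Cmod_mult, Cmod_RtoC_pos by lra. generalize (Cmod_ge_0 y). nra. }
    assert (P0 := Cmod_ge_0 (y * RtoC t)).
    apply Rmult_le_compat.
    + apply Rmult_le_pos; [left; apply exp_pos|auto].
    + apply Rmult_le_pos; [apply pow_le; auto|left; apply Rinv_0_lt_compat, INR_fact_lt_0].
    + apply Rmult_le_compat; auto. left; apply exp_pos. apply exp_le_compat; auto.
    + apply Rmult_le_compat_r; [left; apply Rinv_0_lt_compat, INR_fact_lt_0|apply pow_incr; auto].
  - eapply nint_ext.
    2:{ apply nint_minus; [exact HS|].
        apply (nint_sum Unit (fun m t => y ^ m / factC m *
          (beta_kernel a be t * (Cpower (1 - x * RtoC t) (- b) * RtoC t ^ m)))).
        intros m _. apply nint_scal, euler_spec_pow; auto. }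
    intros t _. cbv beta.
    transitivity (beta_kernel a be t * (Cpower (1 - x * RtoC t) (- b) * Cexp (y * RtoC t)) -
      beta_kernel a be t * Cpower (1 - x * RtoC t) (- b) * sum_n (fun m => (y * RtoC t) ^ m / factC m) n);
      [|ring].
    f_equal. rewrite <- Csum_scal. apply Csum_ext. intros m _.
    rewrite Cpow_mult_l. unfold Cdiv. ring.
Qed.

(** * Functions with power bounds at both ends, and their Fourier integrals *)

(** A derivative costs one power at either end, as for t ^ (a - 1) and (1 - t)
    ^ (b - 1). The class is therefore stable under products, and its exponents
    tell how often one can integrate by parts without boundary terms. *)
Fixpoint tame (i : itv) (n : nat) (m k : R) (f : R -> C) : Prop :=
  (exists C0, (0 <= C0)%R /\
     forall t, dom i t -> (Cmod (f t) <= C0 * (Rpower (tau i t) m * Rpower (wt i t) k))%R) /\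
  match n with
  | O => forall t, dom i t -> continuousC f t
  | S n => exists f', (forall t, dom i t -> der f t (f' t)) /\ tame i n (m - 1) (k - 1) f'
  end.

Lemma tame_bound (i : itv) (n : nat) (m k : R) (f : R -> C) : tame i n m k f ->
  exists C0, (0 <= C0)%R /\
     forall t, dom i t -> (Cmod (f t) <= C0 * (Rpower (tau i t) m * Rpower (wt i t) k))%R.
Proof. destruct n; simpl; intros [H _]; exact H. Qed.

Lemma tame_cont (i : itv) (n : nat) (m k : R) (f : R -> C) (t : R) : tame i n m k f -> dom i t -> continuousC f t.
Proof.
  destruct n as [|n]; intros [_ H] Ht; [auto|].
  destruct H as [f' [H _]]. eapply der_cont, H, Ht.
Qed.

Lemma tame_pred (i : itv) (n : nat) (m k : R) (f : R -> C) : tame i (S n) m k f -> tame i n m k f.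
Proof.
  revert m k f. induction n as [|n IH]; intros m k f H.
  - split; [eapply tame_bound, H|]. intros t Ht. eapply tame_cont; eauto.
  - destruct H as [H1 [f' [H2 H3]]]. split; [exact H1|]. exists f'. split; auto.
Qed.

Lemma weight_le (i : itv) (m k m' k' t : R) : dom i t -> (m' <= m)%R -> (k' <= k)%R ->
  (Rpower (tau i t) m * Rpower (wt i t) k <= Rpower (tau i t) m' * Rpower (wt i t) k')%R.
Proof.
  intros Ht Hm Hk.
  apply Rmult_le_compat; try (left; apply Rpower_pos); apply Rpower_decr; auto; split;
    [apply tau_pos|apply tau_le1|apply wt_pos|apply wt_le1]; auto.
Qed.

Lemma tame_weaken (i : itv) (n : nat) (m k m' k' : R) (f : R -> C) :
  tame i n m k f -> (m' <= m)%R -> (k' <= k)%R -> tame i n m' k' f.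
Proof.
  revert m k m' k' f. induction n as [|n IH]; intros m k m' k' f [[C0 [P H]] H'] Hm Hk; split.
  - exists C0. split; auto. intros t Ht. eapply Rle_trans; [apply H; auto|].
    apply Rmult_le_compat_l; auto. apply weight_le; auto.
  - exact H'.
  - exists C0. split; auto. intros t Ht. eapply Rle_trans; [apply H; auto|].
    apply Rmult_le_compat_l; auto. apply weight_le; auto.
  - destruct H' as [f' [H1 H2]]. exists f'. split; auto. eapply IH; [exact H2|lra|lra].
Qed.

Lemma tame_ext (i : itv) (n : nat) (m k : R) (f g : R -> C) :
  (forall t, dom i t -> f t = g t) -> tame i n m k f -> tame i n m k g.
Proof.
  intros E HV. destruct (tame_bound _ _ _ _ _ HV) as [C0 [P H]].
  assert (L : forall t, dom i t -> locally t (fun s => f s = g s)).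
  { intros t Ht. generalize (dom_open i t Ht). apply filter_imp. auto. }
  destruct n as [|n]; destruct HV as [_ H']; split.
  - exists C0. split; auto. intros t Ht. rewrite <- E; auto.
  - intros t Ht. apply continuousC_ext_loc with f; auto.
  - exists C0. split; auto. intros t Ht. rewrite <- E; auto.
  - destruct H' as [f' [H1 H2]]. exists f'. split; auto.
    intros t Ht. apply der_ext_loc with f; auto.
Qed.

Lemma tame_plus (i : itv) (n : nat) (m k : R) (f g : R -> C) :
  tame i n m k f -> tame i n m k g -> tame i n m k (fun t => f t + g t).
Proof.
  revert m k f g. induction n as [|n IH]; intros m k f g [[C1 [P1 H1]] H1'] [[C2 [P2 H2]] H2']; split;
    try (exists (C1 + C2)%R; split; [lra|]; intros t Ht;
         eapply Rle_trans; [apply Cmod_triangle|]; rewrite Rmult_plus_distr_r; apply Rplus_le_compat; auto).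
  - intros; apply continuousC_plus; auto.
  - destruct H1' as [f' [A B]], H2' as [g' [A' B']]. exists (fun t => f' t + g' t). split; auto.
    intros; apply der_plus; auto.
Qed.

Lemma tame_mult (i : itv) (n : nat) (m k m' k' : R) (f g : R -> C) :
  tame i n m k f -> tame i n m' k' g -> tame i n (m + m') (k + k') (fun t => f t * g t).
Proof.
  revert m k m' k' f g.
  assert (HB : forall n m k m' k' f g, tame i n m k f -> tame i n m' k' g -> exists C0, (0 <= C0)%R /\
     forall t, dom i t -> (Cmod (f t * g t)%C <= C0 * (Rpower (tau i t) (m + m') * Rpower (wt i t) (k + k')))%R).
  { intros j m k m' k' f g Hf Hg. apply tame_bound in Hf, Hg.
    destruct Hf as [C1 [P1 H1]], Hg as [C2 [P2 H2]]. exists (C1 * C2)%R. split; [nra|].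
    intros t Ht. rewrite Cmod_mult, !Rpower_plus.
    eapply Rle_trans; [apply Rmult_le_compat; [apply Cmod_ge_0|apply Cmod_ge_0|apply H1; auto|apply H2; auto]|].
    right. ring. }
  induction n as [|n IH]; intros m k m' k' f g Hf Hg; split.
  - apply (HB 0%nat); auto.
  - intros t Ht. apply continuousC_mult; eapply tame_cont; eauto.
  - apply (HB (S n)); auto.
  - assert (Hf0 := tame_pred _ _ _ _ _ Hf). assert (Hg0 := tame_pred _ _ _ _ _ Hg).
    destruct Hf as [_ [f' [A B]]], Hg as [_ [g' [A' B']]].
    exists (fun t => f' t * g t + f t * g' t). split.
    + intros t Ht. apply der_mult; auto.
    + apply tame_plus.
      * replace (m + m' - 1)%R with (m - 1 + m')%R by ring. replace (k + k' - 1)%R with (k - 1 + k')%R by ring.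
        apply IH; auto.
      * replace (m + m' - 1)%R with (m + (m' - 1))%R by ring. replace (k + k' - 1)%R with (k + (k' - 1))%R by ring.
        apply IH; auto.
Qed.

Lemma tame_mult_eq (i : itv) (n : nat) (m k m' k' M K : R) (f g : R -> C) :
  tame i n m k f -> tame i n m' k' g -> M = (m + m')%R -> K = (k + k')%R -> tame i n M K (fun t => f t * g t).
Proof. intros Hf Hg -> ->. apply tame_mult; auto. Qed.

Lemma tame_zero (i : itv) (n : nat) (m k : R) : tame i n m k (fun _ => 0).
Proof.
  revert m k. induction n as [|n IH]; intros m k; split;
    try (exists 0%R; split; [lra|]; intros; rewrite Cmod_0; lra).
  - intros; apply continuousC_const.
  - exists (fun _ => 0). split; auto. intros; apply der_const.
Qed.

Lemma Rpower_0_r (x : R) : Rpower x 0 = 1%R.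
Proof. unfold Rpower. rewrite Rmult_0_l. apply exp_0. Qed.

Lemma tame_const (i : itv) (n : nat) (c : C) : tame i n 0 0 (fun _ => c).
Proof.
  destruct n as [|n]; split;
    try (exists (Cmod c); split; [apply Cmod_ge_0|]; intros; rewrite !Rpower_0_r; lra).
  - intros; apply continuousC_const.
  - exists (fun _ => 0). split; [intros; apply der_const|apply tame_zero].
Qed.

Lemma tame_scal (i : itv) (n : nat) (m k : R) (c : C) (f : R -> C) :
  tame i n m k f -> tame i n m k (fun t => c * f t).
Proof.
  intros H. apply (tame_mult_eq i n 0 0 m k m k (fun _ => c) f); [apply tame_const|exact H|ring|ring].
Qed.

Lemma tame_minus (i : itv) (n : nat) (m k : R) (f g : R -> C) :
  tame i n m k f -> tame i n m k g -> tame i n m k (fun t => f t - g t).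
Proof.
  intros Hf Hg. apply tame_ext with (fun t => f t + (-1) * g t); [intros; ring|].
  apply tame_plus; auto. apply tame_scal; auto.
Qed.

Lemma tame_pow (i : itv) (n : nat) (m k : R) (f : R -> C) (j : nat) :
  tame i n m k f -> tame i n (INR j * m) (INR j * k) (fun t => f t ^ j).
Proof.
  intros H. induction j as [|j IH].
  - simpl INR. rewrite !Rmult_0_l. apply (tame_const i n 1).
  - rewrite S_INR. replace ((INR j + 1) * m)%R with (m + INR j * m)%R by ring.
    replace ((INR j + 1) * k)%R with (k + INR j * k)%R by ring.
    apply tame_ext with (fun t => f t * f t ^ j); [intros; now rewrite Cpow_S|].
    apply tame_mult; auto.
Qed.

Lemma tame_sum (i : itv) (n : nat) (m k : R) (f : nat -> R -> C) (N : nat) :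
  (forall j, (j <= N)%nat -> tame i n m k (f j)) -> tame i n m k (fun t => sum_n (fun j => f j t) N).
Proof.
  induction N as [|N IH]; intros H.
  - apply tame_ext with (f 0%nat); [intros; now rewrite Csum_O|auto].
  - apply tame_ext with (fun t => sum_n (fun j => f j t) N + f (S N) t); [intros; now rewrite Csum_S|].
    apply tame_plus; auto.
Qed.

Lemma tame_reflect (n : nat) (m k : R) (f : R -> C) :
  tame Unit n m k f -> tame Unit n k m (fun t => f (1 - t)%R).
Proof.
  assert (D : forall t, dom Unit t -> dom Unit (1 - t)) by (simpl; intros; lra).
  revert m k f. induction n as [|n IH]; intros m k f [[C0 [P H]] H']; split;
    try (exists C0; split; auto; intros t Ht; specialize (H (1 - t)%R (D t Ht));
         simpl in *; replace (1 - (1 - t))%R with t in H by ring; lra).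
  - intros t Ht. apply (continuousC_comp f (fun t => (1 - t)%R)); [auto|].
    apply is_derive_continuity with (-1)%R. auto_derive; [auto|ring].
  - destruct H' as [f' [A B]]. exists (fun t => (-1) * f' (1 - t)%R). split.
    + intros t Ht. apply (der_comp f (fun t => (1 - t)%R) t (-1)%R); [auto|].
      auto_derive; [auto|ring].
    + apply tame_scal, IH, B.
Qed.

Lemma tame_power_unit (n : nat) (p : C) : tame Unit n (Re p) 0 (fun t => Cpower (RtoC t) p).
Proof.
  revert p. induction n as [|n IH]; intros p; split;
    try (exists 1%R; split; [lra|]; intros t Ht; simpl in *; rewrite Cmod_Cpower_pos, Rpower_0_r by lra; lra).
  - intros t Ht. simpl in Ht. eapply der_cont, der_Cpower_pos. lra.
  - exists (fun t => p * Cpower (RtoC t) (p - 1)). split.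
    + intros t Ht. simpl in Ht. apply der_Cpower_pos; lra.
    + apply tame_scal. eapply tame_weaken; [apply IH| |lra]. unfold Re; simpl; lra.
Qed.

Lemma tame_power_half (n : nat) (p : C) : tame Half n (Re p) (- Re p) (fun t => Cpower (RtoC t) p).
Proof.
  revert p. induction n as [|n IH]; intros p; split;
    try (exists 1%R; split; [lra|]; intros t Ht; simpl in Ht; rewrite Cmod_Cpower_pos, Rpower_half by lra; lra).
  - intros t Ht. simpl in Ht. eapply der_cont, der_Cpower_pos. lra.
  - exists (fun t => p * Cpower (RtoC t) (p - 1)). split.
    + intros t Ht. simpl in Ht. apply der_Cpower_pos; lra.
    + apply tame_scal. eapply tame_weaken; [apply IH| |]; unfold Re; simpl; lra.
Qed.

Lemma tame_id (n : nat) : tame Unit n 1 0 (fun t => RtoC t).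
Proof.
  apply tame_ext with (fun t => Cpower (RtoC t) 1).
  - intros t Ht. apply Cpower_1, offcut_pos. apply Ht.
  - apply (tame_power_unit n 1).
Qed.

Lemma tame_exp_unit (n : nat) : tame Unit n 0 0 (fun t => Cexp (- RtoC t)).
Proof.
  induction n as [|n IH]; split;
    try (exists 1%R; split; [lra|]; intros t Ht; simpl in Ht; rewrite !Rpower_0_r, Cmod_Cexp_neg;
         rewrite !Rmult_1_r, <- exp_0; apply exp_le_compat; lra).
  - intros. eapply der_cont, der_Cexp_neg.
  - exists (fun t => (-1) * Cexp (- RtoC t)). split.
    + intros t Ht. eapply der_eq; [apply der_Cexp_neg|ring].
    + apply tame_scal. eapply tame_weaken; [apply IH|lra|lra].
Qed.

Lemma tame_exp_half (n : nat) (k : R) : tame Half n 0 k (fun t => Cexp (- RtoC t)).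
Proof.
  assert (HB : forall k, exists C0, (0 <= C0)%R /\ forall t, dom Half t ->
    (Cmod (Cexp (- RtoC t)) <= C0 * (Rpower (tau Half t) 0 * Rpower (wt Half t) k))%R).
  { intros q. set (q' := Rmax q 1). assert (Q1 : (q <= q')%R) by apply Rmax_l. assert (Q2 : (1 <= q')%R) by apply Rmax_r.
    exists (exp (1 - q' + q' * ln q')). split; [left; apply exp_pos|]. intros t Ht.
    rewrite Cmod_Cexp_neg, Rpower_0_r, Rmult_1_l.
    eapply Rle_trans; [apply (exp_neg_le q'); [lra|exact Ht]|].
    apply Rmult_le_compat_l; [left; apply exp_pos|]. apply Rpower_decr; [|auto].
    split; [apply wt_pos; auto|apply wt_le1; auto]. }
  revert k. induction n as [|n IH]; intros k; split; try apply HB.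
  - intros. eapply der_cont, der_Cexp_neg.
  - exists (fun t => (-1) * Cexp (- RtoC t)). split.
    + intros t Ht. eapply der_eq; [apply der_Cexp_neg|ring].
    + apply tame_scal. eapply tame_weaken; [apply (IH k)|lra|lra].
Qed.

(** Continues an integrand on (0, 1) to the half-line, on which the model
    integral is explicit. *)
Definition ext0 (f : R -> C) (t : R) : C :=
  if Rlt_dec 0 t then if Rlt_dec t 1 then f t else 0 else 0.

Lemma ext0_in (f : R -> C) (t : R) : (0 < t < 1)%R -> ext0 f t = f t.
Proof. intros [H1 H2]. unfold ext0. destruct (Rlt_dec 0 t), (Rlt_dec t 1); tauto. Qed.

Lemma ext0_out (f : R -> C) (t : R) : (1 <= t)%R -> ext0 f t = 0.
Proof. intros H. unfold ext0. destruct (Rlt_dec 0 t), (Rlt_dec t 1); auto; lra. Qed.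

Lemma dom_unit_open (t : R) : (0 < t < 1)%R -> locally t (fun s => (0 < s < 1)%R).
Proof. apply (dom_open Unit). Qed.

Lemma der_ext0_at_1 (f : R -> C) (m k C0 : R) : (2 <= k)%R -> (0 <= C0)%R ->
  (forall t, (0 < t < 1)%R -> (Cmod (f t) <= C0 * (Rpower t m * Rpower (1 - t) k))%R) ->
  der (ext0 f) 1 0.
Proof.
  intros Hk HC H. apply der_of_quadratic with (C0 * exp (Rabs m * ln 2))%R (1 / 2)%R; [lra|].
  intros h Hh. apply Rabs_def2 in Hh. rewrite (ext0_out f 1) by lra.
  replace (ext0 f (1 + h)%R - 0 - RtoC h * 0) with (ext0 f (1 + h)%R) by ring.
  assert (E : (0 < exp (Rabs m * ln 2))%R) by apply exp_pos.
  destruct (Rlt_dec h 0) as [L|L].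
  - rewrite ext0_in by lra. eapply Rle_trans; [apply H; lra|]. rewrite Rmult_assoc.
    apply Rmult_le_compat_l; auto. apply Rmult_le_compat; try (left; apply Rpower_pos).
    + apply Rpower_le_exp. lra.
    + replace (1 - (1 + h))%R with (- h)%R by ring.
      eapply Rle_trans; [apply (Rpower_decr (- h) 2 k); lra|].
      replace 2%R with (INR 2) by reflexivity. rewrite Rpower_pow by lra. right. simpl. ring.
  - rewrite ext0_out by lra. rewrite Cmod_0. apply Rmult_le_pos; [apply Rmult_le_pos|]; nra.
Qed.

Lemma der_ext0 (f f' : R -> C) (m k C0 : R) : (2 <= k)%R -> (0 <= C0)%R ->
  (forall t, (0 < t < 1)%R -> (Cmod (f t) <= C0 * (Rpower t m * Rpower (1 - t) k))%R) ->
  (forall t, (0 < t < 1)%R -> der f t (f' t)) ->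
  forall t, (0 < t)%R -> der (ext0 f) t (ext0 f' t).
Proof.
  intros Hk HC H HD t Ht. destruct (Rtotal_order t 1) as [L|[->|L]].
  - rewrite (ext0_in f') by lra. apply der_ext_loc with f; [|apply HD; lra].
    generalize (dom_unit_open t ltac:(lra)). apply filter_imp. intros s Hs. rewrite ext0_in; auto.
  - rewrite (ext0_out f') by lra. eapply der_ext0_at_1; eauto.
  - rewrite (ext0_out f') by lra. apply der_ext_loc with (fun _ => 0); [|apply der_const].
    generalize (open_gt 1 t L). apply filter_imp. intros s Hs. rewrite ext0_out; auto. lra.
Qed.

Lemma unit_weight_le (m q t : R) : (0 < t < 1)%R ->
  (Rpower t m <= exp (Rabs (- m - q) * ln 2) * (Rpower (tau Half t) m * Rpower (wt Half t) q))%R.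
Proof.
  intros Ht. rewrite (Rpower_half t m) by lra.
  assert (W : (1 / 2 <= wt Half t <= 1)%R).
  { simpl. split; [|apply (wt_le1 Half); simpl; lra]. unfold Rdiv. rewrite Rmult_1_l.
    apply Rinv_le_contravar; lra. }
  replace (- m)%R with (- m - q + q)%R at 1 by ring. rewrite (Rpower_plus _ q).
  assert (X := Rpower_le_exp (wt Half t) (- m - q) W).
  assert (P1 := Rpower_pos (tau Half t) m). assert (P2 := Rpower_pos (wt Half t) q).
  assert (P3 := Rpower_pos (wt Half t) (- m - q)).
  replace (Rpower (tau Half t) m * (Rpower (wt Half t) (- m - q) * Rpower (wt Half t) q))%R
    with (Rpower (wt Half t) (- m - q) * (Rpower (tau Half t) m * Rpower (wt Half t) q))%R by ring.
  apply Rmult_le_compat_r; [nra|exact X].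
Qed.

(** Two powers of 1 - t more than the number of derivatives make every
    derivative continue by 0 through 1. *)
Lemma tame_ext0 (n : nat) (m k q : R) (f : R -> C) : (INR n + 2 <= k)%R ->
  tame Unit n m k f -> tame Half n m q (ext0 f).
Proof.
  assert (HB : forall n m k q f, (2 <= k)%R -> tame Unit n m k f -> exists C0, (0 <= C0)%R /\ forall t, dom Half t ->
    (Cmod (ext0 f t) <= C0 * (Rpower (tau Half t) m * Rpower (wt Half t) q))%R).
  { clear. intros n m k q f Hk H. destruct (tame_bound _ _ _ _ _ H) as [C0 [P HC]].
    exists (C0 * exp (Rabs (- m - q) * ln 2))%R. split; [apply Rmult_le_pos; [auto|left; apply exp_pos]|].
    intros t Ht. simpl in Ht. destruct (Rlt_dec t 1) as [L|L].
    - rewrite ext0_in by lra. eapply Rle_trans; [apply HC; simpl; lra|]. rewrite Rmult_assoc.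
      apply Rmult_le_compat_l; auto. simpl tau. simpl wt at 1.
      eapply Rle_trans; [|apply unit_weight_le; lra].
      rewrite <- (Rmult_1_r (Rpower t m)) at 2. apply Rmult_le_compat_l; [left; apply Rpower_pos|].
      apply Rle_trans with (Rpower (1 - t) 0); [apply Rpower_decr; lra|rewrite Rpower_0_r; lra].
    - rewrite ext0_out by lra. rewrite Cmod_0. apply Rmult_le_pos; [apply Rmult_le_pos; [auto|left; apply exp_pos]|].
      apply Rmult_le_pos; left; apply Rpower_pos. }
  revert m k q f. induction n as [|n IH]; intros m k q f Hk H.
  - simpl INR in Hk. split; [eapply HB; [|exact H]; lra|].
    intros t Ht. simpl in Ht. destruct (tame_bound _ _ _ _ _ H) as [C0 [P HC]].
    destruct (Rtotal_order t 1) as [L|[->|L]].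
    + apply continuousC_ext_loc with f; [|eapply tame_cont; [exact H|simpl; lra]].
      generalize (dom_unit_open t ltac:(lra)). apply filter_imp. intros s Hs. rewrite ext0_in; auto.
    + eapply der_cont, der_ext0_at_1; [|exact P|exact HC]. lra.
    + apply continuousC_ext_loc with (fun _ => 0); [|apply continuousC_const].
      generalize (open_gt 1 t L). apply filter_imp. intros s Hs. rewrite ext0_out; auto. lra.
  - rewrite S_INR in Hk. assert (Pn := pos_INR n).
    split; [eapply HB; [|exact H]; lra|].
    destruct (tame_bound _ _ _ _ _ H) as [C0 [P HC]]. destruct H as [_ [f' [A B]]].
    exists (ext0 f'). split.
    + intros t Ht. eapply der_ext0; [|exact P|exact HC|exact A|exact Ht]. lra.
    + apply IH with (k - 1)%R; [lra|exact B].
Qed.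

Lemma glue_bound (n : nat) (p p' q k : R) (f : R -> C) : (p' <= p)%R ->
  tame Unit n p k f -> tame Half n p' q f -> exists C0, (0 <= C0)%R /\ forall t, dom Half t ->
    (Cmod (f t) <= C0 * (Rpower (tau Half t) p * Rpower (wt Half t) q))%R.
Proof.
  intros Hp H1 H2. destruct (tame_bound _ _ _ _ _ H1) as [C1 [P1 B1]].
  destruct (tame_bound _ _ _ _ _ H2) as [C2 [P2 B2]].
  set (e1 := exp (Rabs (- p - q) * ln 2)). set (e2 := exp (Rabs k * ln 2)).
  set (e3 := Rpower (1 / 3) (p' - p)).
  assert (Q1 : (0 < e1)%R) by apply exp_pos. assert (Q2 : (0 < e2)%R) by apply exp_pos.
  assert (Q3 : (0 < e3)%R) by apply Rpower_pos.
  assert (S1 : (0 <= C1 * (e2 * e1))%R) by (apply Rmult_le_pos; [|apply Rmult_le_pos]; lra).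
  assert (S2 : (0 <= C2 * e3)%R) by (apply Rmult_le_pos; lra).
  exists (C1 * (e2 * e1) + C2 * e3)%R. split; [lra|].
  intros t Ht. simpl in Ht.
  assert (W1 := Rpower_pos (tau Half t) p). assert (W2 := Rpower_pos (wt Half t) q).
  assert (W : (0 < Rpower (tau Half t) p * Rpower (wt Half t) q)%R) by (apply Rmult_lt_0_compat; auto).
  set (w := (Rpower (tau Half t) p * Rpower (wt Half t) q)%R) in *.
  rewrite Rmult_plus_distr_r.
  destruct (Rle_dec t (1 / 2)) as [L|L].
  - apply Rle_trans with (C1 * (e2 * e1) * w)%R; [|nra].
    eapply Rle_trans; [apply B1; simpl; lra|]. rewrite !Rmult_assoc. apply Rmult_le_compat_l; auto.
    change (tau Unit t) with t. change (wt Unit t) with (1 - t)%R. rewrite Rmult_comm.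
    apply Rmult_le_compat; try (left; apply Rpower_pos).
    + apply Rpower_le_exp; lra.
    + apply unit_weight_le; lra.
  - apply Rle_trans with (C2 * e3 * w)%R; [|nra].
    eapply Rle_trans; [apply B2; exact Ht|]. rewrite Rmult_assoc. apply Rmult_le_compat_l; auto.
    unfold w. rewrite <- Rmult_assoc. apply Rmult_le_compat_r; [lra|].
    replace p' with (p' - p + p)%R at 1 by ring. rewrite Rpower_plus. apply Rmult_le_compat_r; [lra|].
    unfold e3, Rpower. apply exp_le_compat.
    assert (T : (1 / 3 <= tau Half t)%R).
    { simpl. apply Rmult_le_reg_r with (1 + t)%R; [lra|]. unfold Rdiv at 2. rewrite Rmult_assoc, Rinv_l; lra. }
    assert (ln (1 / 3) <= ln (tau Half t))%R by (apply ln_le; lra). nra.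
Qed.

(** The uniqueness of derivatives identifies the two chains on (0, 1). *)
Lemma tame_glue (n : nat) (p p' q k : R) (f : R -> C) : (p' <= p)%R ->
  tame Unit n p k f -> tame Half n p' q f -> tame Half n p q f.
Proof.
  revert p p' q k f. induction n as [|n IH]; intros p p' q k f Hp H1 H2.
  - split; [eapply glue_bound; eauto|]. apply H2.
  - split; [eapply glue_bound; eauto|].
    destruct H1 as [_ [f1 [A1 B1]]], H2 as [_ [f2 [A2 B2]]].
    exists f2. split; [exact A2|].
    apply (IH (p - 1)%R (p' - 1)%R (q - 1)%R (k - 1)%R); [lra| |exact B2].
    apply tame_ext with f1; [|exact B1].
    intros t Ht. apply (der_unique f t); [apply A1; auto|apply A2; apply Ht].
Qed.

Lemma continuousC_Cexp_i (lam t : R) : continuousC (fun t => Cexp (Ci * RtoC (lam * t))) t.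
Proof. eapply der_cont, der_Cexp_i. Qed.

Lemma tame_fourier_bound (i : itv) (n : nat) (m k : R) (f : R -> C) : (0 <= m)%R -> (2 <= k)%R ->
  tame i n m k f ->
  (forall lam, integrable i (fun t => f t * Cexp (Ci * RtoC (lam * t)))) /\
  exists K, (0 <= K)%R /\ forall lam v, nint i (fun t => f t * Cexp (Ci * RtoC (lam * t))) v -> (Cmod v <= K)%R.
Proof.
  intros Hm Hk H. destruct (tame_bound _ _ _ _ _ H) as [C0 [P HC]].
  assert (HB : forall lam t, dom i t ->
    (Cmod (f t * Cexp (Ci * RtoC (lam * t)))%C <= C0 * beta_density i 1 1 t)%R).
  { intros lam t Ht. rewrite Cmod_mult, Cmod_Cexp_i, Rmult_1_r.
    eapply Rle_trans; [apply HC; auto|]. apply Rmult_le_compat_l; auto.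
    eapply Rle_trans; [apply (weight_le i m k 0 2 t Ht); lra|].
    unfold beta_density. replace (1 - 1)%R with 0%R by ring. rewrite !Rpower_0_r, !Rmult_1_l.
    destruct i; [|rewrite dtau_half by exact Ht; lra].
    apply Rle_trans with (Rpower (wt Unit t) 0); [|rewrite Rpower_0_r; apply Rle_refl].
    apply Rpower_decr; [|lra]. split; [apply wt_pos; auto|apply wt_le1; auto]. }
  split.
  - intros lam. apply (dominated_integrable i 1 1 C0); [lra|lra| |apply HB].
    intros t Ht. apply continuousC_mult; [eapply tame_cont; eauto|apply continuousC_Cexp_i].
  - destruct (dominated_bound i 1 1 ltac:(lra) ltac:(lra)) as [K [HK HD]].
    exists (C0 * K)%R. split; [apply Rmult_le_pos; lra|]. intros lam v Hv.
    apply (HD C0 _ v P Hv). apply HB.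
Qed.

(** Integrate by parts n times: the exponents keep every boundary term zero
    and the last integrand integrable. *)
Lemma tame_fourier_decay (i : itv) (n : nat) (m k : R) (f : R -> C) : (INR n <= m)%R -> (INR n + 2 <= k)%R ->
  tame i n m k f ->
  exists K, (0 <= K)%R /\ forall lam v, lam <> 0%R ->
    nint i (fun t => f t * Cexp (Ci * RtoC (lam * t))) v -> (Cmod v <= K / Rabs lam ^ n)%R.
Proof.
  revert m k f. induction n as [|n IH]; intros m k f Hm Hk H.
  - simpl INR in *. destruct (tame_fourier_bound i 0 m k f ltac:(lra) ltac:(lra) H) as [_ [K [HK HB]]].
    exists K. split; auto. intros lam v _ Hv. simpl. unfold Rdiv. rewrite Rinv_1, Rmult_1_r. eapply HB, Hv.
  - rewrite S_INR in Hm, Hk. assert (Pn := pos_INR n).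
    destruct (tame_bound _ _ _ _ _ H) as [C0 [P HC]].
    destruct H as [_ [f' [A B]]].
    destruct (IH (m - 1)%R (k - 1)%R f' ltac:(lra) ltac:(lra) B) as [K [HK HB]].
    destruct (tame_fourier_bound i n (m - 1) (k - 1) f' ltac:(lra) ltac:(lra) B) as [HI _].
    exists K. split; auto. intros lam v Hl Hv.
    destruct (HI lam) as [v' Hv'].
    assert (Pl := Rabs_pos_lt lam Hl).
    assert (E : nint i (fun t => f' t * Cexp (Ci * RtoC (lam * t)) + Ci * RtoC lam * (f t * Cexp (Ci * RtoC (lam * t)))) 0).
    { destruct (lim_ends_zero i m k C0 (fun t => f t * Cexp (Ci * RtoC (lam * t)))) as [L1 L2]; [lra|lra| |].
      - intros t Ht. rewrite Cmod_mult, Cmod_Cexp_i, Rmult_1_r. auto.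
      - apply nint_der_zero with (fun t => f t * Cexp (Ci * RtoC (lam * t))); auto.
        intros t Ht. eapply der_eq; [apply der_mult; [apply A; auto|apply der_Cexp_i]|]. cbv beta. ring. }
    assert (X := nint_unique _ _ _ _ E (nint_plus _ _ _ _ _ Hv' (nint_scal _ (Ci * RtoC lam) _ _ Hv))).
    assert (Y : (Rabs lam * Cmod v = Cmod v')%R).
    { replace v' with (- (Ci * RtoC lam * v)) by (replace v' with (v' + Ci * RtoC lam * v - Ci * RtoC lam * v) by ring; rewrite <- X; ring).
      rewrite Cmod_opp, !Cmod_mult, Cmod_Ci, Cmod_R. ring. }
    assert (Z := HB lam v' Hl Hv'). rewrite <- Y in Z.
    assert (Pp : (0 < Rabs lam ^ n)%R) by (apply pow_lt; auto).
    apply Rmult_le_reg_l with (Rabs lam); auto. eapply Rle_trans; [exact Z|].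
    right. simpl. field. lra.
Qed.

(** * A polynomial partition of unity *)

(** Flat at both ends; in this form t -> 1 - t maps cutoffs to cutoffs
    ([cutoff_reflect]). *)
Definition cutoff (n : nat) (K : R) (chi : R -> C) : Prop :=
  tame Unit n 0 K chi /\ tame Unit n K 0 (fun t => 1 - chi t).

Lemma geometric_sum (z : C) (n : nat) : (1 - z) * sum_n (fun j => z ^ j) n = 1 - z ^ (S n) :> C.
Proof.
  induction n as [|n IH].
  - rewrite Csum_O. simpl. ring.
  - rewrite Csum_S, Cmult_plus_distr_l, IH, !Cpow_S. ring.
Qed.

Lemma tame_pow_bounded (n : nat) (f : R -> C) (j : nat) : tame Unit n 0 0 f -> tame Unit n 0 0 (fun t => f t ^ j).
Proof.
  intros H. assert (X := tame_pow Unit n 0 0 f j H). rewrite Rmult_0_r in X. exact X.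
Qed.

(** The polynomial 1 - (1 - (1 - t) ^ K) ^ K; both flatness properties are
    factorisations by geometric sums. *)
Lemma cutoff_exists (n K : nat) : exists chi, cutoff n (INR (S K)) chi.
Proof.
  set (z := fun t => RtoC (1 - t) : C). set (u := fun t => 1 - z t ^ (S K)).
  assert (Hz : tame Unit n 0 1 z) by apply (tame_reflect n 1 0 (fun t => RtoC t)), tame_id.
  assert (Hz0 : tame Unit n 0 0 z) by (eapply tame_weaken; [exact Hz|lra|lra]).
  assert (HzK : tame Unit n 0 (INR (S K)) (fun t => z t ^ (S K))).
  { assert (X := tame_pow Unit n 0 1 z (S K) Hz). rewrite Rmult_0_r, Rmult_1_r in X. exact X. }
  assert (Hu0 : tame Unit n 0 0 u).
  { apply tame_minus; [apply tame_const|apply tame_pow_bounded; auto]. }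
  assert (Hu : tame Unit n 1 0 u).
  { apply tame_ext with (fun t => RtoC t * sum_n (fun j => z t ^ j) K).
    - intros t _. unfold u. rewrite <- geometric_sum. unfold z. rewrite RtoC_minus. ring.
    - apply (tame_mult_eq Unit n 1 0 0 0); [apply tame_id| |ring|ring].
      apply (tame_sum Unit n 0 0 (fun j t => z t ^ j)). intros; apply tame_pow_bounded; auto. }
  exists (fun t => 1 - u t ^ (S K)). split.
  - apply tame_ext with (fun t => z t ^ (S K) * sum_n (fun j => u t ^ j) K).
    + intros t _. rewrite <- geometric_sum. unfold u at 2. ring.
    + apply (tame_mult_eq Unit n 0 (INR (S K)) 0 0); [exact HzK| |ring|ring].
      apply (tame_sum Unit n 0 0 (fun j t => u t ^ j)). intros; apply tame_pow_bounded; auto.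
  - apply tame_ext with (fun t => u t ^ (S K)); [intros; ring|].
    assert (X := tame_pow Unit n 1 0 u (S K) Hu). rewrite Rmult_0_r, Rmult_1_r in X. exact X.
Qed.

Lemma cutoff_reflect (n : nat) (K : R) (chi : R -> C) : cutoff n K chi ->
  cutoff n K (fun t => 1 - chi (1 - t)%R).
Proof.
  intros [H1 H2]. split.
  - apply (tame_reflect n K 0 (fun t => 1 - chi t)); auto.
  - apply tame_ext with (fun t => chi (1 - t)%R); [intros; ring|]. apply tame_reflect; auto.
Qed.

(** * Taylor remainder of the factor regular at an end *)

(** The integrand of the representation is a power of t times this function,
    with s = 1 - (c - a). *)
Definition regular_factor (s b x : C) (t : R) : C := Cpower (1 - RtoC t) (- s) * Cpower (1 - x * RtoC t) (- b).

Definition regular_taylor (s b x : C) (M : nat) (t : R) : C :=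
  match M with O => 0 | S M => sum_n (fun k => regular_coef s b x k * RtoC t ^ k) M end.

Lemma der_regular_factor (s b x : C) (t : R) : offcut (1 - x) -> (0 <= t < 1)%R ->
  der (regular_factor s b x) t (s * regular_factor (s + 1) b x t + b * x * regular_factor s (b + 1) x t).
Proof.
  intros Hx Ht. unfold regular_factor. eapply der_eq.
  - apply der_mult; [|apply der_linear_power, offcut_segment; auto; lra].
    apply der_Cpower; [|apply der_minus; [apply der_const|apply der_id]].
    rewrite <- RtoC_minus. apply offcut_pos. lra.
  - cbv beta. replace (- s - 1) with (- (s + 1)) by ring. replace (- b - 1) with (- (b + 1)) by ring. ring.
Qed.

Lemma der_regular_taylor (s b x : C) (M : nat) (t : R) :
  der (regular_taylor s b x M) t (s * regular_taylor (s + 1) b x (pred M) t + b * x * regular_taylor s (b + 1) x (pred M) t).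
Proof.
  destruct M as [|M]; [simpl; eapply der_eq; [apply der_const|ring]|].
  simpl pred. unfold regular_taylor at 1.
  eapply der_eq.
  - apply (der_sum (fun k t => regular_coef s b x k * RtoC t ^ k)). intros k _. apply der_scal, der_pow, der_id.
  - destruct M as [|M].
    + rewrite Csum_O, natC_0. simpl. ring.
    + rewrite Csum_head, natC_0. simpl regular_taylor.
      match goal with |- ?z + _ = _ => replace z with (RtoC 0) by ring end. rewrite Cplus_0_l.
      rewrite <- !Csum_scal, <- Csum_plus. apply Csum_ext. intros k _.
      replace (S k - 1)%nat with k by lia.
      transitivity (natC (S k) * regular_coef s b x (S k) * RtoC t ^ k); [ring|].
      rewrite regular_coef_succ. ring.
Qed.

Definition regular_rem (s b x : C) (M : nat) (t : R) : C := regular_factor s b x t - regular_taylor s b x M t.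

Lemma der_regular_rem (s b x : C) (M : nat) (t : R) : offcut (1 - x) -> (0 <= t < 1)%R ->
  der (regular_rem s b x M) t (s * regular_rem (s + 1) b x (pred M) t + b * x * regular_rem s (b + 1) x (pred M) t).
Proof.
  intros Hx Ht. eapply der_eq; [apply der_minus; [apply der_regular_factor; auto|apply der_regular_taylor]|].
  unfold regular_rem. ring.
Qed.

Lemma regular_factor_bound (s b x : C) : offcut (1 - x) ->
  exists K, (0 < K)%R /\ forall t, (0 <= t < 1)%R -> (Cmod (regular_factor s b x t) <= K * Rpower (1 - t) (- Re s))%R.
Proof.
  intros Hx. destruct (linear_power_bound x (- b) Hx) as [K [HK H]].
  exists K. split; auto. intros t Ht. unfold regular_factor. rewrite Cmod_mult, <- RtoC_minus, Cmod_Cpower_pos by lra.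
  change (Re (- s)) with (- Re s)%R. rewrite Rmult_comm. apply Rmult_le_compat_r; [left; apply Rpower_pos|].
  apply H; lra.
Qed.

Lemma regular_taylor_bound (s b x : C) (M : nat) :
  exists K, (0 <= K)%R /\ forall t, (0 <= t <= 1)%R -> (Cmod (regular_taylor s b x M t) <= K)%R.
Proof.
  destruct M as [|M]; [exists 0%R; split; [lra|]; intros; simpl; rewrite Cmod_0; lra|].
  exists (sum_n (fun k => Cmod (regular_coef s b x k)) M). split.
  - eapply Rle_trans; [|apply (Cmod_sum_le (regular_coef s b x)); intros; apply Rle_refl]. apply Cmod_ge_0.
  - intros t Ht. apply Cmod_sum_le. intros k _. rewrite Cmod_mult.
    rewrite <- (Rmult_1_r (Cmod (regular_coef s b x k))) at 2. apply Rmult_le_compat_l; [apply Cmod_ge_0|].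
    apply Cmod_pow_le1; auto.
Qed.

Lemma regular_rem_at_0 (s b x : C) (M : nat) : regular_rem s b x (S M) 0 = 0.
Proof.
  unfold regular_rem, regular_factor, regular_taylor. rewrite Csum_first.
  - replace (1 - RtoC 0) with (RtoC 1) by ring. replace (1 - x * RtoC 0) with (RtoC 1) by ring.
    rewrite !Cpower_one_base, regular_coef_0. simpl. ring.
  - intros [|k] Hk; [lia|]. rewrite Cpow_S. ring.
Qed.

(** Induction on the order: the remainder vanishes at 0 and its derivative is
    a combination of two remainders of lower order. *)
Lemma regular_rem_bound_near_0 (M : nat) (s b x : C) : offcut (1 - x) ->
  exists K, (0 <= K)%R /\ forall t, (0 <= t <= 1 / 2)%R -> (Cmod (regular_rem s b x M t) <= K * t ^ M)%R.
Proof.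
  intros Hx. revert s b. induction M as [|M IH]; intros s b.
  - destruct (regular_factor_bound s b x Hx) as [K [HK H]].
    exists (K * exp (Rabs (- Re s) * ln 2))%R. split; [apply Rmult_le_pos; [lra|left; apply exp_pos]|].
    intros t Ht. unfold regular_rem, regular_taylor. replace (regular_factor s b x t - 0) with (regular_factor s b x t) by ring.
    simpl. rewrite Rmult_1_r. eapply Rle_trans; [apply H; lra|].
    apply Rmult_le_compat_l; [lra|]. apply Rpower_le_exp. lra.
  - destruct (IH (s + 1) b) as [K1 [P1 H1]]. destruct (IH s (b + 1)) as [K2 [P2 H2]].
    set (L := (Cmod s * K1 + Cmod (b * x) * K2)%R).
    assert (PL : (0 <= L)%R) by (apply Rplus_le_le_0_compat; apply Rmult_le_pos; auto; apply Cmod_ge_0).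
    exists L. split; auto. intros t0 Ht0.
    assert (X := mean_value_le (regular_rem s b x (S M))
      (fun t => s * regular_rem (s + 1) b x M t + b * x * regular_rem s (b + 1) x M t)
      (fun t => (L * t0 ^ M * t)%R) (fun _ => (L * t0 ^ M)%R) 0 t0 ltac:(lra)).
    rewrite regular_rem_at_0 in X. replace (regular_rem s b x (S M) t0 - 0) with (regular_rem s b x (S M) t0) in X by ring.
    simpl pow. replace (L * (t0 * t0 ^ M))%R with (L * t0 ^ M * t0 - L * t0 ^ M * 0)%R by ring.
    apply X.
    + intros t Ht. apply (der_regular_rem s b x (S M)); auto. lra.
    + intros; auto_derive; [auto|ring].
    + intros t Ht. eapply Rle_trans; [apply Cmod_triangle|]. rewrite (Cmod_mult s), (Cmod_mult (b * x)).
      assert (Q : (t ^ M <= t0 ^ M)%R) by (apply pow_incr; lra).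
      assert (Q0 : (0 <= t ^ M)%R) by (apply pow_le; lra).
      unfold L. rewrite Rmult_plus_distr_r, !Rmult_assoc.
      apply Rplus_le_compat; (apply Rmult_le_compat_l; [apply Cmod_ge_0|]).
      * eapply Rle_trans; [apply H1; lra|]. apply Rmult_le_compat_l; auto.
      * eapply Rle_trans; [apply H2; lra|]. apply Rmult_le_compat_l; auto.
Qed.

Lemma regular_rem_bound (M : nat) (s b x : C) : offcut (1 - x) ->
  exists K, (0 <= K)%R /\ forall t, (0 < t < 1)%R ->
    (Cmod (regular_rem s b x M t) <= K * (Rpower t (INR M) * Rpower (1 - t) (- Rabs (Re s))))%R.
Proof.
  intros Hx. destruct (regular_rem_bound_near_0 M s b x Hx) as [K1 [P1 H1]].
  destruct (regular_factor_bound s b x Hx) as [K2 [P2 H2]]. destruct (regular_taylor_bound s b x M) as [K3 [P3 H3]].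
  assert (Pow : (0 < 2 ^ M)%R) by (apply pow_lt; lra).
  assert (S1 : (0 <= (K2 + K3) * 2 ^ M)%R) by (apply Rmult_le_pos; lra).
  exists (K1 + (K2 + K3) * 2 ^ M)%R. split; [lra|]. intros t Ht.
  assert (W : (1 <= Rpower (1 - t) (- Rabs (Re s)))%R).
  { rewrite <- (Rpower_0_r (1 - t)) at 1. apply Rpower_decr; [lra|]. generalize (Rabs_pos (Re s)); lra. }
  rewrite Rpower_pow by lra. set (w := Rpower (1 - t) (- Rabs (Re s))) in *.
  assert (Ptm : (0 < t ^ M)%R) by (apply pow_lt; lra).
  destruct (Rle_dec t (1 / 2)) as [L|L].
  - eapply Rle_trans; [apply H1; lra|].
    apply Rle_trans with (K1 * (t ^ M * w))%R.
    + apply Rmult_le_compat_l; auto. nra.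
    + apply Rmult_le_compat_r; [|lra]. nra.
  - eapply Rle_trans; [apply Cmod_triangle_minus|].
    assert (E1 : (Rpower (1 - t) (- Re s) <= w)%R).
    { apply Rpower_decr; [lra|]. generalize (Rle_abs (Re s)). lra. }
    assert (E2 : (Cmod (regular_factor s b x t) + Cmod (regular_taylor s b x M t) <= (K2 + K3) * w)%R).
    { specialize (H2 t ltac:(lra)). specialize (H3 t ltac:(lra)).
      assert (K2 * Rpower (1 - t) (- Re s) <= K2 * w)%R by (apply Rmult_le_compat_l; lra). nra. }
    eapply Rle_trans; [exact E2|].
    assert (E3 : (1 <= 2 ^ M * t ^ M)%R).
    { rewrite <- Rpow_mult_distr. apply pow_R1_Rle. lra. }
    apply Rle_trans with ((K2 + K3) * w * (2 ^ M * t ^ M))%R.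
    + rewrite <- (Rmult_1_r ((K2 + K3) * w)) at 1. apply Rmult_le_compat_l; [apply Rmult_le_pos; lra|auto].
    + replace ((K2 + K3) * w * (2 ^ M * t ^ M))%R with ((K2 + K3) * 2 ^ M * (t ^ M * w))%R by ring.
      apply Rmult_le_compat_r; [nra|lra].
Qed.

Lemma tame_regular_rem (n M : nat) (s b x : C) : offcut (1 - x) ->
  tame Unit n (INR M) (- Rabs (Re s)) (regular_rem s b x M).
Proof.
  intros Hx. revert M s b. induction n as [|n IH]; intros M s b; split; try (apply regular_rem_bound; auto).
  - intros t Ht. simpl in Ht. eapply der_cont, der_regular_rem; auto. lra.
  - exists (fun t => s * regular_rem (s + 1) b x (pred M) t + b * x * regular_rem s (b + 1) x (pred M) t). split.
    + intros t Ht. simpl in Ht. apply der_regular_rem; auto. lra.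
    + assert (HM : (INR M - 1 <= INR (pred M))%R) by (destruct M; [simpl; lra|rewrite S_INR; simpl pred; lra]).
      apply tame_plus; apply tame_scal; (eapply tame_weaken; [apply IH|exact HM|]); [|lra].
      change (Re (s + 1)) with (Re s + 1)%R.
      assert (T := Rabs_triang (Re s) 1). rewrite (Rabs_right 1) in T by lra. lra.
Qed.

(** * The model integral *)

(** Beyond 1 the antiderivative is constant. *)
Lemma nint_ext0_restrict (f : R -> C) (v : C) : nint Half (ext0 f) v -> nint Unit f v.
Proof.
  intros (F & A & B & HF & HA & HB & ->).
  assert (Hconst : forall t, (1 <= t)%R -> F t = F 1%R).
  { intros t Ht. symmetry. apply der_zero_const; auto. intros u Hu.
    rewrite <- (ext0_out f u) by lra. apply HF. simpl. lra. }
  assert (EB : B = F 1%R).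
  { apply (lim_unique (hi_end Half) F); auto.
    apply lim_ext with (fun _ => F 1%R); [typeclasses eauto| |apply lim_const; typeclasses eauto].
    exists 1%R. intros t Ht. symmetry. apply Hconst. lra. }
  exists F, A, (F 1%R). split; [|split; [auto|split; [|rewrite EB; reflexivity]]].
  - intros t Ht. simpl in Ht. rewrite <- (ext0_in f t Ht). apply HF. simpl. lra.
  - assert (D := der_cont F 1 _ (HF 1%R Rlt_0_1)). destruct D as [D1 D2].
    split; (eapply filterlim_filter_le_1; [apply filter_le_within|]); [exact D1|exact D2].
Qed.

(** It equals 1 to order M + 1 at 0 and decays exponentially, while its
    Laplace transform is explicit: it replaces the constant 1 in the divergent
    integral of t ^ (z - 1) exp (i lam t). *)
Definition expsum (M : nat) (t : R) : C := Cexp (- RtoC t) * sum_n (fun j => RtoC t ^ j / factC j) M.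

Lemma der_expsum (M : nat) (t : R) :
  der (expsum M) t (- (/ factC M) * (RtoC t ^ M * Cexp (- RtoC t))).
Proof.
  induction M as [|M IH].
  - apply der_ext with (fun t => Cexp (- RtoC t)).
    + intros u. unfold expsum. rewrite Csum_O. unfold factC, natC; simpl. field.
    + eapply der_eq; [apply der_Cexp_neg|]. unfold factC, natC; simpl. field.
  - apply der_ext with (fun t => expsum M t + / factC (S M) * (RtoC t ^ S M * Cexp (- RtoC t))).
    + intros u. unfold expsum. rewrite Csum_S. unfold Cdiv. ring.
    + eapply der_eq.
      * apply der_plus; [exact IH|]. apply der_scal, der_mult; [apply der_pow, der_id|apply der_Cexp_neg].
      * cbv beta. replace (S M - 1)%nat with M by lia. rewrite factC_S.
        assert (N1 := natC_S_neq_0 M). assert (N2 := factC_neq_0 M). field. auto.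
Qed.

Lemma expsum_minus_1_bound (M : nat) (t : R) : (0 < t < 1)%R ->
  (Cmod (expsum M t - 1) <= / INR (fact M) * t ^ S M)%R.
Proof.
  intros Ht.
  assert (E : expsum M t - 1 = - (Cexp (- RtoC t) * (Cexp (RtoC t) - sum_n (fun m => RtoC t ^ m / factC m) M))).
  { unfold expsum. assert (X : Cexp (- RtoC t) * Cexp (RtoC t) = 1).
    { rewrite <- Cexp_plus. replace (- RtoC t + RtoC t) with (RtoC 0) by ring. apply Cexp_0. }
    rewrite <- X at 1. ring. }
  rewrite E, Cmod_opp, Cmod_mult, Cmod_Cexp_neg.
  assert (X := exp_taylor (RtoC t) M). rewrite Cmod_RtoC_pos in X by lra.
  apply Rle_trans with (exp (- t) * (exp t * t * (t ^ M / INR (fact M))))%R.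
  - apply Rmult_le_compat_l; [left; apply exp_pos|exact X].
  - right. assert (Y : (exp (- t) * exp t = 1)%R) by (rewrite <- exp_plus, Rplus_opp_l; apply exp_0).
    simpl pow. transitivity (exp (- t) * exp t * (t * (t ^ M * / INR (fact M))))%R; [unfold Rdiv; ring|].
    rewrite Y. ring.
Qed.

Lemma tame_id_pow (n M : nat) : tame Unit n (INR M) 0 (fun t => RtoC t ^ M).
Proof.
  assert (X := tame_pow Unit n 1 0 _ M (tame_id n)). rewrite Rmult_0_r, Rmult_1_r in X. exact X.
Qed.

Lemma tame_expsum_minus_1 (n M : nat) : tame Unit n (INR M) 0 (fun t => expsum M t - 1).
Proof.
  assert (HB : exists C0, (0 <= C0)%R /\ forall t, dom Unit t ->
    (Cmod (expsum M t - 1)%C <= C0 * (Rpower (tau Unit t) (INR M) * Rpower (wt Unit t) 0))%R).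
  { exists (/ INR (fact M))%R. split; [left; apply Rinv_0_lt_compat, INR_fact_lt_0|].
    intros t Ht. simpl in Ht. eapply Rle_trans; [apply expsum_minus_1_bound; auto|].
    apply Rmult_le_compat_l; [left; apply Rinv_0_lt_compat, INR_fact_lt_0|].
    simpl tau. rewrite Rpower_0_r, Rmult_1_r, Rpower_pow by lra. simpl.
    assert (0 < t ^ M)%R by (apply pow_lt; lra). nra. }
  assert (D : forall t, der (fun t => expsum M t - 1) t (- (/ factC M) * (RtoC t ^ M * Cexp (- RtoC t)))).
  { intros t. eapply der_eq; [apply der_minus; [apply der_expsum|apply der_const]|]. ring. }
  destruct n as [|n]; split; auto.
  - intros. eapply der_cont, D.
  - exists (fun t => - (/ factC M) * (RtoC t ^ M * Cexp (- RtoC t))). split; auto.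
    apply tame_scal. eapply tame_weaken.
    + apply (tame_mult Unit n (INR M) 0 0 0 (fun t => RtoC t ^ M)); [apply tame_id_pow|apply tame_exp_unit].
    + lra.
    + lra.
Qed.

Lemma tame_expsum_half (n M : nat) (q : R) : tame Half n 0 q (expsum M).
Proof.
  apply tame_ext with (fun t => sum_n (fun j => / factC j * (RtoC t ^ j * Cexp (- RtoC t))) M).
  - intros t _. unfold expsum. rewrite <- Csum_scal. apply Csum_ext. intros; unfold Cdiv; ring.
  - apply (tame_sum Half n 0 q (fun j t => / factC j * (RtoC t ^ j * Cexp (- RtoC t)))).
    intros j _. apply tame_scal.
    apply tame_ext with (fun t => Cpower (RtoC t) (natC j) * Cexp (- RtoC t)).
    + intros t Ht. rewrite Cpower_nat; auto. apply offcut_pos. exact Ht.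
    + assert (X := tame_mult Half n _ _ 0 (q + INR j) _ _ (tame_power_half n (natC j)) (tame_exp_half n (q + INR j))).
      eapply tame_weaken; [exact X| |]; unfold natC, Re; simpl; generalize (pos_INR j); lra.
Qed.

(** Both functions are 1 to high order at 0, so the difference can be
    integrated by parts many times. *)
Lemma tame_expsum_minus_cutoff (n M : nat) (K q : R) (chi : R -> C) : (0 <= K <= INR M)%R -> (INR n + 2 <= K)%R ->
  cutoff n K chi -> tame Half n K q (fun t => expsum M t - ext0 chi t).
Proof.
  intros HK Hn [H1 H2]. apply (tame_glue n K 0 q 0); [lra| |].
  - apply tame_ext with (fun t => (expsum M t - 1) + (1 - chi t)).
    + intros t Ht. rewrite ext0_in by exact Ht. ring.
    + apply tame_plus; auto. eapply tame_weaken; [apply tame_expsum_minus_1|lra|lra].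
  - apply tame_minus; [apply tame_expsum_half|]. apply tame_ext0 with K; auto.
Qed.

Lemma expsum_laplace (z : C) (M : nat) (lam : R) : (0 < Re z)%R ->
  nint Half (fun t => Cpower (RtoC t) (z - 1) * expsum M t * Cexp (Ci * RtoC (lam * t)))
    (Gamma z * sum_n (fun j => poch z j / factC j * Cpower (1 - Ci * RtoC lam) (- z - natC j)) M).
Proof.
  intros Hz. rewrite <- Csum_scal.
  rewrite (Csum_ext _ (fun j => / factC j * laplace (z + natC j) lam)).
  2:{ intros j _. rewrite laplace_eq, Gamma_plus_nat by (auto; apply Re_natC_pos; auto).
      replace (- (z + natC j)) with (- z - natC j) by ring. unfold Cdiv. ring. }
  eapply nint_ext; [|apply (nint_sum Half (fun j t => / factC j * laplace_kernel (z + natC j) lam t))].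
  - intros t Ht. cbv beta. unfold expsum.
    transitivity (Cpower (RtoC t) (z - 1) * Cexp (- RtoC t) * Cexp (Ci * RtoC (lam * t)) *
       sum_n (fun j => RtoC t ^ j / factC j) M); [|ring].
    rewrite <- Csum_scal. apply Csum_ext. intros j _. unfold laplace_kernel.
    replace (z + natC j - 1) with (z - 1 + natC j) by ring.
    rewrite Cpower_plus, Cpower_nat by (apply offcut_pos; exact Ht). unfold Cdiv. ring.
  - intros j _. apply nint_scal, laplace_spec, Re_natC_pos; auto.
Qed.

Lemma Cmod_1_minus_i (u lam : R) : (Rabs lam <= Cmod (RtoC u - Ci * RtoC lam))%R.
Proof.
  eapply Rle_trans; [|apply im_le_Cmod]. unfold Im; simpl.
  right. rewrite <- Rabs_Ropp. f_equal. ring.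
Qed.

(** The sum is the Taylor polynomial of (p - 1) ^ (- z) at p = 1 - i lam, and
    |p| >= |lam|. *)
Lemma laplace_sum_limit (z : C) (M : nat) : (0 < Re z)%R ->
  exists K, (0 <= K)%R /\ forall lam, (1 <= Rabs lam)%R ->
    (Cmod (Cpower (- Ci * RtoC lam) (- z) -
       sum_n (fun j => (poch z j / factC j * Cpower (1 - Ci * RtoC lam) (- z - natC j))%C) M)
     <= K / Rabs lam ^ M)%R.
Proof.
  intros Hz. set (K0 := exp (Rabs (Im z) * PI)).
  assert (PK0 : (0 < K0)%R) by apply exp_pos.
  assert (P1 : (0 <= Cmod (poch z (S M)) / INR (fact M))%R).
  { apply Rmult_le_pos; [apply Cmod_ge_0|left; apply Rinv_0_lt_compat, INR_fact_lt_0]. }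
  exists (K0 * (Cmod (poch z (S M)) / INR (fact M)))%R. split; [apply Rmult_le_pos; lra|].
  intros lam Hl. set (p := 1 - Ci * RtoC lam).
  assert (Hp : (Rabs lam <= Cmod p)%R) by apply (Cmod_1_minus_i 1).
  assert (Eq : forall u, p - RtoC u * 1 = RtoC (1 - u) - Ci * RtoC lam) by (intros; unfold p; rewrite RtoC_minus; ring).
  assert (Il : (0 < / Cmod p)%R) by (apply Rinv_0_lt_compat; lra).
  assert (Il1 : (/ Cmod p <= / Rabs lam)%R) by (apply Rinv_le_contravar; lra).
  assert (Il2 : (/ Rabs lam <= 1)%R) by (rewrite <- Rinv_1; apply Rinv_le_contravar; lra).
  assert (X := power_taylor p 1 z M (/ Cmod p) K0).
  replace (p - 1) with (- Ci * RtoC lam) in X by (unfold p; ring).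
  rewrite (Csum_ext _ (fun j => poch z j / factC j * Cpower p (- z - natC j))) in X
    by (intros; rewrite Cpow_1_l; ring).
  eapply Rle_trans; [apply X|].
  - intros u Hu. rewrite Eq. apply offcut_im. unfold Im; simpl. intros Z.
    assert (E : lam = 0%R) by lra. rewrite E, Rabs_R0 in Hl. lra.
  - lra.
  - rewrite Cmod_1, Rinv_l; lra.
  - intros u Hu. rewrite Cmod_1, Rmult_1_l, Eq, Cmod_Cpower. unfold K0. apply exp_le_compat.
    assert (Y := Cmod_1_minus_i (1 - u) lam). set (w := RtoC (1 - u) - Ci * RtoC lam) in *.
    assert (L : (0 <= ln (Cmod w))%R) by (rewrite <- ln_1; apply ln_le; lra).
    assert (A := Carg_bound w).
    replace (Re (- z - 1)) with (- (Re z + 1))%R by (unfold Re; simpl; ring).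
    replace (Im (- z - 1)) with (- Im z)%R by (unfold Im; simpl; ring).
    assert (Q : (Im z * Carg w <= Rabs (Im z) * PI)%R).
    { eapply Rle_trans; [apply Rle_abs|]. rewrite Rabs_mult. apply Rmult_le_compat_l; [apply Rabs_pos|auto]. }
    nra.
  - unfold Rdiv. rewrite !Rmult_assoc. apply Rmult_le_compat_l; [lra|].
    apply Rmult_le_compat_l; [apply Cmod_ge_0|].
    apply Rmult_le_compat_l; [left; apply Rinv_0_lt_compat, INR_fact_lt_0|].
    rewrite <- pow_inv. apply pow_incr. lra.
Qed.

(** Replace [chi] by [expsum]: the difference is negligible by
    [tame_fourier_decay] and the main part is [expsum_laplace]. *)
Lemma cutoff_power_fourier (N : nat) (K : R) (chi : R -> C) (z : C) : (0 < Re z)%R ->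
  cutoff N K chi -> (INR N + 2 <= K)%R ->
  exists K0, (0 <= K0)%R /\ forall lam, (1 <= Rabs lam)%R ->
    exists v, nint Unit (fun t => Cpower (RtoC t) (z - 1) * chi t * Cexp (Ci * RtoC (lam * t))) v /\
      (Cmod (v - Gamma z * Cpower (- Ci * RtoC lam) (- z)) <= K0 / Rabs lam ^ N)%R.
Proof.
  intros Hz Hchi HK. assert (PN := pos_INR N).
  destruct (INR_unbounded K) as [M0 HM0]. set (M := (M0 + N)%nat).
  assert (HM : (K <= INR M)%R) by (unfold M; rewrite plus_INR; lra).
  assert (HNM : (N <= M)%nat) by (unfold M; lia).
  set (q := (INR N + 2 + Re (z - 1))%R).
  assert (HV := tame_expsum_minus_cutoff N M K q chi ltac:(lra) HK Hchi).
  assert (HW := tame_mult Half N _ _ _ _ _ _ (tame_power_half N (z - 1)) HV).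
  assert (Ez : Re (z - 1) = (Re z - 1)%R) by reflexivity.
  destruct (tame_fourier_decay Half N (Re (z - 1) + K) (- Re (z - 1) + q) _ ltac:(rewrite Ez; lra) ltac:(unfold q; rewrite Ez; lra) HW) as [K1 [P1 H1]].
  destruct (tame_fourier_bound Half N (Re (z - 1) + K) (- Re (z - 1) + q) _ ltac:(rewrite Ez; lra) ltac:(unfold q; rewrite Ez; lra) HW) as [HI _].
  destruct (laplace_sum_limit z M Hz) as [K2 [P2 H2]].
  exists (K1 + Cmod (Gamma z) * K2)%R.
  split; [apply Rplus_le_le_0_compat; [auto|apply Rmult_le_pos; [apply Cmod_ge_0|auto]]|].
  intros lam Hl. assert (Nl : lam <> 0%R) by (intros E; rewrite E, Rabs_R0 in Hl; lra).
  destruct (HI lam) as [d Hd].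
  assert (HE := expsum_laplace z M lam Hz).
  set (v0 := Gamma z * sum_n (fun j => poch z j / factC j * Cpower (1 - Ci * RtoC lam) (- z - natC j)) M) in *.
  exists (v0 - d). split.
  - apply nint_ext0_restrict. eapply nint_ext; [|apply (nint_minus _ _ _ _ _ HE Hd)].
    intros t Ht. simpl in Ht. cbv beta. destruct (Rlt_dec t 1) as [L|L].
    + rewrite !ext0_in by lra. ring.
    + rewrite !ext0_out by lra. ring.
  - specialize (H1 lam d Nl Hd). specialize (H2 lam Hl).
    set (S0 := sum_n (fun j => poch z j / factC j * Cpower (1 - Ci * RtoC lam) (- z - natC j)) M : C) in *.
    set (c := Cpower (- Ci * RtoC lam) (- z)) in *.
    assert (E : v0 - d - Gamma z * c = - (d + Gamma z * (c - S0))) by (unfold v0; ring).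
    rewrite E, Cmod_opp. eapply Rle_trans; [apply Cmod_triangle|]. rewrite Cmod_mult.
    unfold Rdiv. rewrite Rmult_plus_distr_r. apply Rplus_le_compat; [exact H1|].
    rewrite Rmult_assoc. apply Rmult_le_compat_l; [apply Cmod_ge_0|].
    eapply Rle_trans; [exact H2|]. apply Rmult_le_compat_l; auto.
    apply Rinv_le_contravar; [apply pow_lt; lra|]. apply Rle_pow; auto.
Qed.

(** The Taylor polynomial of the regular factor is integrated term by term by
    [cutoff_power_fourier]; its remainder has N + 1 further powers of t, so
    that N integrations by parts are possible. *)
Lemma endpoint_expansion (N : nat) (K : R) (chi : R -> C) (a s b x : C) : (0 < Re a)%R -> offcut (1 - x) ->
  cutoff N K chi -> (INR N + 2 + Rabs (Re s) <= K)%R ->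
  exists K0, (0 <= K0)%R /\ forall lam, (1 <= Rabs lam)%R ->
    exists v, nint Unit (fun t => Cpower (RtoC t) (a - 1) * chi t * regular_factor s b x t * Cexp (Ci * RtoC (lam * t))) v /\
      (Cmod (v - sum_n (fun k => (regular_coef s b x k * (Gamma (a + natC k) * Cpower (- Ci * RtoC lam) (- (a + natC k))))%C) N)
         <= K0 / Rabs lam ^ N)%R.
Proof.
  intros Ha Hx Hchi HK. assert (PN := pos_INR N). assert (Ps := Rabs_pos (Re s)).
  assert (HV := tame_mult Unit N _ _ _ _ _ _ (tame_mult Unit N _ _ _ _ _ _ (tame_power_unit N (a - 1)) (proj1 Hchi))
     (tame_regular_rem N (S N) s b x Hx)).
  assert (Ea : Re (a - 1) = (Re a - 1)%R) by reflexivity.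
  assert (ES := S_INR N).
  destruct (tame_fourier_decay Unit N (Re (a - 1) + 0 + INR (S N)) (0 + K + - Rabs (Re s)) _ ltac:(rewrite Ea; lra) ltac:(lra) HV) as [K1 [P1 H1]].
  destruct (tame_fourier_bound Unit N (Re (a - 1) + 0 + INR (S N)) (0 + K + - Rabs (Re s)) _ ltac:(rewrite Ea; lra) ltac:(lra) HV) as [HI _].
  assert (HZ : forall k, exists K0, (0 <= K0)%R /\ forall lam, (1 <= Rabs lam)%R ->
    exists v, nint Unit (fun t => Cpower (RtoC t) (a + natC k - 1) * chi t * Cexp (Ci * RtoC (lam * t))) v /\
      (Cmod (v - Gamma (a + natC k) * Cpower (- Ci * RtoC lam) (- (a + natC k))) <= K0 / Rabs lam ^ N)%R).
  { intros k. apply (cutoff_power_fourier N K chi); auto; [apply Re_natC_pos; auto|lra]. }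
  assert (HS : forall n, exists K0, (0 <= K0)%R /\ forall lam, (1 <= Rabs lam)%R ->
    exists v, nint Unit (fun t => sum_n (fun k => regular_coef s b x k *
         (Cpower (RtoC t) (a + natC k - 1) * chi t * Cexp (Ci * RtoC (lam * t)))) n) v /\
      (Cmod (v - sum_n (fun k => (regular_coef s b x k * (Gamma (a + natC k) * Cpower (- Ci * RtoC lam) (- (a + natC k))))%C) n)
         <= K0 / Rabs lam ^ N)%R).
  { assert (Step : forall k, exists K0, (0 <= K0)%R /\ forall lam, (1 <= Rabs lam)%R ->
      exists v, nint Unit (fun t => regular_coef s b x k *
         (Cpower (RtoC t) (a + natC k - 1) * chi t * Cexp (Ci * RtoC (lam * t)))) v /\
      (Cmod (v - regular_coef s b x k * (Gamma (a + natC k) * Cpower (- Ci * RtoC lam) (- (a + natC k))))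
         <= K0 / Rabs lam ^ N)%R).
    { intros k. destruct (HZ k) as [K0 [P0 H0]]. exists (Cmod (regular_coef s b x k) * K0)%R.
      split; [apply Rmult_le_pos; [apply Cmod_ge_0|auto]|].
      intros lam Hl. destruct (H0 lam Hl) as [v [Hv Bv]]. exists (regular_coef s b x k * v).
      split; [apply nint_scal; auto|].
      replace (regular_coef s b x k * v - regular_coef s b x k * (Gamma (a + natC k) * Cpower (- Ci * RtoC lam) (- (a + natC k))))
        with (regular_coef s b x k * (v - Gamma (a + natC k) * Cpower (- Ci * RtoC lam) (- (a + natC k)))) by ring.
      rewrite Cmod_mult. unfold Rdiv. rewrite Rmult_assoc. apply Rmult_le_compat_l; [apply Cmod_ge_0|exact Bv]. }
    induction n as [|n [K0 [P0 H0]]].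
    - destruct (Step 0%nat) as [K0 [P0 H0]]. exists K0. split; auto. intros lam Hl.
      destruct (H0 lam Hl) as [v [Hv Bv]]. exists v. rewrite Csum_O. split; auto.
      eapply nint_ext; [|exact Hv]. intros t _. cbv beta. rewrite Csum_O. reflexivity.
    - destruct (Step (S n)) as [K2 [P2 H2]]. exists (K0 + K2)%R. split; [lra|]. intros lam Hl.
      destruct (H0 lam Hl) as [v [Hv Bv]]. destruct (H2 lam Hl) as [v' [Hv' Bv']].
      exists (v + v'). split.
      + eapply nint_ext; [|apply nint_plus; [exact Hv|exact Hv']]. intros t _. cbv beta.
        rewrite Csum_S. reflexivity.
      + rewrite Csum_S. match goal with |- (Cmod (v + v' - (?A + ?B)) <= _)%R =>
          replace (v + v' - (A + B)) with ((v - A) + (v' - B)) by ring end.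
        eapply Rle_trans; [apply Cmod_triangle|]. unfold Rdiv in *. rewrite Rmult_plus_distr_r.
        apply Rplus_le_compat; auto. }
  destruct (HS N) as [K2 [P2 H2]].
  exists (K1 + K2)%R. split; [lra|]. intros lam Hl.
  assert (Nl : lam <> 0%R) by (intros E; rewrite E, Rabs_R0 in Hl; lra).
  destruct (H2 lam Hl) as [v [Hv Bv]]. destruct (HI lam) as [r Hr]. specialize (H1 lam r Nl Hr).
  exists (r + v). split.
  - eapply nint_ext; [|apply nint_plus; [exact Hr|exact Hv]]. intros t Ht. simpl in Ht. cbv beta.
    unfold regular_rem. simpl regular_taylor.
    rewrite (Csum_ext (fun k => regular_coef s b x k * (Cpower (RtoC t) (a + natC k - 1) * chi t * _))
      (fun k => Cpower (RtoC t) (a - 1) * chi t * Cexp (Ci * RtoC (lam * t)) *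
      (regular_coef s b x k * RtoC t ^ k))).
    + rewrite Csum_scal. ring.
    + intros k _. replace (a + natC k - 1) with (a - 1 + natC k) by ring.
      rewrite Cpower_plus, Cpower_nat by (apply offcut_pos; lra). ring.
  - match goal with |- (Cmod (r + v - ?A) <= _)%R => replace (r + v - A) with (r + (v - A)) by ring end.
    eapply Rle_trans; [apply Cmod_triangle|]. unfold Rdiv in *. rewrite Rmult_plus_distr_r.
    apply Rplus_le_compat; auto.
Qed.

(** * The expansion from both ends *)

Lemma pfaff_offcut (x : C) : offcut (1 - x) -> offcut (1 - x / (x - 1)).
Proof.
  intros Hx. assert (N := offcut_neq_0 _ Hx).
  assert (N' : x - 1 <> 0) by (intros Z; apply N; replace (1 - x) with (- (x - 1)) by ring; rewrite Z; ring).
  replace (1 - x / (x - 1)) with (/ (1 - x)) by (field; auto). apply offcut_inv; auto.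
Qed.

(** The quotient of the two sides has derivative zero in s and equals 1 at s =
    0. *)
Lemma power_split (x w : C) (s : R) : offcut (1 - x) -> (0 <= s <= 1)%R ->
  Cpower (1 - x * RtoC (1 - s)) w = Cpower (1 - x) w * Cpower (1 - x / (x - 1) * RtoC s) w.
Proof.
  intros Hx Hs. assert (N := offcut_neq_0 _ Hx).
  assert (N' : x - 1 <> 0) by (intros Z; apply N; replace (1 - x) with (- (x - 1)) by ring; rewrite Z; ring).
  set (x' := x / (x - 1)). assert (Hx' : offcut (1 - x')) by (apply pfaff_offcut; auto).
  set (h := fun s => Cpower (1 - x * RtoC (1 - s)) w * Cpower (1 - x' * RtoC s) (- w)).
  assert (E : h 0%R = h s).
  { apply der_zero_const; [lra|]. intros t Ht. unfold h.
    assert (H1 : offcut (1 - x * RtoC (1 - t))) by (apply offcut_segment; auto; lra).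
    assert (H2 : offcut (1 - x' * RtoC t)) by (apply offcut_segment; auto; lra).
    eapply der_eq.
    - apply der_mult.
      + apply (der_comp (fun t => Cpower (1 - x * RtoC t) w) (fun t => (1 - t)%R) t (-1)%R).
        * apply der_linear_power; exact H1.
        * auto_derive; [auto|ring].
      + apply der_linear_power; exact H2.
    - cbv beta. rewrite (Cpower_pred _ w H1), (Cpower_pred _ (- w) H2).
      set (p := Cpower (1 - x * RtoC (1 - t)) (w - 1)). set (q := Cpower (1 - x' * RtoC t) (- w - 1)).
      rewrite RtoC_minus. unfold x'. field. auto. }
  unfold h in E. replace (1 - x * RtoC (1 - 0)) with (1 - x) in E by (rewrite Rminus_0_r; ring).
  replace (1 - x' * RtoC 0) with (RtoC 1) in E by ring.
  rewrite Cpower_one_base, Cpower_opp, Cmult_1_r in E. rewrite E. field. apply Cpower_neq_0.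
Qed.

Definition term0 (a b c x : C) (lam : R) (n : nat) : C :=
  coeff0 a b c x n * poch a n / factC n * Cpower (- Ci * lam) (- a - natC n).

Definition term1 (a b c x : C) (lam : R) (n : nat) : C :=
  coeff1 a b x n * poch (c - a) n / factC n * Cpower (Ci * lam) (a - c - natC n).

Lemma Gamma_ratio (a c : C) : (0 < Re a)%R -> (0 < Re (c - a))%R ->
  / Beta a (c - a) * Gamma a = Gamma c / Gamma (c - a) /\
  / Beta a (c - a) * Gamma (c - a) = Gamma c / Gamma a.
Proof.
  intros Ha Hca. assert (E := Gamma_mult_Beta a (c - a) Ha Hca).
  replace (a + (c - a)) with c in E by ring.
  assert (N1 := Gamma_neq_0 a Ha). assert (N2 := Gamma_neq_0 (c - a) Hca).
  assert (N3 := Beta_neq_0 a (c - a) Ha Hca).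
  assert (Ec : Gamma c = Gamma a * Gamma (c - a) / Beta a (c - a)) by (rewrite E; field; auto).
  rewrite Ec. split; field; auto.
Qed.

Lemma endpoint_sum0 (a b c x : C) (lam : R) (N : nat) : (0 < Re a)%R -> (0 < Re (c - a))%R -> offcut (1 - x) ->
  / Beta a (c - a) * sum_n (fun k => regular_coef (1 - (c - a)) b x k *
      (Gamma (a + natC k) * Cpower (- Ci * RtoC lam) (- (a + natC k)))) N
  = Gamma c / Gamma (c - a) * sum_n (term0 a b c x lam) N.
Proof.
  intros Ha Hca Hx. destruct (Gamma_ratio a c Ha Hca) as [E _]. rewrite <- E, <- !Csum_scal.
  apply Csum_ext. intros k _. unfold term0. rewrite coeff0_eq, Gamma_plus_nat by auto.
  replace (1 - (c - a)) with (a - c + 1) by ring. replace (- (a + natC k)) with (- a - natC k) by ring.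
  assert (N1 := factC_neq_0 k). assert (N3 := Beta_neq_0 a (c - a) Ha Hca). field. auto.
Qed.

Lemma endpoint_sum1 (a b c x : C) (lam : R) (N : nat) : (0 < Re a)%R -> (0 < Re (c - a))%R -> offcut (1 - x) ->
  / Beta a (c - a) * (Cexp (Ci * lam) * Cpower (1 - x) (- b) *
    sum_n (fun k => regular_coef (1 - a) b (x / (x - 1)) k *
      (Gamma (c - a + natC k) * Cpower (- Ci * RtoC (- lam)) (- (c - a + natC k)))) N)
  = Gamma c / Gamma a * Cexp (Ci * lam) * sum_n (term1 a b c x lam) N.
Proof.
  intros Ha Hca Hx. destruct (Gamma_ratio a c Ha Hca) as [_ E]. rewrite <- E, <- !Csum_scal.
  apply Csum_ext. intros k _. unfold term1. rewrite coeff1_eq, Gamma_plus_nat by auto.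
  replace (- Ci * RtoC (- lam)) with (Ci * lam) by (rewrite RtoC_opp; ring).
  replace (- (c - a + natC k)) with (a - c - natC k) by ring.
  assert (N1 := factC_neq_0 k). assert (N3 := Beta_neq_0 a (c - a) Ha Hca). field. auto.
Qed.

(** Split the integral by [chi] and 1 - [chi]. The second part is of the first
    kind after t -> 1 - t, which exchanges a and c - a, replaces x by x / (x -
    1) and lam by - lam, and brings out exp (i lam) (1 - x) ^ (- b). *)
Lemma Phi1_expansion (a b c x : C) (N : nat) : (0 < Re a)%R -> (0 < Re (c - a))%R -> offcut (1 - x) ->
  exists K0, (0 <= K0)%R /\ forall lam : R, (1 <= Rabs lam)%R ->
    (Cmod (Phi1 a b c x (Ci * lam)
       - (Gamma c / Gamma (c - a) * sum_n (term0 a b c x lam) N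
          + Gamma c / Gamma a * Cexp (Ci * lam) * sum_n (term1 a b c x lam) N)) <= K0 / Rabs lam ^ N)%R.
Proof.
  intros Ha Hca Hx. set (be := c - a) in *.
  destruct (INR_unbounded (INR N + 2 + Rabs (Re (1 - be)) + Rabs (Re (1 - a)))) as [K1 HK1].
  destruct (cutoff_exists N K1) as [chi Hchi]. assert (Hchi' := cutoff_reflect _ _ _ Hchi).
  assert (P1 := Rabs_pos (Re (1 - be))). assert (P2 := Rabs_pos (Re (1 - a))).
  assert (Hx' := pfaff_offcut x Hx).
  assert (HS := S_INR K1).
  destruct (endpoint_expansion N (INR (S K1)) chi a (1 - be) b x Ha Hx Hchi ltac:(lra)) as [L0 [PL0 H0]].
  destruct (endpoint_expansion N (INR (S K1)) _ be (1 - a) b (x / (x - 1)) Hca Hx' Hchi' ltac:(lra)) as [L1 [PL1 H1]].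
  set (B := Cmod (/ Beta a be)). assert (PB : (0 <= B)%R) by apply Cmod_ge_0.
  set (om := Cmod (Cpower (1 - x) (- b))). assert (Pom : (0 <= om)%R) by apply Cmod_ge_0.
  exists (B * (L0 + om * L1))%R.
  split; [apply Rmult_le_pos; [auto|apply Rplus_le_le_0_compat; [auto|apply Rmult_le_pos; auto]]|].
  intros lam Hl.
  destruct (H0 lam Hl) as [v0 [Hv0 B0]].
  destruct (H1 (- lam)%R ltac:(rewrite Rabs_Ropp; exact Hl)) as [v1 [Hv1 B1]].
  rewrite Rabs_Ropp in B1.
  set (S0 := sum_n _ N : C) in B0. set (S1 := sum_n _ N : C) in B1.
  assert (EI : euler_int a (- b) be x (fun t => Cexp (Ci * lam * RtoC t)) =
    v0 + Cexp (Ci * lam) * Cpower (1 - x) (- b) * v1).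
  { apply Nint_eq. eapply nint_ext; [|apply nint_plus; [exact Hv0|apply nint_scal, nint_reflect; exact Hv1]].
    intros t Ht. simpl in Ht. cbv beta. unfold regular_factor, beta_kernel.
    assert (PS := power_split x (- b) (1 - t) Hx ltac:(lra)).
    replace (1 - (1 - t))%R with t in PS |- * by ring.
    replace (1 - RtoC (1 - t)) with (RtoC t) by (rewrite RtoC_minus; ring).
    replace (1 - RtoC t) with (RtoC (1 - t)) by (rewrite RtoC_minus; ring).
    rewrite PS. replace (- (1 - be)) with (be - 1) by ring. replace (- (1 - a)) with (a - 1) by ring.
    replace (Ci * lam * RtoC t) with (Ci * RtoC (lam * t)) by (rewrite RtoC_mult; ring).
    replace (Cexp (Ci * RtoC (lam * t))) with (Cexp (Ci * lam) * Cexp (Ci * RtoC (- lam * (1 - t)))).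
    2:{ rewrite <- Cexp_plus. f_equal. rewrite !RtoC_mult, RtoC_minus, RtoC_opp. ring. }
    ring. }
  rewrite Phi1_integral by auto. fold be. rewrite EI.
  assert (E0 := endpoint_sum0 a b c x lam N Ha Hca Hx).
  assert (E1 := endpoint_sum1 a b c x lam N Ha Hca Hx). fold be in E0, E1.
  rewrite <- E0, <- E1. fold S0. fold S1.
  replace (/ Beta a be * (v0 + Cexp (Ci * lam) * Cpower (1 - x) (- b) * v1) -
    (/ Beta a be * S0 + / Beta a be * (Cexp (Ci * lam) * Cpower (1 - x) (- b) * S1)))
    with (/ Beta a be * ((v0 - S0) + Cexp (Ci * lam) * Cpower (1 - x) (- b) * (v1 - S1))) by ring.
  rewrite Cmod_mult. fold B. unfold Rdiv. rewrite Rmult_assoc. apply Rmult_le_compat_l; auto.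
  eapply Rle_trans; [apply Cmod_triangle|]. rewrite !Cmod_mult, Cmod_Cexp_i, Rmult_1_l. fold om.
  rewrite Rmult_plus_distr_r. apply Rplus_le_compat; [exact B0|].
  rewrite Rmult_assoc. apply Rmult_le_compat_l; auto.
Qed.

(** * Size of the terms and the theorem *)

Lemma Cmod_i_mult (lam : R) : Cmod (Ci * lam) = Rabs lam /\ Cmod (- Ci * lam) = Rabs lam.
Proof. rewrite !Cmod_mult, Cmod_opp, Cmod_Ci, Cmod_R. split; ring. Qed.

Lemma offcut_i_mult (lam : R) : lam <> 0%R -> offcut (Ci * lam) /\ offcut (- Ci * lam).
Proof. intros H. split; apply offcut_im; unfold Im; simpl; intros Z; apply H; lra. Qed.

Lemma Cpower_modulus_bounds (z w : C) : z <> 0 ->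
  (exp (- (Rabs (Im w) * PI)) * Rpower (Cmod z) (Re w) <= Cmod (Cpower z w) <=
   exp (Rabs (Im w) * PI) * Rpower (Cmod z) (Re w))%R.
Proof.
  intros Hz. rewrite Cmod_Cpower. unfold Rpower. rewrite <- !exp_plus.
  assert (Q : (Rabs (Im w * Carg z) <= Rabs (Im w) * PI)%R).
  { rewrite Rabs_mult. apply Rmult_le_compat_l; [apply Rabs_pos|apply Carg_bound]. }
  apply Rabs_le_between in Q. split; apply exp_le_compat; lra.
Qed.

Lemma Cpower_decay (z w : C) (n : nat) : (1 <= Cmod z)%R -> offcut z -> (0 <= Re w)%R ->
  (Cmod (Cpower z (- w - natC n)) <= exp (Rabs (Im w) * PI) / Cmod z ^ n)%R.
Proof.
  intros H1 Ho Hw. assert (N := offcut_neq_0 z Ho).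
  rewrite Cpower_sub_nat by auto. rewrite Cmod_div, Cmod_pow by (apply Cpow_nz; auto).
  apply Rmult_le_compat_r; [left; apply Rinv_0_lt_compat, pow_lt; lra|].
  eapply Rle_trans; [apply Cpower_modulus_bounds; auto|].
  replace (Im (- w)) with (- Im w)%R by reflexivity. rewrite Rabs_Ropp.
  rewrite <- (Rmult_1_r (exp _)) at 2. apply Rmult_le_compat_l; [left; apply exp_pos|].
  rewrite <- exp_0. unfold Rpower. apply exp_le_compat.
  assert (0 <= ln (Cmod z))%R by (rewrite <- ln_1; apply ln_le; lra).
  replace (Re (- w)) with (- Re w)%R by reflexivity. nra.
Qed.

Lemma inverse_power_sum (ka : nat -> C) (N : nat) : ka 0%nat = 1 ->
  exists K, forall z, (1 <= Cmod z)%R ->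
    (Cmod (sum_n (fun n => (ka n / z ^ n)%C) N - 1) <= K / Cmod z)%R.
Proof.
  intros H0. induction N as [|N [K HK]].
  - exists 0%R. intros z Hz. rewrite Csum_O, H0. simpl. replace (1 / 1 - 1) with (RtoC 0) by field.
    rewrite Cmod_0. lra.
  - exists (K + Cmod (ka (S N)))%R. intros z Hz. rewrite Csum_S.
    assert (Nz : z <> 0) by (intros Z; rewrite Z, Cmod_0 in Hz; lra).
    replace (sum_n (fun n => ka n / z ^ n) N + ka (S N) / z ^ S N - 1)
      with (sum_n (fun n => ka n / z ^ n) N - 1 + ka (S N) / z ^ S N) by ring.
    eapply Rle_trans; [apply Cmod_triangle|]. unfold Rdiv. rewrite Rmult_plus_distr_r.
    apply Rplus_le_compat; [apply HK; auto|].
    rewrite Cmod_div, Cmod_pow by (apply Cpow_nz; auto).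
    apply Rmult_le_compat_l; [apply Cmod_ge_0|]. apply Rinv_le_contravar; [lra|].
    simpl. rewrite <- (Rmult_1_r (Cmod z)) at 1. apply Rmult_le_compat_l; [lra|]. apply pow_R1_Rle; auto.
Qed.

Theorem theorem3p4 (a b c x : C)
  (Ha : (0 < Re a)%R) (Hac : (Re a < Re c)%R)
  (Hx : x <> 1) (Harg : (Rabs (Carg (1 - x)) < PI)%R) :
  (forall N : nat, (1 <= N)%nat ->
     bigO_inv_pow N (fun lam : R =>
       Phi1 a b c x (Ci * lam)
       - (Gamma c / Gamma (c - a)
            * sum_n (fun n =>
                coeff0 a b c x n * poch a n / factC n
                * Cpower (- Ci * lam) (- a - natC n)) (N - 1)
          + Gamma c / Gamma a * Cexp (Ci * lam)
            * sum_n (fun n =>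
                coeff1 a b x n * poch (c - a) n / factC n
                * Cpower (Ci * lam) (a - c - natC n)) (N - 1))))
  /\
  sim_sum (fun lam : R => Phi1 a b c x (Ci * lam))
    (fun lam : R => Gamma c / Gamma (c - a) * Cpower (- Ci * lam) (- a))
    (fun lam : R =>
       Gamma c / Gamma a * Cpower (1 - x) (- b)
       * Cpower (Ci * lam) (a - c) * Cexp (Ci * lam)).
Proof.
  assert (Hca : (0 < Re (c - a))%R) by (unfold Re in *; simpl; lra).
  assert (Hox : offcut (1 - x)).
  { apply NNPP. intros N. apply offcut_not in N. destruct N as [N1 N2].
    (* on the cut the argument is PI *)
    assert (Nz : 1 - x <> 0) by (intros Z; apply Hx; replace x with (1 - (1 - x)) by ring; rewrite Z; ring).
    assert (P := proj1 (Cmod_gt_0 _) Nz). assert (S := Cmod_sqr (1 - x)). rewrite N1 in S.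
    assert (E : Re (1 - x) = (- Cmod (1 - x))%R) by nra.
    unfold Carg in Harg. rewrite N1, E in Harg. destruct (Rle_dec 0 0); [|lra].
    replace (- Cmod (1 - x) / Cmod (1 - x))%R with (- (1))%R in Harg by (field; lra).
    rewrite acos_opp, acos_1, Rabs_right in Harg; generalize PI_RGT_0; lra. }
  set (G0 := Gamma c / Gamma (c - a)). set (G1 := Gamma c / Gamma a).
  assert (Hc : (0 < Re c)%R) by lra.
  assert (NG : Gamma c <> 0) by (apply Gamma_neq_0; auto).
  assert (NG0 : G0 <> 0).
  { intros Z. apply NG. replace (Gamma c) with (G0 * Gamma (c - a)) by (unfold G0; field; apply Gamma_neq_0; auto).
    rewrite Z. ring. }
  assert (NG1 : G1 <> 0).
  { intros Z. apply NG. replace (Gamma c) with (G1 * Gamma a) by (unfold G1; field; apply Gamma_neq_0; auto).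
    rewrite Z. ring. }
  split.
  - intros N HN. destruct N as [|N]; [lia|]. replace (S N - 1)%nat with N by lia.
    destruct (Phi1_expansion a b c x (S N) Ha Hca Hox) as [K0 [P0 H0]]. fold G0 G1 in H0.
    (* the last terms are absorbed by the error *)
    set (k0 := coeff0 a b c x (S N) * poch a (S N) / factC (S N)).
    set (k1 := coeff1 a b x (S N) * poch (c - a) (S N) / factC (S N)).
    exists (K0 + (Cmod (G0 * k0) * exp (Rabs (Im a) * PI) + Cmod (G1 * k1) * exp (Rabs (Im (c - a)) * PI)))%R, 1%R.
    split; [lra|]. intros lam Hl. specialize (H0 lam Hl).
    assert (Nl : lam <> 0%R) by (intros E; rewrite E, Rabs_R0 in Hl; lra).
    destruct (Cmod_i_mult lam) as [M1 M0]. destruct (offcut_i_mult lam Nl) as [O1 O0].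
    fold (term0 a b c x lam). fold (term1 a b c x lam).
    rewrite !Csum_S in H0.
    change (fun n => coeff0 a b c x n * poch a n / factC n * Cpower (- Ci * lam) (- a - natC n)) with (term0 a b c x lam).
    change (fun n => coeff1 a b x n * poch (c - a) n / factC n * Cpower (Ci * lam) (a - c - natC n)) with (term1 a b c x lam).
    set (S0 := sum_n (term0 a b c x lam) N : C) in *. set (S1 := sum_n (term1 a b c x lam) N : C) in *.
    set (T0 := term0 a b c x lam (S N)) in *. set (T1 := term1 a b c x lam (S N)) in *.
    set (Ph := Phi1 a b c x (Ci * lam)) in *. set (ex := Cexp (Ci * lam)) in *.
    replace (Ph - (G0 * S0 + G1 * ex * S1)) with
      (Ph - (G0 * (S0 + T0) + G1 * ex * (S1 + T1)) + (G0 * T0 + G1 * ex * T1)) by ring.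
    eapply Rle_trans; [apply Cmod_triangle|]. unfold Rdiv. rewrite Rmult_plus_distr_r.
    apply Rplus_le_compat; [exact H0|].
    eapply Rle_trans; [apply Cmod_triangle|]. rewrite Rmult_plus_distr_r. apply Rplus_le_compat.
    + replace (G0 * T0) with (G0 * k0 * Cpower (- Ci * lam) (- a - natC (S N))) by (unfold T0, term0, k0; ring).
      rewrite (Cmod_mult (G0 * k0)), Rmult_assoc. apply Rmult_le_compat_l; [apply Cmod_ge_0|].
      assert (X := Cpower_decay (- Ci * lam) a (S N)). rewrite M0 in X. apply X; auto. lra.
    + replace (G1 * ex * T1) with (G1 * k1 * ex * Cpower (Ci * lam) (- (c - a) - natC (S N))).
      2:{ unfold T1, term1, k1. replace (- (c - a)) with (a - c) by ring. ring. }
      rewrite (Cmod_mult (G1 * k1 * ex)), (Cmod_mult (G1 * k1)). unfold ex. rewrite Cmod_Cexp_i, Rmult_1_r, Rmult_assoc.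
      apply Rmult_le_compat_l; [apply Cmod_ge_0|].
      assert (X := Cpower_decay (Ci * lam) (c - a) (S N)). rewrite M1 in X. apply X; auto. lra.
  - set (om := Cpower (1 - x) (- b)). assert (Nom : om <> 0) by apply Cpower_neq_0.
    (* the order is so large that the error is smaller than the first term by a factor 1 / lam *)
    destruct (INR_unbounded (Re a + 1)) as [N HN].
    destruct (Phi1_expansion a b c x N Ha Hca Hox) as [K0 [P0 H0]]. fold G0 G1 in H0.
    set (k0 := fun n => coeff0 a b c x n * poch a n / factC n).
    set (k1 := fun n => coeff1 a b x n * poch (c - a) n / factC n / om).
    assert (F0 : factC 0 = 1) by reflexivity.
    assert (Ek0 : k0 0%nat = 1).
    { unfold k0. rewrite coeff0_eq, regular_coef_0, F0 by auto. simpl. field. }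
    assert (Ek1 : k1 0%nat = 1).
    { unfold k1. rewrite coeff1_eq, regular_coef_0, F0 by auto. simpl. fold om. field. auto. }
    destruct (inverse_power_sum k0 N Ek0) as [C0 HC0]. destruct (inverse_power_sum k1 N Ek1) as [C1 HC1].
    set (A := fun lam : R => G0 * Cpower (- Ci * lam) (- a)).
    set (err := fun lam : R => Phi1 a b c x (Ci * lam) -
       (G0 * sum_n (term0 a b c x lam) N + G1 * Cexp (Ci * lam) * sum_n (term1 a b c x lam) N)).
    set (s0 := fun lam : R => sum_n (fun n => k0 n / (- Ci * lam) ^ n) N - 1 : C).
    set (s1 := fun lam : R => sum_n (fun n => k1 n / (Ci * lam) ^ n) N - 1 : C).
    exists (fun lam => s0 lam + err lam / A lam), s1.
    assert (NA : forall lam, A lam <> 0) by (intros; apply Cmult_neq_0; [auto|apply Cpower_neq_0]).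
    split; [|split].
    + set (g := (Cmod G0 * exp (- (Rabs (Im a) * PI)))%R).
      assert (Pg : (0 < g)%R) by (apply Rmult_lt_0_compat; [apply Cmod_gt_0; auto|apply exp_pos]).
      exists (C0 + K0 / g)%R, 1%R. split; [lra|]. intros lam Hl. rewrite pow_1.
      assert (Nl : lam <> 0%R) by (intros E; rewrite E, Rabs_R0 in Hl; lra).
      destruct (Cmod_i_mult lam) as [M1 M0]. destruct (offcut_i_mult lam Nl) as [O1 O0].
      eapply Rle_trans; [apply Cmod_triangle|]. unfold Rdiv at 1. rewrite Rmult_plus_distr_r.
      apply Rplus_le_compat.
      { specialize (HC0 (- Ci * lam)). rewrite M0 in HC0. apply HC0; auto. }
      rewrite Cmod_div by auto.
      assert (LA : (g * Rpower (Rabs lam) (- Re a) <= Cmod (A lam))%R).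
      { unfold A, g. rewrite Cmod_mult, Rmult_assoc. apply Rmult_le_compat_l; [apply Cmod_ge_0|].
        rewrite <- M0. assert (X := Cpower_modulus_bounds (- Ci * lam) (- a) (offcut_neq_0 _ O0)).
        replace (Im (- a)) with (- Im a)%R in X by reflexivity. rewrite Rabs_Ropp in X. apply X. }
      assert (PR := Rpower_pos (Rabs lam) (- Re a)).
      assert (PN : (0 < Rabs lam ^ N)%R) by (apply pow_lt; lra).
      apply Rle_trans with (K0 / Rabs lam ^ N * / (g * Rpower (Rabs lam) (- Re a)))%R.
      { apply Rmult_le_compat; [apply Cmod_ge_0| |apply (H0 lam Hl)|].
        - left; apply Rinv_0_lt_compat, Cmod_gt_0; auto.
        - apply Rinv_le_contravar; [apply Rmult_lt_0_compat; auto|exact LA]. }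
      replace (K0 / Rabs lam ^ N * / (g * Rpower (Rabs lam) (- Re a)))%R
        with (K0 * / g * / (Rabs lam ^ N * Rpower (Rabs lam) (- Re a)))%R by (field; repeat split; lra).
      apply Rmult_le_compat_l; [apply Rmult_le_pos; [auto|left; apply Rinv_0_lt_compat; auto]|].
      apply Rinv_le_contravar; [lra|].
      rewrite <- Rpower_pow by lra. rewrite <- Rpower_plus.
      rewrite <- (Rpower_1 (Rabs lam)) at 1 by lra. apply Rle_Rpower; lra.
    + exists C1, 1%R. split; [lra|]. intros lam Hl. rewrite pow_1.
      destruct (Cmod_i_mult lam) as [M1 M0].
      specialize (HC1 (Ci * lam)). rewrite M1 in HC1. apply HC1; auto.
    + exists 1%R. intros lam Hl.
      assert (Nl : lam <> 0%R) by (intros E; rewrite E, Rabs_R0 in Hl; lra).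
      destruct (offcut_i_mult lam Nl) as [O1 O0].
      assert (E0 : G0 * sum_n (term0 a b c x lam) N = A lam * (1 + s0 lam)).
      { unfold s0, A. rewrite (Csum_ext (term0 a b c x lam) (fun n => Cpower (- Ci * lam) (- a) * (k0 n / (- Ci * lam) ^ n))).
        - rewrite Csum_scal. ring.
        - intros n _. unfold term0. rewrite Cpower_sub_nat by auto. unfold k0, Cdiv. ring. }
      assert (E1 : G1 * Cexp (Ci * lam) * sum_n (term1 a b c x lam) N =
        G1 * om * Cpower (Ci * lam) (a - c) * Cexp (Ci * lam) * (1 + s1 lam)).
      { unfold s1. rewrite (Csum_ext (term1 a b c x lam) (fun n => om * Cpower (Ci * lam) (a - c) * (k1 n / (Ci * lam) ^ n))).
        - rewrite Csum_scal. ring.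
        - intros n _. unfold term1. rewrite Cpower_sub_nat by auto. unfold k1.
          assert (N1 := factC_neq_0 n). assert (N2 := Cpow_nz _ n (offcut_neq_0 _ O1)). field. auto. }
      fold (A lam). rewrite <- E1.
      replace (A lam * (1 + (s0 lam + err lam / A lam))) with (A lam * (1 + s0 lam) + err lam) by (field; auto).
      rewrite <- E0. unfold err. ring.
Qed.
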